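(* For every integer $k\geqslant 2$, every integer $m\geqslant 4$ and every positive integer $d$, neither the minimal operator system $\bigl(\mathrm{Mat}_k(\mathbb C)_+\bigr)^{\min}$ over the cone of positive semidefinite $k\times k$ matrices nor the minimal operator system $\mathcal L_m^{\min}$ over the $m$-dimensional Lorentz cone is $d$-subhomogeneous.
   Context: For a finite-dimensional ordered real vector space $(V,P,u)$ (a finite-dimensional real vector space $V$, a convex cone $P\subseteq V$ of positive elements with $P\cap(-P)=\{0\}$, and an order unit $u$), the minimal operator system $P^{\min}$ over $P$ is given by the matrix cones, for $s\geqslant1$, $$P_s^{\min}=\Bigl\{\sum_{\nu=1}^N p_\nu\otimes b_\nu \;\Big|\; N\in\mathbb N,\ p_\nu\in P,\ b_\nu\in \mathrm{Mat}_s(\mathbb C)_+\Bigr\}\subseteq V\otimes_{\mathbb R}\mathrm{Her}_s(\mathbb C),$$ with order unit $u$. Here $\mathrm{Her}_s(\mathbb C)$ is the real vector space of Hermitian $s\times s$ matrices and $\mathrm{Mat}_s(\mathbb C)_+\subseteq\mathrm{Her}_s(\mathbb C)$ is the cone of positive semidefinite matrices. An operator system $T$ is $d$-subhomogeneous if it admits a unital complete order embedding into $\mathrm{Mat}_d(A)$ for some commutative $C^*$-algebra $A$. For $T=P^{\min}$ this means: there are a unital commutative $C^*$-algebra $A$ and a real-linear map $\varphi$ from $V$ to the self-adjoint elements of $\mathrm{Mat}_d(A)$ with $\varphi(u)=1$ such that, for every $s\geqslant1$ and every $x\in V\otimes\mathrm{Her}_s(\mathbb C)$, one has $x\in P_s^{\min}$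 if and only if $(\varphi\otimes\mathrm{id})(x)\geqslant0$ in $\mathrm{Mat}_d(A)\otimes\mathrm{Mat}_s(\mathbb C)$. The cone $\mathrm{Mat}_k(\mathbb C)_+\subseteq\mathrm{Her}_k(\mathbb C)$ is equipped with the order unit $I_k$. For $m\geqslant2$, the Lorentz cone is $\mathcal L_m=\{(t,x)\in\mathbb R\times\mathbb R^{m-1}\mid t\geqslant\|x\|_2\}$, with order unit $(1,0)$. *)

(* Defs.v *)
From HB Require Import structures.
From mathcomp Require Import all_boot all_order all_algebra.
From mathcomp Require Import complex mxtens.
From mathcomp Require Import boolp classical_sets reals.

Set Implicit Arguments.
Unset Strict Implicit.
Unset Printing Implicit Defensive.

Import Order.TTheory GRing.Theory Num.Theory.

Local Open Scope classical_set_scope.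
Local Open Scope complex_scope.
Local Open Scope sesquilinear_scope.
Local Open Scope ring_scope.

(* The zero algebra is excluded because comAlgType requires 1 != 0. *)
Record comCStarAlgebra (R : realType) := ComCStarAlgebra {
  cstar_alg :> comAlgType R[i];
  cnorm : cstar_alg -> R;
  star : cstar_alg -> cstar_alg;
  cnorm_eq0 : forall a, cnorm a = 0 -> a = 0;
  cnormD_le : forall a b, cnorm (a + b) <= cnorm a + cnorm b;
  cnormZ : forall (c : R[i]) a, cnorm (c *: a) = ComplexField.Normc.normc c * cnorm a;
  cnormM_le : forall a b, cnorm (a * b) <= cnorm a * cnorm b;
  cnorm_complete : forall a_ : nat -> cstar_alg,
    (forall e : R, 0 < e -> exists N : nat, forall p q : nat,
       (N <= p)%N -> (N <= q)%N -> cnorm (a_ p - a_ q) < e) ->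
    exists a, forall e : R, 0 < e -> exists N : nat, forall p : nat,
       (N <= p)%N -> cnorm (a_ p - a) < e;
  starK : forall a, star (star a) = a;
  starD : forall a b, star (a + b) = star a + star b;
  starZ : forall (c : R[i]) a, star (c *: a) = conjc c *: star a;
  starM : forall a b, star (a * b) = star b * star a;
  cnorm_starM : forall a, cnorm (star a * a) = cnorm a ^+ 2 }.

Definition starmx (R : realType) (A : comCStarAlgebra R) (n : nat)
  (M : 'M[A]_n) : 'M[A]_n := (map_mx (@star R A) M)^T.

(* Positivity in the C*-algebra Mat_n(A). *)
Definition mx_ge0 (R : realType) (A : comCStarAlgebra R) (n : nat)
  (M : 'M[A]_n) : Prop := exists N : 'M[A]_n, M = starmx N *m N.

Record herm (R : realType) (n : nat) := Herm {
  herm_mx :> 'M[R[i]]_n;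
  _ : herm_mx \is hermsymmx }.

Section HermVect.
Context {R : realType} {n : nat}.
Implicit Types (H K : herm R n) (a b : R).

HB.instance Definition _ := [isSub for @herm_mx R n].
HB.instance Definition _ := [Choice of herm R n by <:].

Lemma conjcE (x : R[i]) : x^* = conjc x. Proof. by []. Qed.

Lemma hermP (M : 'M[R[i]]_n) :
  reflect (forall i j, M i j = (M j i)^*) (M \is hermsymmx).
Proof.
apply: (iffP (is_hermitianmxP _ _ _)); rewrite expr0 scale1r.
  by move=> E i j; rewrite {1}E !mxE.
by move=> E; apply/matrixP => i j; rewrite !mxE.
Qed.

Lemma hermE H i j : H i j = (H j i)^*.
Proof. by case: H => M /= /hermP. Qed.

Fact herm0_subproof : (0 : 'M[R[i]]_n) \is hermsymmx.
Proof. by apply/hermP => i j; rewrite !mxE conjC0. Qed.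
Fact hermD_subproof H K : (herm_mx H + herm_mx K) \is hermsymmx.
Proof. by apply/hermP => i j; rewrite !mxE hermE (hermE K) rmorphD. Qed.
Fact hermN_subproof H : (- herm_mx H) \is hermsymmx.
Proof. by apply/hermP => i j; rewrite !mxE hermE rmorphN. Qed.
Fact hermZ_subproof a H : (a%:C *: herm_mx H) \is hermsymmx.
Proof. by apply/hermP => i j; rewrite !mxE hermE rmorphM /= [a%:C^*]conjcE conjc_real. Qed.
Fact herm1_subproof : (1%:M : 'M[R[i]]_n) \is hermsymmx.
Proof. exact: hermitian1mx_subproof. Qed.

Definition herm0 := Herm herm0_subproof.
Definition hermD H K := Herm (hermD_subproof H K).
Definition hermN H := Herm (hermN_subproof H).
Definition hermZ a H := Herm (hermZ_subproof a H).
Definition herm1 := Herm herm1_subproof.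

Fact hermDA : associative hermD.
Proof. by move=> H K L; apply/val_inj; rewrite /= addrA. Qed.
Fact hermDC : commutative hermD.
Proof. by move=> H K; apply/val_inj; rewrite /= addrC. Qed.
Fact herm0D : left_id herm0 hermD.
Proof. by move=> H; apply/val_inj; rewrite /= add0r. Qed.
Fact hermND : left_inverse herm0 hermN hermD.
Proof. by move=> H; apply/val_inj; rewrite /= addNr. Qed.

HB.instance Definition _ :=
  GRing.isZmodule.Build (herm R n) hermDA hermDC herm0D hermND.

Fact hermZA a b H : hermZ a (hermZ b H) = hermZ (a * b) H.
Proof. by apply/val_inj; rewrite /= scalerA rmorphM. Qed.
Fact herm1Z : left_id 1 hermZ.
Proof. by move=> H; apply/val_inj; rewrite /= scale1r. Qed.
Fact hermZDr : right_distributive hermZ +%R.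
Proof. by move=> a H K; apply/val_inj; rewrite /= scalerDr. Qed.
Fact hermZDl H : {morph hermZ^~ H : a b / a + b}.
Proof. by move=> a b; apply/val_inj; rewrite /= rmorphD scalerDl. Qed.

HB.instance Definition _ :=
  GRing.Zmodule_isLmodule.Build R (herm R n) hermZA herm1Z hermZDr hermZDl.

(* Her_n(C) is isomorphic to Mat_n(R): the real part of a Hermitian matrix is
   symmetric and its imaginary part is antisymmetric, so their sum determines
   both. *)
Definition herm_to_real H : 'M[R]_n := \matrix_(i, j) (complex.Re (H i j) + complex.Im (H i j)).

Definition real_to_mx (Q : 'M[R]_n) : 'M[R[i]]_n :=
  \matrix_(i, j) (((Q i j + Q j i) / 2) +i* ((Q i j - Q j i) / 2)).

Fact real_to_mx_subproof Q : real_to_mx Q \is hermsymmx.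
Proof.
by apply/hermP => i j; rewrite !mxE conjcE /= addrC -mulNr opprB.
Qed.

Definition real_to_herm Q : herm R n := Herm (real_to_mx_subproof Q).

Fact herm_to_realK : cancel herm_to_real real_to_herm.
Proof.
move=> H; apply/val_inj/matrixP => i j; rewrite /= !mxE.
rewrite (hermE H j i) conjcE; case: (H i j) => x y /=.
rewrite opprD opprK addrACA subrr addr0 -mulr2n -(mulr_natr x) mulfK ?pnatr_eq0//.
by rewrite addrACA subrr add0r -mulr2n -(mulr_natr y) mulfK ?pnatr_eq0.
Qed.

Fact real_to_hermK : cancel real_to_herm herm_to_real.
Proof.
move=> Q; apply/matrixP => i j; rewrite !mxE /= -mulrDl addrACA subrr addr0.
by rewrite -mulr2n -(mulr_natr (Q i j)) mulfK ?pnatr_eq0.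
Qed.

Fact herm_vect_iso : Vector.axiom (n * n) (herm R n).
Proof.
exists (mxvec \o herm_to_real).
  move=> a H K; rewrite -linearP; congr mxvec; apply/matrixP => i j.
  rewrite !mxE; case: (H i j) (K i j) => x y [z t] /=.
  by rewrite !mul0r subr0 addr0 mulrDr addrACA.
exists (real_to_herm \o vec_mx) => [H|v] /=.
  by rewrite mxvecK herm_to_realK.
by rewrite real_to_hermK vec_mxK.
Qed.

HB.instance Definition _ := Lmodule_hasFinDim.Build R (herm R n) herm_vect_iso.

Definition psd : set (herm R n) :=
  [set H | forall v : 'rV[R[i]]_n, 0 <= (v *m H *m v^t*) 0 0].

End HermVect.

(* V (x) W in coordinates: every element is uniquely sum_i e_i (x) x_i, where
   (e_i) is the basis vbasis {:V} of V and x_i is in W. *)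
Definition tens (R : realType) (V W : vectType R) : vectType R :=
  {ffun 'I_(\dim {:V}) -> W}.

Definition tpure (R : realType) (V W : vectType R) (p : V) (b : W) : tens V W :=
  [ffun i => coord (vbasis {:V}) i p *: b].

Section TensorUniversal.
Context {R : realType} {V W : vectType R}.

Lemma tens_basisE (x : tens V W) :
  x = \sum_(i < \dim {:V}) tpure (vbasis {:V})`_i (x i).
Proof.
apply/ffunP => j; rewrite sum_ffunE (bigD1 j) //= ffunE.
rewrite coord_free ?(basis_free (vbasisP _)) // eqxx scale1r big1 ?addr0 //.
move=> i /negPf ij; rewrite ffunE coord_free ?(basis_free (vbasisP _)) //.
by rewrite ij scale0r.
Qed.

Lemma tpure_linearl (c : R) (p q : V) (b : W) :
  tpure (c *: p + q) b = c *: tpure p b + tpure q b.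
Proof. by apply/ffunP => i; rewrite !ffunE linearP scalerDl scalerA. Qed.

Lemma tpure_linearr (c : R) (p : V) (b b' : W) :
  tpure p (c *: b + b') = c *: tpure p b + tpure p b'.
Proof.
by apply/ffunP => i; rewrite !ffunE scalerDr !scalerA mulrC.
Qed.

Lemma tens_universal (U : lmodType R) (f : V -> W -> U) :
    (forall b, linear (f^~ b)) -> (forall p, linear (f p)) ->
  exists g : {linear tens V W -> U}, forall p b, g (tpure p b) = f p b.
Proof.
move=> fl fr; pose g (x : tens V W) := \sum_(i < \dim {:V}) f (vbasis {:V})`_i (x i).
have gl : linear g.
  move=> c x y; rewrite /g scaler_sumr -big_split; apply: eq_bigr => i _ /=.
  by rewrite !ffunE fr.
pose gM := GRing.isLinear.Build _ _ _ _ g gl.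
pose G : {linear tens V W -> U} := HB.pack g gM.
exists G => p b; rewrite /= /g {2}(coord_vbasis (memvf p)).
pose flM := GRing.isLinear.Build _ _ _ _ (f^~ b) (fl b).
pose F : {linear V -> U} := HB.pack (f^~ b) flM.
rewrite -[RHS]/(F _) linear_sum; apply: eq_bigr => i _.
pose frM := GRing.isLinear.Build _ _ _ _ (f (vbasis {:V})`_i) (fr _).
pose F' : {linear W -> U} := HB.pack (f (vbasis {:V})`_i) frM.
by rewrite linearZ ffunE -[LHS]/(F' _) linearZ.
Qed.

Lemma tens_linear_eq (U : lmodType R) (g h : {linear tens V W -> U}) :
  (forall p b, g (tpure p b) = h (tpure p b)) -> g =1 h.
Proof.
move=> gh x; rewrite (tens_basisE x) !linear_sum.
by apply: eq_bigr => i _; rewrite gh.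
Qed.

End TensorUniversal.

Definition Pmin (R : realType) (V : vectType R) (P : set V) (s : nat) :
    set (tens V (herm R s)) :=
  [set x | exists (N : nat) (p : 'I_N -> V) (b : 'I_N -> herm R s),
     (forall nu, P (p nu) /\ psd (b nu)) /\ x = \sum_nu tpure (p nu) (b nu)].

(* phi (x) id, with Mat_d(A) (x) Mat_s(C) identified with Mat_(d*s)(A) through
   the Kronecker product. *)
Definition ampliation (R : realType) (V : vectType R) (A : comCStarAlgebra R)
    (d s : nat) (phi : V -> 'M[A]_d) (x : tens V (herm R s)) : 'M[A]_(d * s) :=
  \sum_(i < \dim {:V}) phi (vbasis {:V})`_i *t map_mx (in_alg A) (x i).

Definition real_linear (R : realType) (V : vectType R) (A : comCStarAlgebra R)
    (d : nat) (phi : V -> 'M[A]_d) : Prop :=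
  forall (c : R) (v w : V), phi (c *: v + w) = c%:C%:A *: phi v + phi w.

Lemma ampliation_tpure (R : realType) (V : vectType R) (A : comCStarAlgebra R)
    (d s : nat) (phi : V -> 'M[A]_d) (p : V) (b : herm R s) :
  real_linear phi ->
  ampliation phi (tpure p b) = phi p *t map_mx (in_alg A) b.
Proof.
move=> phiL; apply/matrixP => i j; rewrite /ampliation summxE.
have phi0 : phi 0 = 0.
  have := phiL 1 0 0; rewrite scale1r addr0 rmorph1 !scale1r => /esym/eqP.
  by rewrite -subr_eq0 addrK => /eqP.
rewrite mxE {2}(coord_vbasis (memvf p)).
have phi_sum (I : finType) (c : I -> R) (v : I -> V) :
    phi (\sum_k c k *: v k) = \sum_k (c k)%:C%:A *: phi (v k).
  pose T u M := phi u = M.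
  apply: (big_rec2 T) => [//|k u M _ <-]; exact: phiL.
rewrite phi_sum summxE mulr_suml; apply: eq_bigr => k _.
by rewrite !mxE ffunE /= !mxE -mulrA mulrCA -scalerAl mul1r scalerA.
Qed.

Definition Pmin_subhomogeneous (R : realType) (d : nat) (V : vectType R)
    (P : set V) (u : V) : Prop :=
  exists (A : comCStarAlgebra R) (phi : V -> 'M[A]_d),
    [/\ real_linear phi,
        forall v, starmx (phi v) = phi v,
        phi u = 1%:M &
        forall (s : nat) (x : tens V (herm R s)), (1 <= s)%N ->
          (Pmin P x <-> mx_ge0 (ampliation phi x))].

Definition lorentz (R : realType) (m : nat) : set (R^o * 'rV[R]_m.-1)%type :=
  [set tx : R^o * 'rV[R]_m.-1 | Num.sqrt (\sum_j tx.2 0 j ^+ 2) <= tx.1].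

(* Main.v *)
(* Composing with characters of the commutative algebra, d-subhomogeneity makes
   membership in P_s^min detectable by the maps (psi (x) id) with psi : V -> Her_d
   positive and unital. Both cones have the Lorentz cone in R^4 as a unital positive
   retract, so it suffices to work with that cone, whose extreme rays are the points
   (1, p) with p in the sphere S^2.

   Put N = 2 d + 1 and let q_p be the quadratic form on C^2 vanishing at p and -p.
   Multiplication by q_p maps Sym^N to Sym^(N+2), and for the SU(2)-invariant
   hermitian products q_p^* q_p = ((N+2)^2 - J_p^2)/4, where the spin operator J_p has
   odd integer eigenvalues. With kappa = ((N+2)^2 - 1)/4, the affine function
   W(p) = [[kappa, q_p^*], [q_p, 1]] is thus positive semidefinite on S^2, and W(p)
   kills v = (w, - q_p w) when w = l^(d+1) l'^d, with l and l' the eigenvectors of p.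

   These kernel vectors are so plentiful that a d-dimensional psi and a linear map E
   with psi(p) E v = 0 for all of them must have E = 0: such an E intertwines q_p and
   q_p^* with d x d matrices, while the algebra they generate has an element with
   N + 1 > d distinct eigenvalues. So for the sum x0 of finitely many p (x) v v^*, all
   (psi (x) id)(x0) are positive definite, uniformly in psi; then x0 - e u (x) 1 is
   positive in Mat_d(A) (x) Mat_s for small e > 0, but its pairing with W is negative,
   so it does not belong to P_s^min.

   Instead of Gelfand theory, characters are obtained from maximal preorderings of
   the self-adjoint part of A, and square roots of matrices from the Cholesky
   decomposition. *)
Require Import Defs.
From HB Require Import structures.
From mathcomp Require Import all_boot all_order all_algebra.
From mathcomp Require Import complex mxtens ring lra zify.
From mathcomp Require Import boolp classical_sets reals.

Set Implicit Arguments.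
Unset Strict Implicit.
Unset Printing Implicit Defensive.

Import Order.TTheory GRing.Theory Num.Theory.

Local Open Scope classical_set_scope.
Local Open Scope complex_scope.
Local Open Scope sesquilinear_scope.
Local Open Scope ring_scope.

(** * Commutative C*-algebras *)

(** [N] is odd for two reasons. No spin operator then has the eigenvalue 0, so J_p^2 >= 1 and
    [kappa] is the largest eigenvalue of q_p^* q_p, attained at w = l^(d+1) l'^d; that is why W(p)
    is positive and singular at once. Moreover l and l' enter w unequally. For even [N] the
    corresponding vector is a power q_p^n, and the tensors q_p (x) q_p^n span only part of the
    product of the spaces of forms of degrees 2 and [N], whereas for odd [N] the tensors q_p (x) w
    span all of it. Relations that hold at the points of the sphere thus hold for every pair of
    monomials.

    The points in x0 must be fixed before psi is known. As psi(p) E v = 0 is linear in p (x) v, a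
    finite list whose tensors p (x) v span all the others serves every psi and every E at once. *)

Lemma expr_small (R : realType) (r e : R) : 0 <= r < 1 -> 0 < e ->
  exists n : nat, r ^+ n < e.
Proof.
move=> /andP[r0 r1] e0; have [->|rN0] := eqVneq r 0.
  by exists 1; rewrite expr1.
have rgt0 : 0 < r by rewrite lt_def rN0.
have h0 : 0 < r^-1 - 1 by rewrite subr_gt0 invf_gt1.
have bern n : 1 + n%:R * (r^-1 - 1) <= r^-1 ^+ n.
  elim: n => [|n IH]; first by rewrite mul0r addr0 expr0.
  rewrite exprS; apply: le_trans (_ : r^-1 * (1 + n%:R * (r^-1 - 1)) <= _); last first.
    by rewrite ler_wpM2l // invr_ge0.
  have : 0 <= (r^-1 - 1) * (n%:R * (r^-1 - 1)) by rewrite !mulr_ge0 ?ler0n // ltW.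
  rewrite -[n.+1]addn1 natrD; lra.
have q0 : 0 <= e^-1 / (r^-1 - 1) by rewrite divr_ge0 ?invr_ge0 ?ltW.
have := archi_boundP q0; set n := Num.bound _ => Hn.
exists n; rewrite -ltf_pV2 ?posrE ?exprn_gt0 // -exprVn.
apply: lt_le_trans (bern n); rewrite addrC; apply: ltr_wpDr => //.
by rewrite -ltr_pdivrMr.
Qed.

Section CStar.
Variables (R : realType) (A : comCStarAlgebra R).
Implicit Types (a b x y z : A) (r t e : R).

Definition sca (r : R) : A := (r%:C)%:A.

Lemma scaD r t : sca (r + t) = sca r + sca t.
Proof. by rewrite /sca rmorphD scalerDl. Qed.
Lemma scaN r : sca (- r) = - sca r.
Proof. by rewrite /sca rmorphN scaleNr. Qed.
Lemma scaM r t : sca (r * t) = sca r * sca t.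
Proof. by rewrite /sca rmorphM -scalerAl mul1r scalerA. Qed.
Lemma sca1 : sca 1 = 1.
Proof. by rewrite /sca rmorph1 scale1r. Qed.
Lemma sca0 : sca 0 = 0.
Proof. by rewrite /sca rmorph0 scale0r. Qed.
Lemma scaMV r : r != 0 -> sca r * sca r^-1 = 1.
Proof. by move=> r0; rewrite -scaM mulfV // sca1. Qed.

Lemma star0 : star (0 : A) = 0.
Proof. by have := starZ 0 (0 : A); rewrite !scale0r conjc0 scale0r. Qed.
Lemma starN a : star (- a) = - star a.
Proof. by rewrite -scaleN1r starZ -conjcE rmorphN1 scaleN1r. Qed.
Lemma starB a b : star (a - b) = star a - star b.
Proof. by rewrite starD starN. Qed.
Lemma star1 : star (1 : A) = 1.
Proof. by rewrite -[LHS]mulr1 -{2}(starK (1 : A)) -starM mulr1 starK. Qed.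
Lemma star_alg (c : R[i]) : star (c%:A : A) = (conjc c)%:A.
Proof. by rewrite starZ star1. Qed.
Lemma star_sca r : star (sca r) = sca r.
Proof. by rewrite /sca star_alg conjc_real. Qed.
Lemma star_sum (I : Type) (s : seq I) (F : I -> A) :
  star (\sum_(i <- s) F i) = \sum_(i <- s) star (F i).
Proof. by elim/big_rec2: _ => [|i x y _ <-]; rewrite ?star0 ?starD. Qed.

Lemma normc_real r : ComplexField.Normc.normc r%:C = `|r|.
Proof. by rewrite /= expr0n /= addr0 sqrtr_sqr. Qed.
Lemma cnormZr r a : cnorm (sca r * a) = `|r| * cnorm a.
Proof. by rewrite mulr_algl cnormZ normc_real. Qed.
Lemma cnorm0 : cnorm (0 : A) = 0.
Proof. by rewrite -[0 in LHS](mulr0 (sca 0)) cnormZr normr0 mul0r. Qed.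
Lemma cnormN a : cnorm (- a) = cnorm a.
Proof. by rewrite -mulN1r -sca1 -scaN cnormZr normrN1 mul1r. Qed.
Lemma cnorm_ge0 a : 0 <= cnorm a.
Proof. by have := cnormD_le a (- a); rewrite subrr cnorm0 cnormN; lra. Qed.
Lemma cnormB_le a b : cnorm (a - b) <= cnorm a + cnorm b.
Proof. by rewrite -(cnormN b); exact: cnormD_le. Qed.
Lemma cnorm1 : cnorm (1 : A) = 1.
Proof.
have := cnorm_starM (1 : A); rewrite star1 mulr1 => E.
have : cnorm (1 : A) * (cnorm (1 : A) - 1) = 0 by rewrite mulrBr mulr1 -expr2 -E subrr.
move/eqP; rewrite mulf_eq0 => /orP[/eqP/cnorm_eq0 /eqP|]; first by rewrite oner_eq0.
by rewrite subr_eq0 => /eqP.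
Qed.
Lemma cnorm_sca r : cnorm (sca r) = `|r|.
Proof. by rewrite -[sca r]mulr1 cnormZr cnorm1 mulr1. Qed.
(** The C*-identity gives |b|^2 = |b^* b| <= |b^*| |b|; cancel |b| and exchange b with b^*. *)
Lemma cnorm_star a : cnorm (star a) = cnorm a.
Proof.
have H b : cnorm b <= cnorm (star b).
  have := cnorm_starM b; have := cnormM_le (star b) b; have := cnorm_ge0 b.
  rewrite le_eqVlt => /orP[/eqP <- _ _|b0]; first exact: cnorm_ge0.
  by move=> + E; rewrite E expr2 ler_pM2r.
by apply/eqP; rewrite eq_le H andbT -{2}(starK a) H.
Qed.

Definition limit_closed (D : A -> Prop) :=
  forall y, (forall e, 0 < e -> exists2 z, D z & cnorm (z - y) < e) -> D y.

(** Banach's fixed point theorem on a closed subset. It stands in for power series: square roots and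
    inverses of 1 - x are both obtained as fixed points. *)
Lemma contraction (D : A -> Prop) (F : A -> A) r a :
  0 <= r < 1 -> limit_closed D -> D a -> (forall x, D x -> D (F x)) ->
  (forall x y, D x -> D y -> cnorm (F x - F y) <= r * cnorm (x - y)) ->
  exists2 y, D y & F y = y.
Proof.
move=> /andP[r0 r1] Dcl Da DF Fr; pose u n := iter n F a.
have Du n : D (u n) by elim: n => //= n; exact: DF.
pose C := cnorm (F a - a).
have r10 : 0 < 1 - r by rewrite subr_gt0.
have uS n : cnorm (u n.+1 - u n) <= r ^+ n * C.
  elim: n => [|n IH]; first by rewrite expr0 mul1r.
  by rewrite exprS -mulrA; exact: le_trans (Fr (u n.+1) (u n) (Du _) (Du _)) (ler_wpM2l
    r0 IH).
have uk n k : cnorm (u (n + k)%N - u n) <= r ^+ n * (C / (1 - r)) * (1 - r ^+ k).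
  elim: k => [|k IH]; first by rewrite addn0 subrr cnorm0 expr0 subrr mulr0.
  rewrite addnS -(subrK (u (n + k)%N) (u (n + k).+1)) -addrA.
  apply: le_trans (cnormD_le _ _) _; apply: le_trans (lerD (uS _) IH) _.
  rewrite exprD exprS le_eqVlt; apply/orP; left; apply/eqP.
  by field; rewrite gt_eqF.
have C0 : 0 <= C / (1 - r) by rewrite divr_ge0 ?cnorm_ge0 // ltW.
have uk' n k : cnorm (u (n + k)%N - u n) <= r ^+ n * (C / (1 - r)).
  apply: le_trans (uk n k) _; apply: ler_piMr; first by rewrite mulr_ge0 ?exprn_ge0.
  by rewrite lerBlDr lerDl exprn_ge0.
have small e : 0 < e -> exists N, r ^+ N * (C / (1 - r)) < e.
  move=> e0; have K0 : 0 < C / (1 - r) + 1 by rewrite ltr_wpDl.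
  have [||N HN] := @expr_small _ r (e / (C / (1 - r) + 1)); rewrite ?r0 ?r1 ?divr_gt0 //.
  exists N; rewrite ltr_pdivlMr // in HN; apply: le_lt_trans HN.
  by rewrite ler_wpM2l ?exprn_ge0 // lerDl.
have [e e0|y Hy] := @cnorm_complete _ A u.
  have [|N HN] := small (e / 2); first by rewrite divr_gt0.
  exists N => p q Np Nq; rewrite -(subrKA (u N)) -(opprB (u q)).
  apply: le_lt_trans (cnormB_le _ _) _.
  rewrite -(subnKC Np) -(subnKC Nq).
  by have := uk' N (p - N)%N; have := uk' N (q - N)%N; lra.
have Dy : D y.
  by apply: Dcl => e /Hy [N HN]; exists (u N) => //; exact: HN.
exists y => //; apply/eqP; rewrite -subr_eq0; apply/eqP/cnorm_eq0/eqP.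
rewrite eq_le cnorm_ge0 andbT; apply/ler_addgt0Pl => e e0; rewrite addr0.
have [|N HN] := Hy (e / 2); first by rewrite divr_gt0.
have H1 := HN N.+1 (leqnSn _); have H2 := HN N (leqnn _).
rewrite -(subrKA (u N.+1)); apply: le_trans (cnormD_le _ _) _.
have := Fr _ _ Dy (Du N); rewrite -[F (u N)]/(u N.+1).
have : r * cnorm (y - u N) <= cnorm (y - u N) by rewrite ler_piMl ?cnorm_ge0 // ltW.
rewrite -(cnormN (y - _)) opprB; lra.
Qed.

Definition selfadj a := star a = a.
Lemma selfadj_sca r : selfadj (sca r). Proof. exact: star_sca. Qed.
Lemma selfadj0 : selfadj 0. Proof. exact: star0. Qed.
Lemma selfadj1 : selfadj 1. Proof. exact: star1. Qed.
Lemma selfadjD a b : selfadj a -> selfadj b -> selfadj (a + b).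
Proof. by rewrite /selfadj starD => -> ->. Qed.
Lemma selfadjN a : selfadj a -> selfadj (- a).
Proof. by rewrite /selfadj starN => ->. Qed.
Lemma selfadjB a b : selfadj a -> selfadj b -> selfadj (a - b).
Proof. by move=> ? ?; apply: selfadjD => //; apply: selfadjN. Qed.
Lemma selfadjM a b : selfadj a -> selfadj b -> selfadj (a * b).
Proof. by rewrite /selfadj starM => -> ->; rewrite mulrC. Qed.

Lemma selfadj_ball_closed t : limit_closed (fun y => selfadj y /\ cnorm y <= t).
Proof.
move=> y Hy; split.
  apply/eqP; rewrite -subr_eq0; apply/eqP/cnorm_eq0/eqP.
  rewrite eq_le cnorm_ge0 andbT; apply/ler_addgt0Pl => e e0; rewrite addr0.
  have [|z [sz _] zy] := Hy (e / 2); first by rewrite divr_gt0.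
  rewrite -(subrKA z); apply: le_trans (cnormD_le _ _) _.
  by rewrite -{1}sz -starB cnorm_star -(cnormN (y - z)) opprB; lra.
apply/ler_addgt0Pl => e e0; have [z [_ zt] zy] := Hy _ e0.
rewrite -(subrK z y); apply: le_trans (cnormD_le _ _) _.
by rewrite -(cnormN (y - z)) opprB; lra.
Qed.

(* [1 - y] is the square root, where [y] is the fixed point of [y = (x + y^2)/2]. *)
Lemma sqrt_one_sub x : selfadj x -> cnorm x < 1 -> exists2 g, selfadj g & g * g = 1 - x.
Proof.
move=> sx; have := cnorm_ge0 x; move E: (cnorm x) => r r0 x1.
(* On the ball of radius r = |x| the map is stable, as (r + r^2)/2 <= r, and Lipschitz with constant
   r, as y^2 - z^2 = (y + z)(y - z). *)
have [|||||y [sy yr] Ey] := @contraction (fun y => selfadj y /\ cnorm y <= r)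
    (fun y => sca 2^-1 * (x + y * y)) r 0.
- by rewrite r0.
- exact: selfadj_ball_closed.
- by split; [exact: selfadj0|rewrite cnorm0].
- move=> y [sy yr]; split; first by apply: selfadjM;
  [exact: selfadj_sca|exact/selfadjD/selfadjM].
  rewrite cnormZr gtr0_norm ?invr_gt0 //.
  have h1 := cnormD_le x (y * y); have h2 := cnormM_le y y.
  have h3 : cnorm y * cnorm y <= 1 * r by rewrite ler_pM ?cnorm_ge0 //; lra.
  rewrite E in h1; lra.
- move=> y z [_ yr] [_ zr].
  rewrite -mulrBr cnormZr gtr0_norm ?invr_gt0 // opprD addrACA subrr add0r.
  have -> : y * y - z * z = (y + z) * (y - z) by ring.
  have h1 := cnormM_le (y + z) (y - z); have h2 := cnormD_le y z.
  have h3 : cnorm (y + z) * cnorm (y - z) <= (2 * r) * cnorm (y - z).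
    by rewrite ler_wpM2r ?cnorm_ge0 //; lra.
  lra.
exists (1 - y); first by apply: selfadjB => //; exact: selfadj1.
have E2 : sca 2 * y = x + y * y.
  by rewrite -{1}Ey mulrA -scaM mulfV ?pnatr_eq0 // sca1 mul1r.
have -> : (1 - y) * (1 - y) = 1 - sca 2 * y + y * y.
  by rewrite (_ : 2 = 1 + 1) // scaD sca1; ring.
by rewrite E2; ring.
Qed.

(** The Neumann series, as the fixed point of y = 1 + x y. *)
Lemma inv_one_sub x : selfadj x -> cnorm x < 1 -> exists2 g, selfadj g & (1 - x) * g = 1.
Proof.
move=> sx; have := cnorm_ge0 x; move E: (cnorm x) => r r0 x1.
have [||||| y sy Ey] := @contraction selfadj (fun y => 1 + x * y) r 0.
- by rewrite r0.
(* [selfadj_ball_closed] speaks of balls only, so approximants within 1 of [y] are used. *)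
- move=> y Hy; have [|//] := @selfadj_ball_closed (cnorm y + 1) y.
  move=> e e0; have [|z sz zy] := Hy (Num.min e 1); first by rewrite lt_min e0 ltr01.
  move: zy; rewrite lt_min => /andP[zy z1]; exists z => //; split=> //.
  rewrite -(subrK y z); apply: le_trans (cnormD_le _ _) _; lra.
- exact: selfadj0.
- by move=> y sy; apply: selfadjD; [exact: selfadj1|exact: selfadjM].
- move=> y z _ _; have -> : 1 + x * y - (1 + x * z) = x * (y - z) by ring.
  by rewrite -E; exact: cnormM_le.
by exists y => //; rewrite mulrBl mul1r -{1}Ey addrK.
Qed.
End CStar.

(** * Characters *)

Section Characters.
Variables (R : realType) (A : comCStarAlgebra R).
Implicit Types (a b c x y z : A) (r t e : R) (Q : set A).
Local Notation sca := (@sca R A).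

(* After scaling, [1 - d^2] has a self-adjoint root [g], so [d + i g] is unitary
   and hence [g] is a contraction. *)
Lemma sq_ball c : selfadj c -> exists2 t : R, 0 <= t & cnorm (sca t - c * c) <= t.
Proof.
move=> sc; pose s : R := cnorm c + 1.
have c0 := cnorm_ge0 c; have s0 : 0 < s by rewrite /s; lra.
pose d := sca s^-1 * c.
have sd : selfadj d by apply: selfadjM => //; exact: selfadj_sca.
have d1 : cnorm d < 1.
  by rewrite cnormZr gtr0_norm ?invr_gt0 // mulrC ltr_pdivrMr // mul1r /s; lra.
have [|g sg Eg] := @sqrt_one_sub _ _ (d * d) (selfadjM sd sd).
  apply: le_lt_trans (cnormM_le _ _) _.
  by rewrite mulr_ilt1 ?cnorm_ge0.
pose i : A := ('i%C : R[i])%:A; pose u := d + i * g.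
have ii : i * i = -1.
  by rewrite /i -scalerAl mul1r scalerA; apply/eqP; rewrite -expr2 sqr_i scaleN1r.
have si : star i = - i.
  rewrite /i star_alg -scaleNr; congr (_ *: _); apply/eqP.
  by rewrite eq_complex /= oppr0 !eqxx.
have uu : star u * u = 1.
  rewrite /u starD starM sg si sd.
  have -> : (d + g * - i) * (d + i * g) = d * d - (i * i) * (g * g) by ring.
  by rewrite ii Eg; ring.
have u1 : cnorm u = 1.
  have := cnorm_starM u; rewrite uu cnorm1 => /esym/eqP.
  by rewrite sqrf_eq1 => /orP[/eqP//|/eqP E]; have := cnorm_ge0 u; rewrite E; lra.
have g1 : cnorm g <= 1.
  have : cnorm (u - star u) <= 2.
    by apply: le_trans (cnormB_le _ _) _; rewrite cnorm_star u1; lra.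
  have -> : u - star u = sca 2 * (i * g).
    by rewrite /u starD starM sg si sd (_ : 2 = 1 + 1) // scaD sca1; ring.
  rewrite cnormZr gtr0_norm // {1}/i mulr_algl cnormZ.
  have -> : ComplexField.Normc.normc ('i%C : R[i]) = 1.
    by rewrite /= expr0n expr1n add0r sqrtr1.
  by rewrite mul1r; lra.
exists (s * s); first by rewrite mulr_ge0 ?ltW.
have -> : sca (s * s) - c * c = sca (s * s) * (g * g).
  rewrite Eg mulrBr mulr1; congr (_ - _); rewrite /d scaM.
  have -> : sca s * sca s * (sca s^-1 * c * (sca s^-1 * c)) =
    (sca s * sca s^-1) * (sca s * sca s^-1) * (c * c) by ring.
  by rewrite scaMV ?gt_eqF // !mul1r.
rewrite cnormZr ger0_norm ?mulr_ge0 ?(ltW s0) //.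
apply: ler_piMr; first by rewrite mulr_ge0 ?ltW.
apply: le_trans (cnormM_le _ _) _; by rewrite mulr_ile1 ?cnorm_ge0.
Qed.

(** Stands in for the cone of positive elements: closure under addition is built in, whereas for
    single squares it would require functional calculus. *)
Inductive sos : A -> Prop :=
| sos_0 : sos 0
| sos_sq c a : selfadj c -> sos a -> sos (c * c + a).

Lemma sosD a b : sos a -> sos b -> sos (a + b).
Proof.
move=> sosa sosb; elim: sosa => [|c x sc _ IH]; first by rewrite add0r.
by rewrite -addrA; exact: sos_sq.
Qed.

Lemma sos_sqr c : selfadj c -> sos (c * c).
Proof. by move=> sc; rewrite -[c * c]addr0; apply: sos_sq => //; exact: sos_0. Qed.

Lemma sosM a b : sos a -> sos b -> sos (a * b).
Proof.
move=> sosa sosb; elim: sosa => [|c x sc _ IH]; first by rewrite mul0r; exact: sos_0.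
rewrite mulrDl; apply: sosD IH; elim: sosb => [|d y sd _ IH].
  by rewrite mulr0; exact: sos_0.
rewrite mulrDr; have -> : c * c * (d * d) = (c * d) * (c * d) by ring.
by apply: sos_sq => //; exact: selfadjM.
Qed.

Lemma sos_selfadj a : sos a -> selfadj a.
Proof.
by elim=> [|c x sc _ sx]; [exact: selfadj0|apply: selfadjD => //; exact: selfadjM].
Qed.

Lemma sos_sca r : 0 <= r -> sos (sca r).
Proof.
move=> r0; rewrite -(sqr_sqrtr r0) expr2 scaM; apply: sos_sqr; exact: selfadj_sca.
Qed.

Lemma sos1 : sos 1.
Proof. by rewrite -(sca1 A); apply: sos_sca. Qed.

(** The metric form of positivity, |t - a| <= t, passes to sums by the triangle inequality. It
    excludes a = -1, as t + 1 <= t fails. *)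
Lemma sos_ball a : sos a -> exists2 t : R, 0 <= t & cnorm (sca t - a) <= t.
Proof.
elim=> [|c x sc _ [t t0 Ht]]; first by exists 0; rewrite // sca0 subrr cnorm0.
have [r r0 Hr] := sq_ball sc; exists (r + t); first exact: addr_ge0.
rewrite scaD opprD addrACA; apply: le_trans (cnormD_le _ _) _; exact: lerD.
Qed.

Lemma sosN1 : ~ sos (-1).
Proof.
move=> /sos_ball [t t0]; rewrite opprK -(sca1 A) -scaD cnorm_sca ger0_norm; lra.
Qed.

Lemma one_sub_sqr t x : selfadj x -> cnorm x < t -> exists2 g,
  selfadj g & sca t - x = g * g.
Proof.
move=> sx xt; have t0 : 0 < t by apply: le_lt_trans xt; exact: cnorm_ge0.
have [||g sg Eg] := @sqrt_one_sub _ _ (sca t^-1 * x).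
- by apply: selfadjM => //; exact: selfadj_sca.
- by rewrite cnormZr gtr0_norm ?invr_gt0 // mulrC ltr_pdivrMr // mul1r.
exists (sca (Num.sqrt t) * g); first by apply: selfadjM => //; exact: selfadj_sca.
have -> : sca (Num.sqrt t) * g * (sca (Num.sqrt t) * g) =
  (sca (Num.sqrt t) * sca (Num.sqrt t)) * (g * g) by ring.
rewrite -scaM -expr2 sqr_sqrtr ?ltW // Eg mulrBr mulr1 mulrA scaMV ?mul1r //.
exact: lt0r_neq0.
Qed.

Lemma sos_sub t x : selfadj x -> cnorm x < t -> sos (sca t - x).
Proof. by move=> sx xt; have [g sg ->] := one_sub_sqr sx xt; exact: sos_sqr. Qed.

(** With |t - a| <= t, write 1 + a = (1 + t) - (t - a): the subtracted element has norm less than 1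
    + t, so after scaling both the square root and the Neumann inverse exist. *)
Lemma one_add_sos a : sos a ->
  (exists2 g, selfadj g & 1 + a = g * g) /\ (exists2 g, selfadj g & (1 + a) * g = 1).
Proof.
move=> sosa; have [t t0 Ht] := sos_ball sosa.
have sx : selfadj (sca t - a) by apply: selfadjB; [exact: selfadj_sca|exact: sos_selfadj].
have xt : cnorm (sca t - a) < 1 + t by lra.
have E : 1 + a = sca (1 + t) - (sca t - a) by rewrite scaD sca1; ring.
split; first by rewrite E; exact: one_sub_sqr.
have t1 : 0 < 1 + t by lra.
have [||g sg Eg] := @inv_one_sub _ _ (sca (1 + t)^-1 * (sca t - a)).
- by apply: selfadjM => //; exact: selfadj_sca.
- by rewrite cnormZr gtr0_norm ?invr_gt0 // mulrC ltr_pdivrMr // mul1r.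
exists (sca (1 + t)^-1 * g); first by apply: selfadjM => //; exact: selfadj_sca.
rewrite E -[RHS]Eg mulrA; congr (_ * _).
rewrite mulrBl scaMV ?gt_eqF //; ring.
Qed.

Definition preordering Q := [/\ sos `<=` Q, Q `<=` @selfadj R A,
  forall a b, Q a -> Q b -> Q (a + b), forall a b, Q a -> Q b -> Q (a * b) & ~ Q (-1)].

(** In the product of p + a q and p' + a q' the term a^2 q q' stays in [Q], as a^2 is a square. *)
Lemma preordering_adjoin Q a : preordering Q -> selfadj a ->
  (forall p q, Q p -> Q q -> p + a * q != -1) ->
  preordering [set x | exists p q, [/\ Q p, Q q & x = p + a * q]].
Proof.
case=> sQ Qs QD QM QN sA HN; have Q0 : Q 0 by apply: sQ; exact: sos_0.
split=> [x /sQ Qx|x [p [q [Qp Qq ->]]]|_ _ [p [q [Qp Qq ->]]] [p' [q' [Qp' Qq' ->]]]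
  |_ _ [p [q [Qp Qq ->]]] [p' [q' [Qp' Qq' ->]]]|[p [q [Qp Qq E]]]].
- by exists x, 0; split=> //; rewrite mulr0 addr0.
- by apply: selfadjD; [exact: Qs|apply: selfadjM => //; exact: Qs].
- by exists (p + p'), (q + q'); split; [exact: QD|exact: QD|ring].
- exists (p * p' + (a * a) * (q * q')), (p * q' + q * p'); split; last ring.
    by apply: (QD); [exact: QM|apply: (QM); [apply/sQ/sos_sqr|exact: QM]].
  by apply: (QD); exact: QM.
- by have := HN _ _ Qp Qq; rewrite -E eqxx.
Qed.

(** Zorn's lemma. If neither a nor -a belongs to a maximal preordering, then p + a q = -1 and p' - a
    q' = -1; multiplying yields (1 + p)(1 + p') = - a^2 q q', which expresses -1 within the
    preordering. *)
Lemma maximal_preordering Q : preordering Q -> exists Q',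
  [/\ preordering Q', Q `<=` Q' & forall a, selfadj a -> Q' a \/ Q' (- a)].
Proof.
move=> preQ.
pose P := [set B : set A | B = set0 \/ (Q `<=` B /\ preordering B)].
have [|M [PM maxM]] := @Zorn_bigcup A P.
  move=> F FP Ftot.
  have [[B0 [FB0 B0N]]|H] := pselect (exists B, F B /\ B <> set0); last first.
    left; apply/seteqP; split=> // x [B FB Bx].
    by apply: H; exists B; split=> // B0; move: Bx; rewrite B0.
  have FP' B x : F B -> B x -> Q `<=` B /\ preordering B.
    by move=> /FP [->|//].
  have F2 B B' x y : F B -> F B' -> B x -> B' y -> exists2 C, F C & C x /\ C y.
    move=> FB FB' Bx By; have [BB'|BB'] := Ftot _ _ FB FB'.
      by exists B' => //; split=> //; exact: BB'.
    by exists B => //; split=> //; exact: BB'.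
  have [x0 B0x] : exists x, B0 x.
    apply: contrapT => H; apply: B0N; apply/seteqP; split=> // x Bx.
    by exfalso; apply: H; exists x.
  have [QB0 [sB0 B0s B0D B0M B0N1]] := FP' _ _ FB0 B0x.
  right; split=> [x Qx|]; first by exists B0 => //; exact: QB0.
  split.
  - by move=> x sx; exists B0 => //; exact: sB0.
  - by move=> x [B FB Bx]; have [_ [_ Bs _ _ _]] := FP' _ _ FB Bx; exact: Bs.
  - move=> x y [B FB Bx] [B' FB' By]; have [C FC [Cx Cy]] := F2 _ _ _ _ FB FB' Bx By.
    by exists C => //; have [_ [_ _ CD _ _]] := FP' _ _ FC Cx; exact: CD.
  - move=> x y [B FB Bx] [B' FB' By]; have [C FC [Cx Cy]] := F2 _ _ _ _ FB FB' Bx By.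
    by exists C => //; have [_ [_ _ _ CM _]] := FP' _ _ FC Cx; exact: CM.
  - by move=> [B FB Bx]; have [_ [_ _ _ _]] := FP' _ _ FB Bx.
have maxP M' : M `<=` M' -> Q `<=` M' -> preordering M' -> M' `<=` M.
  move=> MM' QM' preM'; apply: contrapT => NM; apply: (maxM M'); last by right.
  by split.
have [M0|[QM preM]] := PM.
  have Q0 : Q 0 by have [sQ _ _ _ _] := preQ; apply: sQ; exact: sos_0.
  by have := maxP Q _ _ preQ 0 Q0; rewrite M0; case.
exists M; split=> // a sA; have [sM Ms MD MM MN] := preM.
have M0 : M 0 by apply: sM; exact: sos_0.
have M1 : M 1 by apply: sM; exact: sos1.
have adjmx b : selfadj b -> ~ M b -> exists p q, [/\ M p, M q & p + b * q = -1].
  move=> sb Mb; apply: contrapT => H; apply: Mb.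
  have MM' : M `<=` [set x | exists p q, [/\ M p, M q & x = p + b * q]].
    by move=> x Mx; exists x, 0; split=> //; rewrite mulr0 addr0.
  apply: (maxP _ MM') => [x /QM /MM' //||].
    apply: preordering_adjoin => // p q Mp Mq; apply/eqP => E.
    by apply: H; exists p, q.
  by exists 0, 1; split=> //; rewrite mulr1 add0r.
have [Ma|Ma] := pselect (M a); first by left.
have [Mna|Mna] := pselect (M (- a)); first by right.
have [p [q [Mp Mq E]]] := adjmx _ sA Ma.
have [p' [q' [Mp' Mq' E']]] := adjmx _ (selfadjN sA) Mna.
exfalso; apply: MN.
have -> : -1 = p + p' + p * p' + (a * a) * (q * q').
  have e1 : a * q = -1 - p by rewrite -E; ring.
  have e2 : a * q' = 1 + p'.
    by rewrite -[LHS]opprK -mulNr (_ : - a * q' = -1 - p'); [ring|rewrite -E'; ring].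
  have -> : (a * a) * (q * q') = (a * q) * (a * q') by ring.
  by rewrite e1 e2; ring.
apply: (MD _ _ (MD _ _ (MD _ _ Mp Mp') (MM _ _ Mp Mp'))).
by apply: (MM); [apply/sM/sos_sqr|exact: MM].
Qed.
End Characters.

(** * The character of a total preordering *)

Definition starchar (R : realType) (A : comCStarAlgebra R)
    (chi : {rmorphism A -> R[i]}) : Prop :=
  (forall c : R[i], chi c%:A = c) /\ forall a, chi (star a) = (chi a)^*.

Section CharacterOfPreordering.
Variables (R : realType) (A : comCStarAlgebra R) (Q : set A).
Implicit Types (a b c x y z : A) (r t e : R).
Local Notation sca := (@sca R A).
Hypotheses (preQ : preordering Q) (totQ : forall a, selfadj a -> Q a \/ Q (- a)).

Let sQ a : sos a -> Q a. Proof. by have [sQ _ _ _ _] := preQ; exact: sQ. Qed.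
Let Qs a : Q a -> selfadj a. Proof. by have [_ Qs _ _ _] := preQ; exact: Qs. Qed.
Let QD a b : Q a -> Q b -> Q (a + b).
Proof. by have [_ _ QD _ _] := preQ; exact: QD. Qed.
Let QM a b : Q a -> Q b -> Q (a * b).
Proof. by have [_ _ _ QM _] := preQ; exact: QM. Qed.
Let Qsca r : 0 <= r -> Q (sca r).
Proof. by move=> ?; apply/sQ/sos_sca. Qed.
Let Qsca_ge0 r : Q (sca r) -> 0 <= r.
Proof.
have [_ _ _ _ QN] := preQ; move=> Qr; rewrite leNgt; apply/negP => r0; apply: QN.
have -> : -1 = sca (- r^-1) * sca r.
  by rewrite -scaM mulNr mulVf ?lt_eqF // scaN sca1.
by apply: QM => //; apply: Qsca; rewrite oppr_ge0 invr_le0 ltW.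
Qed.

Definition infinitesimal a := forall e, 0 < e -> Q (sca e - a) /\ Q (sca e + a).

Lemma infinitesimalD a b : infinitesimal a -> infinitesimal b -> infinitesimal (a + b).
Proof.
move=> Ia Ib e e0; have e2 : 0 < e / 2 by rewrite divr_gt0.
have [a1 a2] := Ia _ e2; have [b1 b2] := Ib _ e2.
have -> : sca e = sca (e / 2) + sca (e / 2) by rewrite -scaD; congr sca; field.
by split; [rewrite opprD|]; rewrite addrACA; exact: QD.
Qed.

Lemma infinitesimalN a : infinitesimal a -> infinitesimal (- a).
Proof. by move=> Ia e /Ia [? ?]; rewrite opprK; split. Qed.

(** By totality b may be taken in [Q]. With b <= t, split e = (e/t) b + (e/t)(t - b); then e + a b
    and e - a b are (e/t + a) b and (e/t - a) b plus an element of [Q]. *)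
Lemma infinitesimalM a b : infinitesimal a -> selfadj b -> infinitesimal (a * b).
Proof.
wlog Qb : b / Q b.
  move=> H Ia sb; have [Qb|Qb] := totQ sb; first exact: H.
  rewrite -(opprK b) mulrN; apply: infinitesimalN; apply: H => //; exact: selfadjN.
move=> Ia sb e e0; pose t : R := cnorm b + 1.
have b0 := cnorm_ge0 b; have t0 : 0 < t by rewrite /t; lra.
have Qtb : Q (sca t - b) by apply/sQ/sos_sub => //; rewrite /t; lra.
have et : 0 < e / t by rewrite divr_gt0.
have [Q1 Q2] := Ia _ et.
have -> : sca e = sca (e / t) * b + sca (e / t) * (sca t - b).
  by rewrite -mulrDr addrC subrK -scaM mulfVK ?gt_eqF.
split.
- have -> : sca (e / t) * b + sca (e / t) * (sca t - b) - a * b =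
     (sca (e / t) - a) * b + sca (e / t) * (sca t - b) by ring.
  by apply: QD; apply: QM => //; apply/Qsca/ltW.
- have -> : sca (e / t) * b + sca (e / t) * (sca t - b) + a * b =
     (sca (e / t) + a) * b + sca (e / t) * (sca t - b) by ring.
  by apply: QD; apply: QM => //; apply/Qsca/ltW.
Qed.

Lemma infinitesimal_sca r : infinitesimal (sca r) -> r = 0.
Proof.
move=> Ir; apply/eqP; rewrite eq_le; apply/andP; split.
  apply/ler_addgt0Pr => e /Ir [+ _]; rewrite -scaN -scaD => /Qsca_ge0; lra.
rewrite -lerN2 oppr0; apply/ler_addgt0Pr => e /Ir [_].
by rewrite -scaD => /Qsca_ge0; lra.
Qed.

(** A Dedekind cut: take the supremum of the reals r with a - r in [Q]. Totality puts r - a in [Q]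
    for r above it. *)
Lemma standard_part_ex a : selfadj a -> exists r, infinitesimal (a - sca r).
Proof.
move=> sA; pose S := [set r | Q (a - sca r)].
have [lo hi] : S (- (cnorm a + 1)) /\ ubound S (cnorm a + 1).
  split.
    have E : a - sca (- (cnorm a + 1)) = sca (cnorm a + 1) - (- a) by rewrite scaN; ring.
    rewrite /S /= E; apply/sQ/sos_sub; first exact: selfadjN.
    by rewrite cnormN; lra.
  move=> r Sr; have Q1 : Q (sca (cnorm a + 1) - a) by apply/sQ/sos_sub => //; lra.
  have := QD Sr Q1; rewrite addrC addrA subrK -scaN -scaD => /Qsca_ge0; lra.
have hS : has_sup S by split; [exists (- (cnorm a + 1))|exists (cnorm a + 1)].
exists (sup S) => e e0; split.
  have NS : ~ S (sup S + e).
    by move=> /(ub_le_sup hS.2); rewrite gerDl leNgt e0.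
  have [|//|H] := @totQ (a - sca (sup S + e)); first by apply: selfadjB => //;
    exact: selfadj_sca.
  by move: H; congr (Q _); rewrite scaD; ring.
have [r Sr Hr] := sup_adherent e0 hS.
have -> : sca e + (a - sca (sup S)) = (a - sca r) + sca (r - sup S + e).
  by rewrite !scaD scaN; ring.
by apply: QD => //; apply: Qsca; lra.
Qed.

(* For a total preordering [Q], [infinitesimal] elements form an ideal of finite
   elements with quotient the reals. *)
Definition standard_part a : R := xget 0 [set r | infinitesimal (a - sca r)].

Lemma standard_partP a : selfadj a -> infinitesimal (a - sca (standard_part a)).
Proof. by move=> /standard_part_ex [r Hr]; rewrite /standard_part;
  case: xgetP => // /(_ r). Qed.

Lemma standard_part_uniq a r : infinitesimal (a - sca r) -> selfadj a -> standard_part a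
  = r.
Proof.
move=> Ir /standard_partP Is; apply/eqP; rewrite -subr_eq0; apply/eqP/infinitesimal_sca.
have -> : sca (standard_part a - r) = (a - sca r) - (a - sca (standard_part a)) by
  rewrite scaD scaN; ring.
by apply: infinitesimalD => //; exact: infinitesimalN.
Qed.

Lemma standard_part_sca r : standard_part (sca r) = r.
Proof.
apply: standard_part_uniq; last exact: selfadj_sca.
by rewrite subrr => e e0; rewrite subr0 addr0; split; apply/Qsca/ltW.
Qed.

Lemma standard_partD a b : selfadj a -> selfadj b -> standard_part (a + b) =
  standard_part a + standard_part b.
Proof.
move=> sA sB; apply: standard_part_uniq; last exact: selfadjD.
by rewrite scaD opprD addrACA; apply: infinitesimalD; exact: standard_partP.
Qed.

Lemma standard_partM a b : selfadj a -> selfadj b -> standard_part (a * b) =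
  standard_part a * standard_part b.
Proof.
move=> sA sB; apply: standard_part_uniq; last exact: selfadjM.
have -> : a * b - sca (standard_part a * standard_part b) =
    (a - sca (standard_part a)) * b + (b - sca (standard_part b)) * sca (standard_part a)
      by rewrite scaM; ring.
apply: infinitesimalD; first by apply: infinitesimalM => //; exact: standard_partP.
by apply: infinitesimalM; [exact: standard_partP|exact: selfadj_sca].
Qed.

Lemma standard_partN a : selfadj a -> standard_part (- a) = - standard_part a.
Proof.
move=> sA; apply: (addrI (standard_part a)); rewrite -standard_partD //;
  last exact: selfadjN.
by rewrite !subrr -(sca0 A) standard_part_sca.
Qed.

Lemma standard_part_ge0 a : Q a -> 0 <= standard_part a.
Proof.
move=> Qa; rewrite -oppr_le0; apply/ler_addgt0Pr => e /(standard_partP (Qs Qa)) [H _].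
by have := QD Qa H; rewrite addrC opprB -addrA subrK -scaD => /Qsca_ge0; lra.
Qed.

Let imA : A := ('i%C : R[i])%:A.
Let imA2 : imA * imA = -1.
Proof.
by rewrite /imA -scalerAl mul1r scalerA; apply/eqP; rewrite -expr2 sqr_i scaleN1r.
Qed.
Let star_imA : star imA = - imA.
Proof.
rewrite /imA star_alg -scaleNr; congr (_ *: _); apply/eqP.
by rewrite eq_complex /= oppr0 !eqxx.
Qed.
Let half2 : sca 2^-1 + sca 2^-1 = 1.
Proof. by rewrite -scaD -(sca1 A); congr sca; field. Qed.

Definition re_part a := sca 2^-1 * (a + star a).
Definition im_part a := sca 2^-1 * (- imA * (a - star a)).

Lemma selfadj_re a : selfadj (re_part a).
Proof. by rewrite /selfadj /re_part starM star_sca starD starK; ring. Qed.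
Lemma selfadj_im a : selfadj (im_part a).
Proof.
by rewrite /selfadj /im_part !starM star_sca starN starB starK star_imA; ring.
Qed.

Lemma re_im a : a = re_part a + imA * im_part a.
Proof.
rewrite /re_part /im_part.
have -> : imA * (sca 2^-1 * (- imA * (a - star a))) =
   - (imA * imA) * (sca 2^-1 * (a - star a)) by ring.
rewrite imA2 opprK mul1r.
have -> : sca 2^-1 * (a + star a) + sca 2^-1 * (a - star a) =
  (sca 2^-1 + sca 2^-1) * a by ring.
by rewrite half2 mul1r.
Qed.

Lemma re_im_uniq x y : selfadj x -> selfadj y ->
  re_part (x + imA * y) = x /\ im_part (x + imA * y) = y.
Proof.
rewrite /selfadj => sx sy; rewrite /re_part /im_part starD starM star_imA sx sy; split.
  rewrite -[RHS]mul1r -half2; ring.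
have -> : sca 2^-1 * (- imA * (x + imA * y - (x + y * - imA))) =
   - (imA * imA) * ((sca 2^-1 + sca 2^-1) * y) by ring.
by rewrite imA2 half2 opprK !mul1r.
Qed.

(** The complex linear extension of [standard_part], which is meaningful on self-adjoint elements
    only. *)
Definition charQ a : R[i] := (standard_part (re_part a) +i* standard_part (im_part a))%C.

Lemma charQ_re_im x y : selfadj x -> selfadj y -> charQ (x + imA * y) = (standard_part x
  +i* standard_part y)%C.
Proof. by move=> sx sy; rewrite /charQ; have [-> ->] := re_im_uniq sx sy. Qed.

Lemma charQ_sa x : selfadj x -> charQ x = (standard_part x)%:C.
Proof.
move=> sx; rewrite -{1}[x]addr0 -(mulr0 imA) charQ_re_im //; last exact: selfadj0.
by rewrite -(sca0 A) standard_part_sca.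
Qed.

Lemma charQ_zmod : zmod_morphism charQ.
Proof.
move=> a b; rewrite {1}(re_im a) {1}(re_im b).
have -> : re_part a + imA * im_part a - (re_part b + imA * im_part b) =
  (re_part a - re_part b) + imA * (im_part a - im_part b) by ring.
have [? ? ? ?] := And4 (selfadj_re a) (selfadj_re b) (selfadj_im a) (selfadj_im b).
rewrite charQ_re_im; [|exact: selfadjB..].
by rewrite !standard_partD ?standard_partN //; exact: selfadjN.
Qed.

Lemma charQ_monoid : monoid_morphism charQ.
Proof.
split; first by rewrite -(sca1 A) charQ_sa; [rewrite standard_part_sca|exact: selfadj_sca].
move=> a b; rewrite {1}(re_im a) {1}(re_im b).
have -> : (re_part a + imA * im_part a) * (re_part b + imA * im_part b) =
  (re_part a * re_part b + (imA * imA) * (im_part a * im_part b)) + imA * (re_part a *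
    im_part b + im_part a * re_part b) by ring.
rewrite imA2 mulN1r.
have [? ? ? ?] := And4 (selfadj_re a) (selfadj_re b) (selfadj_im a) (selfadj_im b).
have [? ? ? ?] := And4 (selfadjM (selfadj_re a) (selfadj_re b)) (selfadjM (selfadj_im a)
  (selfadj_im b))
   (selfadjM (selfadj_re a) (selfadj_im b)) (selfadjM (selfadj_im a) (selfadj_re b)).
rewrite charQ_re_im; [|exact: selfadjB|exact: selfadjD].
rewrite (standard_partD _ (selfadjN _)) // (standard_partD (a := re_part a * im_part b))
  // standard_partN //.
rewrite (standard_partM (selfadj_re a) (selfadj_re b)) (standard_partM (selfadj_re a)
  (selfadj_im b)).
by rewrite (standard_partM (selfadj_im a) (selfadj_re b)) (standard_partM (selfadj_im a)
  (selfadj_im b)).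
Qed.

Lemma exists_char : exists2 chi : {rmorphism A -> R[i]}, starchar chi &
  forall a, Q a -> 0 <= chi a.
Proof.
pose zM := GRing.isZmodMorphism.Build _ _ charQ charQ_zmod.
pose mM := GRing.isMonoidMorphism.Build _ _ charQ charQ_monoid.
pose chi : {rmorphism A -> R[i]} := HB.pack charQ zM mM.
exists chi; last first.
  move=> a Qa; rewrite -[chi a]/(charQ a) charQ_sa ?lecR;
    [exact: standard_part_ge0|exact: Qs].
have chi_sca r : charQ (sca r) = r%:C.
  by rewrite charQ_sa ?standard_part_sca //; exact: selfadj_sca.
split=> [[x y]|a].
  have -> : (x +i* y)%C%:A = sca x + imA * sca y.
    rewrite /imA /sca -scalerAl mul1r scalerA -scalerDl; congr (_ *: _).
    by apply/eqP; rewrite eq_complex /= !(mul0r, mulr0, mul1r, addr0, add0r, subr0) !eqxx.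
  rewrite -[LHS]/(charQ _) charQ_re_im ?standard_part_sca //; exact: selfadj_sca.
rewrite -[LHS]/(charQ _) -[chi a]/(charQ _).
have -> : star a = re_part a + imA * - im_part a.
  by rewrite {1}(re_im a) starD starM star_imA (selfadj_re a) (selfadj_im a); ring.
rewrite charQ_re_im ?standard_partN //;
  [exact: selfadj_im|exact: selfadj_re|exact/selfadjN/selfadj_im].
Qed.
End CharacterOfPreordering.

(** * Elements positive at every character *)

Section Positive.
Variables (R : realType) (A : comCStarAlgebra R).
Implicit Types (a b c x y z : A) (r t e : R).
Local Notation sca := (@sca R A).

Lemma preordering_sos : preordering (@sos R A).
Proof.
split=> //; [exact: sos_selfadj|exact: sosD|exact: sosM|exact: sosN1].
Qed.

(* Otherwise [- a] could be adjoined to the sums of squares, and a maximal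
   preordering containing it would give a character with [chi a <= 0]. So
   [a q = 1 + p] for sums of squares [p] and [q]: then [a] has an inverse [q'] that
   is a sum of squares, and so are [a = a^2 q'] and [t a - 1 = a (t - q')]. *)
Lemma char_pos_sqrt a : selfadj a ->
  (forall chi : {rmorphism A -> R[i]}, starchar chi -> 0 < chi a) ->
  exists b b', [/\ selfadj b, selfadj b', b * b' = 1 & a = b * b].
Proof.
move=> sA Ha.
have [p [q [sp sq E]]] : exists p q, [/\ sos p, sos q & a * q = 1 + p].
  apply: contrapT => H.
  have pre : preordering [set x | exists p q, [/\ sos p, sos q & x = p + (- a) * q]].
    apply: preordering_adjoin (preordering_sos) (selfadjN sA) _ => p q sp sq.
    apply/eqP => E; apply: H; exists p, q; split=> //.
    have -> : a * q = p - (p + - a * q) by ring.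
    by rewrite E; ring.
  have [Q [preQ sQ totQ]] := maximal_preordering pre.
  have [chi schi /(_ (- a))] := exists_char preQ totQ.
  have Qa : Q (- a) by apply: sQ; exists 0, 1; split; [exact: sos_0|exact: sos1|ring].
  by move=> /(_ Qa); rewrite rmorphN oppr_ge0 => /(lt_le_trans (Ha _ schi)); rewrite ltxx.
have [_ [g sg Eg]] := one_add_sos sp.
(* [q * g] is already an inverse of [a]; in this form it is visibly a product of sums of squares. *)
pose q' := (q * (1 + p)) * (g * g).
have sq' : sos q'.
  apply: sosM; last exact: sos_sqr.
  by apply: sosM => //; apply: sosD => //; exact: sos1.
have aq' : a * q' = 1.
  rewrite /q'; have -> : a * (q * (1 + p) * (g * g)) = (a * q) * (1 + p) * (g * g) by ring.
  by rewrite E mulrACA Eg mulr1.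
have sosa : sos a.
  have -> : a = (a * a) * q' by rewrite -mulrA aq' mulr1.
  by apply: sosM => //; exact: sos_sqr.
pose t : R := cnorm q' + 1; have t0 : 0 < t by have := cnorm_ge0 q'; rewrite /t; lra.
have sosp' : sos (sca t * a - 1).
  have -> : sca t * a - 1 = a * (sca t - q') by rewrite mulrBr aq' mulrC.
  by apply: sosM => //; apply: sos_sub; [exact: sos_selfadj|rewrite /t; lra].
(* Since 1 + (t a - 1) = t a, this yields a square root and an inverse of t a. *)
have [[h sh Eh] [h' sh' Eh']] := one_add_sos sosp'.
have Ea : h * h = sca t * a by rewrite -Eh; ring.
have rt : sca (Num.sqrt t^-1) * sca (Num.sqrt t) = 1.
  by rewrite -scaM -sqrtrM ?invr_ge0 ?ltW // mulVf ?gt_eqF // sqrtr1 sca1.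
have rt2 : sca (Num.sqrt t^-1) * sca (Num.sqrt t^-1) = sca t^-1.
  by rewrite -scaM -expr2 sqr_sqrtr // invr_ge0 ltW.
exists (sca (Num.sqrt t^-1) * h), (sca (Num.sqrt t) * (h * h')); split.
- by apply: selfadjM => //; exact: selfadj_sca.
- by apply: selfadjM; [exact: selfadj_sca|exact: selfadjM].
- rewrite mulrACA rt mul1r; have -> : h * (h * h') = h * h * h' by ring.
  by rewrite -Eh.
- rewrite mulrACA rt2 Ea mulrA -scaM mulVf ?gt_eqF // sca1 mul1r //.
Qed.

(** With r = |a^* a| + 1 the element r - a^* a is a square g^2, and a character maps it to r - |chi
    a|^2 = |chi g|^2 >= 0. *)
Lemma char_bound a : exists2 r, 0 < r &
  forall chi : {rmorphism A -> R[i]}, starchar chi -> `|chi a| ^+ 2 <= r%:C.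
Proof.
exists (cnorm (star a * a) + 1) => [|chi [chiZ chis]].
  by rewrite ltr_wpDl ?cnorm_ge0.
have sx : selfadj (star a * a) by rewrite /selfadj starM starK mulrC.
have [|g sg] := @one_sub_sqr _ _ (cnorm (star a * a) + 1) _ sx; first by rewrite ltrDl.
move/(congr1 chi); rewrite rmorphB !rmorphM /= chis chiZ -normCKC => E.
by rewrite -subr_ge0 E -{1}sg chis -normCKC exprn_ge0.
Qed.

End Positive.

Definition posdef (R : realType) n (H : 'M[R[i]]_n) :=
  forall v : 'rV[R[i]]_n, v != 0 -> 0 < (v *m H *m v^t*) 0 0.

(** * Positive matrices over a commutative C*-algebra *)

Section Cholesky.
Variables (R : realType) (A : comCStarAlgebra R).
Local Notation sca := (@sca R A).

(** Rectangular version of [starmx], for blocks; the two are convertible on square matrices. *)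
Definition adjmx m n (M : 'M[A]_(m, n)) : 'M[A]_(n, m) := (map_mx (@star R A) M)^T.

Lemma adjmxE m n (M : 'M[A]_(m, n)) i j : adjmx M i j = star (M j i).
Proof. by rewrite !mxE. Qed.

Lemma adjmxK m n (M : 'M[A]_(m, n)) : adjmx (adjmx M) = M.
Proof. by apply/matrixP => i j; rewrite !adjmxE starK. Qed.

Lemma adjmxM m n p (M : 'M[A]_(m, n)) (N : 'M[A]_(n, p)) :
  adjmx (M *m N) = adjmx N *m adjmx M.
Proof.
apply/matrixP => i j; rewrite adjmxE !mxE star_sum; apply: eq_bigr => k _.
by rewrite !adjmxE starM.
Qed.

Lemma adjmxB m n (M N : 'M[A]_(m, n)) : adjmx (M - N) = adjmx M - adjmx N.
Proof.
apply/matrixP => i j; rewrite [RHS]mxE [X in _ = _ + X]mxE !adjmxE !mxE.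
by rewrite starB.
Qed.

Lemma adjmxZ m n c (M : 'M[A]_(m, n)) : adjmx (c *: M) = star c *: adjmx M.
Proof.
by apply/matrixP => i j; rewrite adjmxE [in LHS]mxE [RHS]mxE adjmxE starM mulrC.
Qed.

Lemma adjmx_block m1 m2 n1 n2 (Mul : 'M[A]_(m1, n1)) Mur Mdl (Mdr : 'M_(m2, n2)) :
  adjmx (block_mx Mul Mur Mdl Mdr) = block_mx (adjmx Mul) (adjmx Mdl) (adjmx Mur) (adjmx
    Mdr).
Proof. by rewrite /adjmx map_block_mx tr_block_mx. Qed.

Lemma adjmx0 m n : adjmx (0 : 'M[A]_(m, n)) = 0.
Proof. by apply/matrixP => i j; rewrite adjmxE !mxE star0. Qed.

Lemma adjmx_scalar n (c : A) : adjmx (c%:M : 'M_n) = (star c)%:M.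
Proof.
apply/matrixP => i j; rewrite adjmxE !mxE eq_sym.
by case: (i == j); rewrite // !mulr0n star0.
Qed.

Lemma map_adjmx (chi : {rmorphism A -> R[i]}) m n (M : 'M[A]_(m, n)) :
  starchar chi -> map_mx chi (adjmx M) = (map_mx chi M)^t*.
Proof. by move=> [_ chis]; apply/matrixP => i j; rewrite !mxE chis. Qed.

(** Induction by the Schur complement. The pivot is positive at every character, hence equal to b^2
    with b invertible, and the Schur complement is again positive definite at every character. *)
Lemma cholesky n (M : 'M[A]_n) : adjmx M = M ->
  (forall chi : {rmorphism A -> R[i]}, starchar chi -> posdef (map_mx chi M)) ->
  exists N N' : 'M[A]_n, M = adjmx N *m N /\ N' *m N = 1%:M.
Proof.
elim: n M => [|n IH] M; first by exists 0, 0; split; apply/matrixP => -[].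
rewrite -[n.+1]/(1 + n)%N in M *; rewrite -[M]submxK.
set a1 := ulsubmx M; set r := ursubmx M; set c := dlsubmx M; set D := drsubmx M.
have -> : a1 = (a1 0 0)%:M by rewrite [LHS]mx11_scalar.
set a := a1 0 0; rewrite adjmx_block => /eq_block_mx [/matrixP /(_ 0 0)].
rewrite adjmxE !mxE eqxx !mulr1n => sA _ rc sD posM.
have {}rc : c = adjmx r by [].
have [||b [b' [sb sb' bb' ab]]] := @char_pos_sqrt _ _ a.
- exact: sA.
- move=> chi schi; have := posM _ schi (row_mx 1%:M 0).
  rewrite map_block_mx mul_row_block !mul1mx !mul0mx !addr0 map_scalar_mx.
  have -> : (row_mx 1%:M 0 : 'rV[R[i]]_(1 + n))^t* = col_mx 1%:M 0.
    rewrite tr_row_mx map_col_mx; congr col_mx; apply/matrixP => i j.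
      by rewrite !mxE !ord1 /= rmorph1.
    by rewrite !mxE rmorph0.
  rewrite mul_row_col mulmx1 mulmx0 addr0 mxE eqxx mulr1n; apply.
  apply/eqP => /matrixP /(_ 0 (lshift n 0)); rewrite row_mxEl !mxE eqxx => /eqP.
  by rewrite oner_eq0.
pose S := D - (b' * b') *: (c *m r).
have aa' : a * (b' * b') = 1.
  by rewrite ab mulrACA bb' mulr1.
have [||N1 [N1' [SN NN1]]] := IH S.
- by rewrite /S rc adjmxB adjmxZ adjmxM adjmxK starM sb' sD.
- move=> chi schi v v0.
  (* The test vector whose product with M has first entry 0, so that the form of M at it is the form
     of [S] at v. *)
  have := posM _ schi (row_mx (- (chi (b' * b') *: (v *m map_mx chi c))) v).
  rewrite map_block_mx mul_row_block map_scalar_mx mul_mx_scalar.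
  rewrite scalerN scalerA -rmorphM aa' rmorph1 scale1r addNr.
  rewrite tr_row_mx map_col_mx mul_row_col mul0mx add0r mulNmx -scalemxAl.
  rewrite (_ : - _ + v *m _ = v *m map_mx chi S); last first.
    by rewrite /S map_mxB map_mxZ map_mxM mulmxBr -scalemxAr mulmxA addrC.
  apply.
  apply: contra_neq v0 => /(congr1 rsubmx); rewrite row_mxKr linear0 => ->.
  by [].
exists (block_mx b%:M (b' *: r) 0 N1), (block_mx b'%:M (- ((b' * b') *: (r *m N1'))) 0 N1').
split; last first.
  rewrite mulmx_block !mulmx0 !mul0mx !addr0 !add0r NN1 -scalar_mxM mulrC bb'.
  rewrite mul_scalar_mx scalerA mulNmx -scalemxAl -mulmxA NN1 mulmx1 subrr.
  by rewrite [RHS]scalar_mx_block.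
rewrite adjmx_block mulmx_block adjmx_scalar adjmxZ adjmx0 !mulmx0 !mul0mx !addr0 sb sb'.
rewrite -scalar_mxM -ab -SN -rc mul_scalar_mx scalerA bb' scale1r mul_mx_scalar.
rewrite scalerA bb' scale1r -scalemxAl -scalemxAr scalerA /S addrC subrK.
by [].
Qed.

Lemma normsq_sum_le (T : numDomainType) n (z : 'I_n -> T) :
  `|\sum_i z i| ^+ 2 <= 2 ^+ n * \sum_i `|z i| ^+ 2.
Proof.
elim: n z => [|n IH] z; first by rewrite !big_ord0 normr0 expr0n mulr0.
rewrite !big_ord_recl mulrDr (exprS 2).
set s := \sum_(i < n) z _; set x := z ord0.
have h0 : `|x + s| ^+ 2 <= (`|x| + `|s|) ^+ 2.
  by rewrite lerXn2r ?nnegrE ?addr_ge0 // ler_normD.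
apply: le_trans h0 _.
have h1 : (`|x| + `|s|) ^+ 2 <= 2 * `|x| ^+ 2 + 2 * `|s| ^+ 2.
  rewrite -subr_ge0.
  have -> : 2 * `|x| ^+ 2 + 2 * `|s| ^+ 2 - (`|x| + `|s|) ^+ 2 = (`|x| - `|s|) ^+ 2.
    by ring.
  by rewrite real_exprn_even_ge0 // rpredB ?normr_real.
apply: le_trans h1 _; apply: lerD; last by rewrite -mulrA ler_wpM2l ?IH.
rewrite ler_wpM2r ?exprn_ge0 // ler_peMr //.
by apply: exprn_ege1; rewrite ler1n.
Qed.

(* The inverse Cholesky factor has bounded entries, so the matrices [chi M] are
   bounded below uniformly in [chi]. *)
Lemma posdef_shift n (M : 'M[A]_n) : adjmx M = M ->
  (forall chi : {rmorphism A -> R[i]}, starchar chi -> posdef (map_mx chi M)) ->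
  exists2 e : R, 0 < e & mx_ge0 (M - (sca e)%:M).
Proof.
move=> sM posM; have [N [N' [MN NN]]] := cholesky sM posM.
have [p|rr Hrr] := @choice _ _ (fun (p : 'I_n * 'I_n) (r : R) => 0 < r /\
    forall chi : {rmorphism A -> R[i]}, starchar chi ->
    `|chi (N' p.1 p.2)| ^+ 2 <= r%:C).
  by have [r r0 Hr] := char_bound (N' p.1 p.2); exists r.
pose K : R := 1 + \sum_p rr p.
have rr0 p : 0 <= rr p by have [/ltW] := Hrr p.
have K0 : 0 < K by rewrite ltr_pwDl // sumr_ge0.
(* The summand 1 makes [bound] strict, so that the shifted matrix is again positive definite and has
   a Cholesky factor. *)
pose C : R := 1 + n%:R * (2 ^+ n * K).
have C0 : 0 < C by rewrite ltr_pwDl // mulr_ge0 ?ler0n // mulr_ge0 ?exprn_ge0 // ltW.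
have nrm m (v : 'rV[R[i]]_m) : (v *m v^t*) 0 0 = \sum_j `|v 0 j| ^+ 2.
  by rewrite mxE; apply: eq_bigr => j _; rewrite !mxE normCK.
(* With w = v N^*, the form of M at v is |w|^2; recovering v from w by [N'] bounds |v|^2 by a
   multiple of |w|^2. *)
have bound chi (v : 'rV[R[i]]_n) : starchar chi -> v != 0 ->
    (C^-1)%:C * (v *m v^t*) 0 0 < (v *m map_mx chi M *m v^t*) 0 0.
  move=> schi v0; pose w := v *m (map_mx chi N)^t*.
  have -> : (v *m map_mx chi M *m v^t*) 0 0 = (w *m w^t*) 0 0.
    by rewrite MN map_mxM map_adjmx // /w trmx_mul map_mxM trmxCK !mulmxA.
  have vw : v = w *m (map_mx chi N')^t*.
    rewrite /w -mulmxA -!map_adjmx // -map_mxM -adjmxM NN adjmx_scalar star1.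
    by rewrite map_mx1 mulmx1.
  have w0 : w != 0 by apply: contra_neq v0 => w0; rewrite vw w0 mul0mx.
  have w_gt0 : 0 < (w *m w^t*) 0 0.
    rewrite nrm lt_def sumr_ge0 ?andbT; last by move=> ? _; exact: exprn_ge0.
    apply: contra_neq w0 => /eqP; rewrite psumr_eq0; last by move=> ? _; exact: exprn_ge0.
    move=> /allP H; apply/rowP => j;
    by have := H j (mem_index_enum _); rewrite /= expf_eq0 /= normr_eq0 => /eqP ->;
      rewrite mxE.
  rewrite mulrC -ltr_pdivlMr ?invr_gt0 ?ltcR ?invr_gt0 //.
  rewrite fmorphV invrK.
  have vj j : `|v 0 j| ^+ 2 <= (2 ^+ n * K)%:C * (w *m w^t*) 0 0.
    rewrite {1}vw mxE; apply: le_trans (normsq_sum_le _) _.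
    rewrite rmorphM /= rmorphXn /= (rmorph_nat (real_complex R)) -mulrA.
    rewrite ler_wpM2l ?exprn_ge0 // nrm mulr_sumr; apply: ler_sum => i _.
    rewrite normrM exprMn mulrC ler_wpM2r ?exprn_ge0 //.
    rewrite !mxE norm_conjC; have [_ /(_ _ schi) H] := Hrr (j, i).
    apply: le_trans H _; rewrite lecR /K (bigD1 (j, i)) //= addrCA lerDl.
    by rewrite addr_ge0 ?sumr_ge0.
  rewrite {1}nrm; apply: le_lt_trans (_ : \sum_(j < n) (2 ^+ n * K)%:C * (w *m w^t*) 0 0
    < _).
    exact: ler_sum.
  rewrite sumr_const card_ord -mulrnAl mulrC ltr_pM2l //.
  by rewrite -rmorphMn ltcR /C -[X in X < _]mulr_natl ltrDr.
exists C^-1; first by rewrite invr_gt0.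
have [|chi schi v v0|N2 [_ [E _]]] := @cholesky _ (M - (sca C^-1)%:M).
- by rewrite adjmxB sM adjmx_scalar star_sca.
- rewrite map_mxB map_scalar_mx schi.1 mulmxBr mulmxBl mul_mx_scalar -scalemxAl.
  by rewrite mxE [X in _ + X]mxE [X in - X]mxE subr_gt0; exact: bound.
by exists N2; rewrite E.
Qed.

Lemma mx_ge0_char n (M : 'M[A]_n) (chi : {rmorphism A -> R[i]}) (v : 'rV[R[i]]_n) :
  starchar chi -> mx_ge0 M -> 0 <= (v *m map_mx chi M *m v^t*) 0 0.
Proof.
move=> schi [N ->]; rewrite map_mxM map_adjmx //.
pose w := v *m (map_mx chi N)^t*.
have -> : v *m ((map_mx chi N)^t* *m map_mx chi N) *m v^t* = w *m w^t*.
  by rewrite /w trmx_mul map_mxM trmxCK !mulmxA.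
by rewrite mxE sumr_ge0 // => j _; rewrite !mxE -normCK exprn_ge0.
Qed.

End Cholesky.

(** * Binary forms and spin operators *)

Section Fischer.
Variable C : numClosedFieldType.
Implicit Types (f g h q : {poly C}) (N : nat) (c : C).

(* A binary form [sum_a f_a x^(N-a) y^a] is represented by the polynomial
   [sum_a f_a X^a]. Then [dx N] and [deriv] are the partial derivatives, of degree
   [N - 1], and they are adjoint to the multiplications by [x] and [y]. *)
Definition fischer N f g : C :=
  \sum_(a < N.+1) (a`! * (N - a)`!)%:R * (f`_a * (g`_a)^*).
Definition dx N f : {poly C} := N%:R *: f - 'X * f^`().

Lemma coef_dx N f a : (dx N f)`_a = (N%:R - a%:R) * f`_a.
Proof.
rewrite coefB coefZ coefXM mulrBl; case: a => [|a]; first by rewrite mul0r.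
by rewrite coef_deriv /= mulr_natl.
Qed.

Lemma size_dx N f : (size f <= N.+2)%N -> (size (dx N.+1 f) <= N.+1)%N.
Proof.
move=> sf; apply/leq_sizeP => a; rewrite coef_dx leq_eqVlt => /orP[/eqP <-|Na].
  by rewrite subrr mul0r.
by rewrite (leq_sizeP _ _ sf) ?mulr0.
Qed.

Lemma size_dy N f : (size f <= N.+2)%N -> (size f^`() <= N.+1)%N.
Proof.
move=> sf; apply/leq_sizeP => a Na; rewrite coef_deriv.
by rewrite (leq_sizeP _ _ sf) ?mul0rn.
Qed.

Lemma fischerDl N f g h : fischer N (f + g) h = fischer N f h + fischer N g h.
Proof.
by rewrite -big_split; apply: eq_bigr => a _; rewrite coefD mulrDl mulrDr.
Qed.
Lemma fischerZl N c f h : fischer N (c *: f) h = c * fischer N f h.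
Proof. by rewrite mulr_sumr; apply: eq_bigr => a _; rewrite coefZ; ring. Qed.
Lemma fischerC N f g : fischer N f g = (fischer N g f)^*.
Proof.
rewrite rmorph_sum; apply: eq_bigr => a _.
rewrite !rmorphM /= conjCK rmorph_nat; ring.
Qed.
Lemma fischerDr N f g h : fischer N f (g + h) = fischer N f g + fischer N f h.
Proof. by rewrite fischerC fischerDl rmorphD /= -!fischerC. Qed.
Lemma fischerZr N c f h : fischer N f (c *: h) = c^* * fischer N f h.
Proof. by rewrite fischerC fischerZl rmorphM /= -fischerC. Qed.
Lemma fischer0l N f : fischer N 0 f = 0.
Proof. by rewrite -(scale0r 0) fischerZl mul0r. Qed.
Lemma fischer0r N f : fischer N f 0 = 0.
Proof. by rewrite fischerC fischer0l conjC0. Qed.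
Lemma fischer_ge0 N f : 0 <= fischer N f f.
Proof. by apply: sumr_ge0 => a _; rewrite -normCK mulr_ge0 ?exprn_ge0. Qed.

Lemma fischer_gt0 N f : f`_0 != 0 -> 0 < fischer N f f.
Proof.
move=> f0; rewrite /fischer big_ord_recl; apply: ltr_wpDr.
  by apply: sumr_ge0 => a _; rewrite -normCK mulr_ge0 ?exprn_ge0.
by rewrite -normCK mulr_gt0 ?exprn_gt0 ?normr_gt0 // ltr0n muln_gt0 !fact_gt0.
Qed.

(** Multiplication by x leaves the coefficient polynomial unchanged and only raises the degree
    index, so [f] itself stands on the left. *)
Lemma fischer_x N f g : (size f <= N.+1)%N ->
  fischer N.+1 f g = fischer N f (dx N.+1 g).
Proof.
move=> sf; rewrite /fischer big_ord_recr /= (leq_sizeP _ _ sf) // mul0r mulr0 addr0.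
apply: eq_bigr => a _; rewrite coef_dx.
have aN : (a <= N)%N by rewrite -ltnS ltn_ord.
rewrite -natrB ?leqW // subSn // factS !natrM [X in _ = _ * (_ * X)]rmorphM /=.
rewrite rmorph_nat; ring.
Qed.

Lemma fischer_X N f g : fischer N.+1 ('X * f) g = fischer N f g^`().
Proof.
rewrite /fischer big_ord_recl coefXM eqxx mul0r mulr0 add0r.
apply: eq_bigr => a _; rewrite coefXM /= subSS coef_deriv /bump /= add1n.
rewrite [X in _ = _ * (_ * X)]rmorphMn /= -[X in _ = _ * (_ * X)]mulr_natr.
rewrite factS !natrM; ring.
Qed.

(** Euler's identity x f_x + y f_y = (N+1) f, paired with g. It reduces norms in degree N + 1 to
    norms of partial derivatives, which drives the induction in [spin_shift_ge]. *)
Lemma fischer_euler N f g : (size f <= N.+2)%N ->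
  fischer N (dx N.+1 f) (dx N.+1 g) + fischer N f^`() g^`() =
  N.+1%:R * fischer N.+1 f g.
Proof.
move=> sf; rewrite -fischer_X -fischer_x ?size_dx // -fischerDl /dx subrK.
by rewrite fischerZl.
Qed.

(* The adjoint of multiplication by a quadratic form. *)
Definition qadj q N g : {poly C} :=
  (q`_1)^* *: dx N.+1 g^`() + (q`_0)^* *: dx N.+1 (dx N.+2 g) + (q`_2)^* *: g^`()^`().

Lemma poly3E q : (size q <= 3)%N -> q = q`_0 *: 1 + q`_1 *: 'X + q`_2 *: ('X * 'X).
Proof.
move=> sq; apply/polyP => i; rewrite !coefD !coefZ coef1 coefX coefXM coefX.
case: i => [|[|[|i]]] /=; rewrite ?mulr1 ?mulr0 ?addr0 ?add0r //.
by rewrite (leq_sizeP _ _ sq).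
Qed.

Lemma fischer_qadj q N f g : (size q <= 3)%N -> (size f <= N.+1)%N ->
  fischer N.+2 (q * f) g = fischer N f (qadj q N g).
Proof.
move=> sq sf; rewrite {1}(poly3E sq) !mulrDl -!scalerAl mul1r -mulrA.
rewrite !fischerDl !fischerZl !fischer_X !fischer_x //; last exact: leqW.
rewrite /qadj; move: (dx _ g^`()) (dx _ (dx _ g)) => u v.
by rewrite !fischerDr !fischerZr !conjCK; congr (_ + _); rewrite addrC.
Qed.

Section Spin.
Variables (be ga : C).
Hypothesis be_real : be^* = be.
Implicit Types k : int.

(* [spin] is the action on forms of degree [N] of the traceless hermitian matrix
   with entries [be], [ga], [ga^*], [- be]; the quadratic form [bloch_quad] is the product
   of its two eigenvectors. *)
Definition spin N f : {poly C} :=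
  be *: (dx N f - 'X * f^`()) + ga *: f^`() + ga^* *: ('X * dx N f).
Definition bloch_quad : {poly C} := be *: 'X + (- (ga / 2)) *: 1 + (ga^* / 2) *: ('X * 'X).

Lemma coef_bloch_quad : (bloch_quad`_0 = - (ga / 2)) * (bloch_quad`_1 = be) *
  (bloch_quad`_2 = ga^* / 2).
Proof.
rewrite /bloch_quad !coefD !coefZ !coefX !coef1 !coefXM !coefX /=.
by rewrite !mulr0 !mulr1 !addr0 ?add0r.
Qed.

Lemma size_bloch_quad : (size bloch_quad <= 3)%N.
Proof.
apply/leq_sizeP => -[|[|[|i]]] // _.
by rewrite /bloch_quad !coefD !coefZ !coefX !coef1 !coefXM !coefX /= !mulr0 !addr0.
Qed.

Lemma size_spin N f : (size f <= N.+1)%N -> (size (spin N f) <= N.+1)%N.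
Proof.
move=> sf; have f0 a : (N < a)%N -> f`_a = 0 by move/(leq_sizeP _ _ sf).
apply/leq_sizeP => a Na; rewrite /spin coefD coefD 3!coefZ coefB !coefXM !coef_deriv.
rewrite !coef_dx; case: a Na => // a Na /=; rewrite (f0 a.+1) // (f0 a.+2) ?(leqW Na) //.
rewrite !(mulr0, mul0rn, subr0, addr0, add0r); move: Na.
rewrite ltnS oppr0 mulr0 add0r leq_eqVlt => /orP[/eqP <-|Na].
  by rewrite subrr mul0r mulr0.
by rewrite f0 // !mulr0.
Qed.

(** An identity between differential operators in which [N] is a scalar; renaming the halves of [ga]
    and [ga^*] clears the denominators for [ring]. *)
Lemma qadj_bloch_quad N f : 4 *: qadj bloch_quad N (bloch_quad * f) =
  (N.+2%:R ^+ 2 * (be ^+ 2 + ga * ga^*)) *: f - spin N (spin N f).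
Proof.
have half : (2^-1 : C)^* = 2^-1 by rewrite fmorphV rmorph_nat.
have e0 : (- (ga / 2))^* = - (ga^* / 2) by rewrite rmorphN rmorphM /= half.
have e2 : (ga^* / 2)^* = ga / 2 by rewrite rmorphM /= half conjCK.
rewrite /qadj !coef_bloch_quad e0 e2 be_real /spin /dx /bloch_quad.
have [g Eg] : exists g : C, ga = 2 * g by exists (ga / 2); field.
have [g' Eg'] : exists g : C, ga^* = 2 * g by exists (ga^* / 2); field.
rewrite Eg' Eg ![2 * _ / 2]mulrAC divff ?pnatr_eq0 // !mul1r {half e0 e2 Eg Eg'}.
rewrite -[N.+2%:R]natr1 -[N.+1%:R]natr1 -!mul_polyC !derivE; move: (N%:R) => c.
ring.
Qed.

(** x d/dx and y d/dy are self-adjoint, while x d/dy and y d/dx are adjoint to each other and carry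
    conjugate coefficients. *)
Lemma spin_adjoint N f g : (size f <= N.+2)%N -> (size g <= N.+2)%N ->
  fischer N.+1 (spin N.+1 f) g = fischer N.+1 f (spin N.+1 g).
Proof.
move=> sf sg; have [sxf syf] := (size_dx sf, size_dy sf).
have [sxg syg] := (size_dx sg, size_dy sg).
rewrite /spin; move: (fischer_x) (fischer_X) => adx adX.
rewrite -scaleN1r -[- ('X * g^`())]scaleN1r.
have xX h1 h2 : (size h1 <= N.+2)%N -> (size h2 <= N.+2)%N ->
    fischer N.+1 ('X * h1^`()) h2 = fischer N.+1 h1 ('X * h2^`()).
  move=> s1 s2; rewrite adX -[RHS]conjCK -fischerC adX fischerC.
  by rewrite fischerC conjCK.
have xx h1 h2 : (size h1 <= N.+2)%N -> (size h2 <= N.+2)%N ->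
    fischer N.+1 (dx N.+1 h1) h2 = fischer N.+1 h1 (dx N.+1 h2).
  move=> s1 s2; rewrite adx ?size_dx // [RHS]fischerC adx ?size_dx //.
  by rewrite -fischerC.
have xy h1 h2 : (size h1 <= N.+2)%N -> (size h2 <= N.+2)%N ->
    fischer N.+1 h1^`() h2 = fischer N.+1 h1 ('X * dx N.+1 h2).
  move=> s1 s2; rewrite adx ?size_dy // [RHS]fischerC adX.
  by rewrite -fischerC.
have yx h1 h2 : (size h1 <= N.+2)%N -> (size h2 <= N.+2)%N ->
    fischer N.+1 ('X * dx N.+1 h1) h2 = fischer N.+1 h1 h2^`().
  by move=> s1 s2; rewrite [RHS]fischerC xy // -fischerC.
move: {adx adX} (xX _ _ sf sg) (xx _ _ sf sg) (xy _ _ sf sg) (yx _ _ sf sg).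
move: ('X * f^`()) (dx N.+1 f) (f^`()) ('X * dx N.+1 f) => f1 f2 f3 f4.
move: ('X * g^`()) (dx N.+1 g) (g^`()) ('X * dx N.+1 g) => g1 g2 g3 g4 E1 E2 E3 E4.
rewrite !(fischerDl, fischerDr, fischerZl, fischerZr) E1 E2 E3 E4 conjCK be_real.
by rewrite rmorphN1; ring.
Qed.

(** On the gradient, J becomes J + K, where K = [[be, ga], [ga^*, - be]] acts on the pair of partial
    derivatives; [dy_spin] is the second row. *)
Lemma dx_spin N f : dx N.+1 (spin N.+1 f) =
  spin N (dx N.+1 f) + be *: dx N.+1 f + ga *: f^`().
Proof.
rewrite /spin /dx -[N.+1%:R]natr1 -!mul_polyC !derivE; move: (N%:R) => c.
ring.
Qed.

Lemma dy_spin N f : (spin N.+1 f)^`() =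
  spin N f^`() - be *: f^`() + ga^* *: dx N.+1 f.
Proof.
rewrite /spin /dx -[N.+1%:R]natr1 -!mul_polyC !derivE; move: (N%:R) => c.
ring.
Qed.

Lemma spinD N f g : spin N (f + g) = spin N f + spin N g.
Proof. by rewrite /spin /dx -!mul_polyC !derivE; ring. Qed.
Lemma spinZ N c f : spin N (c *: f) = c *: spin N f.
Proof. by rewrite /spin /dx -!mul_polyC !derivE; ring. Qed.

(* The eigenspaces of the hermitian involution [[be, ga], [ga^*, - be]] are
   orthogonal. *)
Lemma fischer_pythagoras N u1 u2 v1 v2 :
  be *: u1 + ga *: u2 = u1 -> ga^* *: u1 - be *: u2 = u2 ->
  be *: v1 + ga *: v2 = - v1 -> ga^* *: v1 - be *: v2 = - v2 ->
  fischer N (u1 + v1) (u1 + v1) + fischer N (u2 + v2) (u2 + v2) =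
  fischer N u1 u1 + fischer N u2 u2 + (fischer N v1 v1 + fischer N v2 v2).
Proof.
move=> U1 U2 V1 V2; pose s := fischer N u1 v1 + fischer N u2 v2.
have s0 : s = 0.
  have : s = - s.
    have -> : - s = fischer N u1 (- v1) + fischer N u2 (- v2).
      by rewrite -!scaleN1r !fischerZr rmorphN1 /s; ring.
    have -> : s = fischer N (be *: u1 + ga *: u2) v1 +
        fischer N (ga^* *: u1 - be *: u2) v2 by rewrite U1 U2.
    rewrite -V1 -V2 -!scaleNr !(fischerDl, fischerDr, fischerZl, fischerZr) conjCK.
    by rewrite rmorphN /= be_real; ring.
  by move/eqP; rewrite -subr_eq0 opprK -mulr2n mulrn_eq0 /= => /eqP.
rewrite !(fischerDl, fischerDr) (fischerC N v1 u1) (fischerC N v2 u2).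
have -> : fischer N u1 v1 = s - fischer N u2 v2 by rewrite /s; ring.
by rewrite s0 sub0r rmorphN /=; ring.
Qed.

Hypothesis unit_p : be ^+ 2 + ga * ga^* = 1.

(* By induction on the degree: [spin N] is a sum of [N] commuting involutions,
   so its eigenvalues have the parity of [N]. *)
Lemma spin_shift_ge N k f : (size f <= N.+1)%N ->
  let g := spin N f + (2 * k%:~R + 1 - N%:R) *: f in
  fischer N f f <= fischer N g g.
Proof.
elim: N k f => [|N IH] k f sf.
  (* In degree 0 the spin operator vanishes and the shift is the odd integer 2 k + 1, of modulus at
     least 1. *)
  have fc : f = (f`_0)%:P by exact: size1_polyC.
  have -> : spin 0 f = 0.
    by rewrite /spin /dx fc derivC !mulr0 scale0r !subr0 !mulr0 !scaler0 !addr0.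
  rewrite add0r subr0 /= fischerZl fischerZr mulrA -normCK ler_peMl ?fischer_ge0 //.
  rewrite -normrX (_ : (2 * _ + 1) ^+ 2 = ((2 * k + 1) ^+ 2)%:~R); last first.
    by rewrite rmorphXn rmorphD rmorphM.
  by rewrite -intr_norm -[1]/(1%:~R) ler_int; lia.
set g := _ + _ => /=.
have sg : (size g <= N.+2)%N.
  rewrite (leq_trans (size_polyD _ _)) // geq_max size_spin //=.
  by rewrite (leq_trans (size_scale_leq _ _)).
have N0 : (0 : C) < N.+1%:R by rewrite ltr0n.
rewrite -(ler_pM2l N0) -!fischer_euler //.
pose F1 := dx N.+1 f; pose F2 := f^`().
rewrite -/F1 -/F2.
have [s1 s2] : (size F1 <= N.+1)%N /\ (size F2 <= N.+1)%N.
  by split; [exact: size_dx|exact: size_dy].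
pose m : C := 2 * k%:~R + 1 - N.+1%:R.
pose h : C := 2^-1.
have hh : h + h = 1 by rewrite /h; field.
(* The components of the gradient in the eigenspaces 1 and -1 of K. *)
pose a1 := h *: (F1 + (be *: F1 + ga *: F2)).
pose a2 := h *: (F2 + (ga^* *: F1 - be *: F2)).
pose c1 := h *: (F1 - (be *: F1 + ga *: F2)).
pose c2 := h *: (F2 - (ga^* *: F1 - be *: F2)).
have EF1 : F1 = a1 + c1.
  by rewrite /a1 /c1 -scalerDr addrACA subrr addr0 scalerDr -scalerDl hh scale1r.
have EF2 : F2 = a2 + c2.
  by rewrite /a2 /c2 -scalerDr addrACA subrr addr0 scalerDr -scalerDl hh scale1r.
have unit1 : be%:P * be%:P + ga%:P * (ga^*)%:P = 1 :> {poly C}.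
  by rewrite -!rmorphM -rmorphD /= -expr2 unit_p.
have KK1 : be *: (be *: F1 + ga *: F2) + ga *: (ga^* *: F1 - be *: F2) = F1.
  rewrite -[RHS]mul1r -unit1 -!mul_polyC; ring.
have KK2 : ga^* *: (be *: F1 + ga *: F2) - be *: (ga^* *: F1 - be *: F2) = F2.
  rewrite -[RHS]mul1r -unit1 -!mul_polyC; ring.
have A1 : be *: a1 + ga *: a2 = a1.
  rewrite /a1 /a2 -[X in _ = h *: (X + _)]KK1 -!mul_polyC; ring.
have A2 : ga^* *: a1 - be *: a2 = a2.
  rewrite /a1 /a2 -[X in _ = h *: (X + _)]KK2 -!mul_polyC; ring.
have C1 : be *: c1 + ga *: c2 = - c1.
  rewrite /c1 /c2 -[X in _ = - (h *: (X - _))]KK1 -!mul_polyC; ring.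
have C2 : ga^* *: c1 - be *: c2 = - c2.
  rewrite /c1 /c2 -[X in _ = - (h *: (X - _))]KK2 -!mul_polyC; ring.
have szZ (c : C) (p : {poly C}) : (size p <= N.+1)%N -> (size (c *: p) <= N.+1)%N.
  by move=> sp; rewrite (leq_trans (size_scale_leq _ _)).
have szD (p q : {poly C}) : (size p <= N.+1)%N -> (size q <= N.+1)%N ->
    (size (p + q)%R <= N.+1)%N.
  by move=> sp sq; rewrite (leq_trans (size_polyD _ _)) // geq_max sp.
have szN (p : {poly C}) : (size p <= N.+1)%N -> (size (- p)%R <= N.+1)%N.
  by rewrite size_polyN.
have [sa1 sa2] : (size a1 <= N.+1)%N /\ (size a2 <= N.+1)%N.
  by split; apply: (szZ); apply: (szD) => //; apply: (szD); rewrite ?size_polyN; exact: szZ.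
have [sc1 sc2] : (size c1 <= N.+1)%N /\ (size c2 <= N.+1)%N.
  split; apply: (szZ); apply: (szD) => //; apply: (szN); apply: (szD);
    by rewrite ?size_polyN; exact: szZ.
move: (a1) (a2) (c1) (c2) EF1 EF2 A1 A2 C1 C2 sa1 sa2 sc1 sc2 => {KK1 KK2 unit1}.
move=> {h hh a1 a2 c1 c2} a1 a2 c1 c2 EF1 EF2 A1 A2 C1 C2 sa1 sa2 sc1 sc2.
(* On the component of eigenvalue 1, J + K + m is J + (m + 1), the shift for [k] in degree [N]; on
   the other it is J + (m - 1), the shift for [k - 1]. *)
pose kp : C := 2 * k%:~R + 1 - N%:R; pose antispinor : C := 2 * (k - 1)%:~R + 1 - N%:R.
have mp : m = kp - 1 by rewrite /m /kp -natr1; ring.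
have mm : m = antispinor + 1 by rewrite /m /antispinor -natr1 rmorphB /=; ring.
pose T c p := spin N p + c *: p.
have TK c p1 p2 : be *: T c p1 + ga *: T c p2 = T c (be *: p1 + ga *: p2).
  by rewrite /T spinD !spinZ -!mul_polyC; ring.
have TK' c p1 p2 : ga^* *: T c p1 - be *: T c p2 = T c (ga^* *: p1 - be *: p2).
  by rewrite /T -[- (be *: p2)]scaleNr spinD !spinZ -!mul_polyC; ring.
have TN c p : T c (- p) = - T c p by rewrite /T -scaleN1r spinZ -!mul_polyC; ring.
have gx : dx N.+1 g = T kp a1 + T antispinor c1.
  rewrite /g -/m; have -> : dx N.+1 (spin N.+1 f + m *: f) =
     dx N.+1 (spin N.+1 f) + m *: F1.
    by rewrite /F1 /dx -!mul_polyC !derivE; ring.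
  rewrite dx_spin -/F1 -/F2 -addrA -(addrA (spin N F1)) {1}EF1 spinD.
  have -> : be *: F1 + (ga *: F2 + m *: F1) = a1 - c1 + (m *: a1 + m *: c1).
    by rewrite -[X in X - c1]A1 -[X in _ + X + _]C1 EF1 EF2 -!mul_polyC; ring.
  by rewrite /T {1}mp mm -!mul_polyC; ring.
have gy : g^`() = T kp a2 + T antispinor c2.
  rewrite /g -/m derivD derivZ -/F2 dy_spin -/F1 -/F2 -addrA -(addrA (spin N F2)).
  rewrite {1}EF2 spinD.
  have -> : - (be *: F2) + (ga^* *: F1 + m *: F2) = a2 - c2 + (m *: a2 + m *: c2).
    by rewrite -[X in X - c2]A2 -[X in _ + X + _]C2 EF1 EF2 -!mul_polyC; ring.
  by rewrite /T {1}mp mm -!mul_polyC; ring.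
rewrite gx gy EF1 EF2 fischer_pythagoras // fischer_pythagoras; last first.
- by rewrite TK' C2 TN.
- by rewrite TK C1 TN.
- by rewrite TK' A2.
- by rewrite TK A1.
by apply: lerD; apply: lerD; apply: IH.
Qed.

End Spin.
End Fischer.

(** * The block form W(p) and its kernel vectors *)

Section Witness.
Variable C : numClosedFieldType.
Variable b : nat.
Let N := b.*2.+1.
Implicit Types (f g : {poly C}) (t be ga : C).

Definition kappa : C := (N.+2%:R ^+ 2 - 1) / 4.

Lemma kappa_gt0 : 0 < kappa.
Proof.
rewrite /kappa divr_gt0 // subr_gt0 -natrX ltr1n.
by rewrite (@leq_trans (2 ^ 2)) // leq_exp2r.
Qed.

Lemma fischer_spin be ga f : be^* = be -> (size f <= N.+1)%N ->
  4 * fischer N.+2 (bloch_quad be ga * f) (bloch_quad be ga * f) =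
  N.+2%:R ^+ 2 * (be ^+ 2 + ga * ga^*) * fischer N f f
  - fischer N (spin be ga N f) (spin be ga N f).
Proof.
move=> rbe sf; rewrite fischer_qadj ?size_bloch_quad //.
have c4 : (4 : C)^* = 4 by rewrite rmorph_nat.
rewrite -[4 in LHS]c4 -fischerZr qadj_bloch_quad // -scaleN1r fischerDr !fischerZr.
rewrite rmorphN1 -spin_adjoint ?size_spin //.
have -> : (N.+2%:R ^+ 2 * (be ^+ 2 + ga * ga^*))^* = N.+2%:R ^+ 2 * (be ^+ 2 + ga * ga^*).
  rewrite rmorphM rmorphXn rmorph_nat; congr (_ * _).
  by rewrite rmorphD rmorphXn rmorphM /= rbe conjCK [ga^* * ga]mulrC.
by rewrite mulN1r.
Qed.

Lemma bloch_quad0 : bloch_quad (0 : C) 0 = 0.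
Proof. by rewrite /bloch_quad !mul0r conjC0 mul0r oppr0 !scale0r !addr0. Qed.

Lemma bloch_quadZ (c : C) be ga : c^* = c -> bloch_quad (c * be) (c * ga) = c *:
  bloch_quad be ga.
Proof.
move=> cr; rewrite /bloch_quad rmorphM /= cr !scalerDr !scalerA.
by rewrite mulrN !mulrA.
Qed.

(** By homogeneity p may be taken on the sphere, where the bound amounts to |J f| >= |f|. *)
Lemma fischer_bloch_quad_le be ga f : be^* = be -> (size f <= N.+1)%N ->
  fischer N.+2 (bloch_quad be ga * f) (bloch_quad be ga * f) <=
  kappa * (be ^+ 2 + ga * ga^*) * fischer N f f.
Proof.
move=> rbe sf; pose n2 := be ^+ 2 + ga * ga^*.
have be2 : 0 <= be ^+ 2 by rewrite real_exprn_even_ge0 //; apply/CrealP.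
have ga2 : 0 <= ga * ga^* by rewrite -normCK exprn_ge0.
have [n20|n2N0] := eqVneq n2 0.
  move: n20 => /eqP; rewrite paddr_eq0 // expf_eq0 /= mulf_eq0 conjC_eq0 orbb.
  move=> /andP[/eqP -> /eqP ->]; rewrite bloch_quad0 mul0r fischer0l.
  by rewrite expr0n mul0r addr0 mulr0 mul0r.
have n2_gt0 : 0 < n2 by rewrite lt_def n2N0 addr_ge0.
pose rho := sqrtC n2; have rho_gt0 : 0 < rho by rewrite sqrtC_gt0.
have rrho : rho^* = rho by apply/CrealP/gtr0_real.
have rhoN0 : rho != 0 by rewrite gt_eqF.
have rho2 : rho ^+ 2 = n2 by rewrite sqrtCK.
have r1 : (be / rho)^* = be / rho by rewrite rmorphM fmorphV /= rbe rrho.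
have unit_p : (be / rho) ^+ 2 + (ga / rho) * (ga / rho)^* = 1.
  rewrite rmorphM fmorphV /= rrho (_ : 1 = n2 / rho ^+ 2); last by rewrite rho2 mulfV.
  rewrite /n2; field.
  exact: rhoN0.
(* At k = b the shift in [spin_shift_ge] vanishes, because [N] is odd. *)
have odd0 : 2 * (b : int)%:~R + 1 - N%:R = 0 :> C.
  have -> : N%:R = b%:R * 2 + 1 :> C by rewrite /N -[_.+1%:R]natr1 -muln2 natrM.
  by rewrite -pmulrn; ring.
have := spin_shift_ge r1 unit_p b sf; rewrite odd0 scale0r addr0 => ge_sp.
have -> : bloch_quad be ga = rho *: bloch_quad (be / rho) (ga / rho).
  by rewrite -bloch_quadZ // ![rho * _]mulrC !mulfVK.
rewrite -scalerAl fischerZl fischerZr rrho mulrA -expr2 rho2 -/n2.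
rewrite -[kappa * n2]mulrC -mulrA ler_wpM2l ?(ltW n2_gt0) //.
have := fischer_spin (ga / rho) r1 sf; rewrite unit_p mulr1 => E.
rewrite -(@ler_pM2l _ 4) // E /kappa.
have -> : 4 * ((N.+2%:R ^+ 2 - 1) / 4 * fischer N f f) =
  (N.+2%:R ^+ 2) * fischer N f f - fischer N f f by field.
by rewrite lerB.
Qed.

(* The hermitian block form [[kappa t, q^*], [q, t]] on pairs of forms of degrees
   [N] and [N + 2]. *)
Definition Wform t be ga f g f' g' : C :=
  kappa * t * fischer N f f' + t * fischer N.+2 g g'
  + fischer N.+2 (bloch_quad be ga * f) g' + fischer N.+2 g (bloch_quad be ga * f').

(** Completing the square with h = q f: t W = |t g + h|^2 + (kappa t^2 |f|^2 - |h|^2). For t = 0 the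
    bound on |h| forces h = 0. *)
Lemma Wform_ge0 t be ga f g : be^* = be -> 0 <= t ->
  be ^+ 2 + ga * ga^* <= t ^+ 2 -> (size f <= N.+1)%N -> 0 <= Wform t be ga f g f g.
Proof.
move=> rbe t0 pt sf; rewrite /Wform; set h := bloch_quad be ga * f.
have hle : fischer N.+2 h h <= kappa * t ^+ 2 * fischer N f f.
  apply: le_trans (fischer_bloch_quad_le _ rbe sf) _.
  by rewrite ler_wpM2r ?fischer_ge0 // ler_wpM2l ?(ltW kappa_gt0).
move: t0; rewrite le_eqVlt => /orP[/eqP t0|t0].
  have h0 : fischer N.+2 h h = 0.
    apply/eqP; rewrite eq_le fischer_ge0 andbT.
    by move: hle; rewrite -t0 expr0n mulr0 mul0r.
  have hz : forall u, fischer N.+2 h u = 0.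
    move=> u; apply: big1 => a _; suff -> : h`_a = 0 by rewrite mul0r mulr0.
    move: h0 => /eqP; rewrite /fischer psumr_eq0 => [/allP /(_ a)|i _]; last first.
      by rewrite -normCK mulr_ge0 ?exprn_ge0.
    rewrite mem_index_enum => /(_ isT) /=; rewrite mulf_eq0 pnatr_eq0 muln_eq0.
    by rewrite !gtn_eqF ?fact_gt0 //= mulf_eq0 conjC_eq0 orbb => /eqP.
  by rewrite (fischerC _ g h) !hz conjC0 -t0 mulr0 !mul0r !addr0.
have rt : t^* = t by apply/CrealP/gtr0_real.
rewrite -(pmulr_rge0 _ t0).
have -> : t * (kappa * t * fischer N f f + t * fischer N.+2 g g
    + fischer N.+2 h g + fischer N.+2 g h) =
  fischer N.+2 (t *: g + h) (t *: g + h)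
  + (kappa * t ^+ 2 * fischer N f f - fischer N.+2 h h).
  by rewrite !(fischerDl, fischerDr, fischerZl, fischerZr) rt; ring.
by rewrite addr_ge0 ?fischer_ge0 ?subr_ge0.
Qed.

Lemma Wform_linear_p (c t be ga t' be' ga' : C) f g f' g' : c^* = c ->
  Wform (c * t + t') (c * be + be') (c * ga + ga') f g f' g' =
  c * Wform t be ga f g f' g' + Wform t' be' ga' f g f' g'.
Proof.
move=> cr; rewrite /Wform.
have -> : bloch_quad (c * be + be') (c * ga + ga') = c *: bloch_quad be ga + bloch_quad
  be' ga'.
  by rewrite /bloch_quad rmorphD rmorphM /= cr -!mul_polyC; ring.
move: (bloch_quad be ga) (bloch_quad be' ga') => q q'.
rewrite !mulrDl -!scalerAl !(fischerDl, fischerDr, fischerZl, fischerZr) cr; ring.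
Qed.

Lemma Wform_linear_l (c t be ga : C) f g f1 g1 f' g' :
  Wform t be ga (c *: f + f1) (c *: g + g1) f' g' =
  c * Wform t be ga f g f' g' + Wform t be ga f1 g1 f' g'.
Proof.
rewrite /Wform; move: (bloch_quad be ga) => q.
by rewrite mulrDr -scalerAr !(fischerDl, fischerZl); ring.
Qed.

Lemma Wform_linear_r (c t be ga : C) f g f1 g1 f' g' :
  Wform t be ga f' g' (c *: f + f1) (c *: g + g1) =
  c^* * Wform t be ga f' g' f g + Wform t be ga f' g' f1 g1.
Proof.
rewrite /Wform; move: (bloch_quad be ga) => q.
by rewrite mulrDr -scalerAr !(fischerDr, fischerZr); ring.
Qed.

Section Kernel.
Variable z : C.
Let n2 := 1 + z * z^*.
(* [spinor] and [antispinor] are the eigenvectors, of eigenvalues [1] and [-1], of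
   the unit vector of the sphere with stereographic coordinate [z]. *)
Definition bloch_beta : C := (1 - z * z^*) / n2.
Definition bloch_gamma : C := 2 * z^* / n2.
Definition spinor : {poly C} := 1 + z *: 'X.
Definition antispinor : {poly C} := 'X - (z^*)%:P.
(** A Dicke state: [n.+1] spins along the unit vector and [n] against it. *)
Definition dicke n : {poly C} := spinor ^+ n.+1 * antispinor ^+ n.

Let n2_gt0 : 0 < n2.
Proof. by rewrite /n2 ltr_pwDl // -normCK exprn_ge0. Qed.
Let n2N0 : n2 != 0. Proof. by rewrite gt_eqF. Qed.
Let n2r : n2^* = n2.
Proof. exact/CrealP/gtr0_real. Qed.

Lemma bloch_beta_real : bloch_beta^* = bloch_beta.
Proof.
by rewrite /bloch_beta rmorphM fmorphV /= n2r rmorphB rmorphM rmorph1 /= conjCK [z^* *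
  z]mulrC.
Qed.
Lemma bloch_gamma_conj : bloch_gamma^* = 2 * z / n2.
Proof. by rewrite /bloch_gamma !rmorphM fmorphV /= n2r conjCK rmorph_nat. Qed.

Lemma bloch_unit : bloch_beta ^+ 2 + bloch_gamma * bloch_gamma^* = 1.
Proof. by rewrite bloch_gamma_conj /bloch_beta /bloch_gamma /n2; field. Qed.

Lemma bloch_quad_kernel : bloch_quad bloch_beta bloch_gamma = n2^-1 *: (spinor *
  antispinor).
Proof.
rewrite /bloch_quad bloch_gamma_conj /bloch_beta /bloch_gamma.
have -> : 2 * z^* / n2 / 2 = n2^-1 * z^* by field.
have -> : 2 * z / n2 / 2 = n2^-1 * z by field.
rewrite [(1 - _) / _]mulrC /spinor /antispinor -!mul_polyC !rmorphN !rmorphM rmorphB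
  rmorphM /=; ring.
Qed.

Lemma spin_mul be ga n m f g :
  spin be ga (n + m)%N (f * g) = spin be ga n f * g + f * spin be ga m g.
Proof. by rewrite /spin /dx natrD -!mul_polyC !derivE rmorphD /=; ring. Qed.

Lemma spin_exp be ga c f n : spin be ga 1 f = c *: f ->
  spin be ga n (f ^+ n) = (n%:R * c) *: f ^+ n.
Proof.
move=> Ef; elim: n => [|n IH].
  rewrite expr0 mul0r scale0r /spin /dx -!mul_polyC !derivE; ring.
rewrite exprS -[n.+1]add1n spin_mul Ef IH -scalerAl -scalerAr -scalerDl.
by rewrite natrD mulrDl mul1r.
Qed.

(** [spin] is a derivation on products of forms, so the eigenvalue is (n + 1) - n = 1. *)
Lemma spin_dicke n : spin bloch_beta bloch_gamma n.*2.+1 (dicke n) = dicke n.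
Proof.
have El : spin bloch_beta bloch_gamma 1 spinor = 1 *: spinor.
  have E0 : bloch_gamma * z + bloch_beta = 1 by rewrite /bloch_beta /bloch_gamma /n2; field.
  have E1 : bloch_gamma^* - bloch_beta * z = z by rewrite bloch_gamma_conj /bloch_beta
    /bloch_gamma /n2; field.
  rewrite scale1r (_ : spin _ _ 1 spinor = (bloch_gamma * z + bloch_beta)%:P +
    (bloch_gamma^* - bloch_beta * z)%:P * 'X).
    by rewrite E0 E1 mul_polyC.
  by rewrite /spin /dx /spinor -!mul_polyC !derivE; ring.
have Em : spin bloch_beta bloch_gamma 1 antispinor = -1 *: antispinor.
  have E0 : bloch_gamma - bloch_beta * z^* = z^* by rewrite /bloch_beta /bloch_gamma /n2;
    field.
  have E1 : bloch_beta + bloch_gamma^* * z^* = 1 by rewrite bloch_gamma_conj /bloch_beta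
    /bloch_gamma /n2; field.
  rewrite scaleN1r opprB (_ : spin _ _ 1 antispinor =
    (bloch_gamma - bloch_beta * z^*)%:P - (bloch_beta + bloch_gamma^* * z^*)%:P * 'X).
    by rewrite E0 E1 mul1r.
  by rewrite /spin /dx /antispinor -!mul_polyC !derivE; ring.
rewrite -addnn -addSn /dicke spin_mul (spin_exp _ El) (spin_exp _ Em).
rewrite -scalerAl -scalerAr -scalerDl mulr1 mulrN1 -natr1 addrAC subrr add0r.
by rewrite scale1r.
Qed.

Lemma size_dicke n : (size (dicke n) <= n.*2.+2)%N.
Proof using z.
have sl : (size spinor <= 2)%N.
  apply/leq_sizeP => -[|[|i]] // _.
  by rewrite /spinor coefD coef1 coefZ coefX /= mulr0 addr0.
have sm : (size antispinor <= 2)%N.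
  apply/leq_sizeP => -[|[|i]] // _.
  by rewrite /antispinor coefB coefX coefC /= subrr.
have := size_polyMleq (spinor ^+ n.+1) (antispinor ^+ n).
have := size_poly_exp_leq spinor n.+1; have := size_poly_exp_leq antispinor n.
have : ((size spinor).-1 * n.+1 <= 1 * n.+1)%N by rewrite leq_mul2r;
  case: (size spinor) sl => [|[|[]]].
have : ((size antispinor).-1 * n <= 1 * n)%N by rewrite leq_mul2r;
  case: (size antispinor) sm => [|[|[]]] // ; rewrite orbT.
rewrite /dicke; clear N; lia.
Qed.

Lemma qadj_dicke : qadj (bloch_quad bloch_beta bloch_gamma) N (bloch_quad bloch_beta
  bloch_gamma * dicke b) = kappa *: dicke b.
Proof.
have c4 : (4 : C) != 0 by rewrite pnatr_eq0.
apply: (scalerI c4); rewrite qadj_bloch_quad ?bloch_beta_real // bloch_unit mulr1 /N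
  !spin_dicke.
by rewrite scalerA /kappa mulrC mulfVK // scalerBl scale1r.
Qed.

(** Both terms in the completed square vanish: t g + h = 0 by the choice of g, and kappa |w|^2 = |q
    w|^2 because J w = w. The same w serves a point (s = 1) and its antipode (s = -1), which
    [intertwine] exploits. *)
Lemma Wform_kernel s : s ^+ 2 = 1 -> s^* = s ->
  let g := - s *: (bloch_quad bloch_beta bloch_gamma * dicke b) in
  Wform 1 (s * bloch_beta) (s * bloch_gamma) (dicke b) g (dicke b) g = 0.
Proof.
move=> s2 sr /=; rewrite /Wform bloch_quadZ // -scalerAl.
set h := bloch_quad bloch_beta bloch_gamma * dicke b; set w := dicke b.
have E : fischer N.+2 h h = kappa * fischer N w w.
  rewrite fischer_qadj ?size_bloch_quad ?qadj_dicke //; last exact: size_dicke.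
  by rewrite fischerZr; congr (_ * _); apply/CrealP/gtr0_real/kappa_gt0.
rewrite !(fischerZl, fischerZr) -/h -/w E rmorphN /= sr.
have -> : kappa * 1 * fischer N w w + 1 * (- s * (- s * (kappa * fischer N w w)))
   + s * (- s * (kappa * fischer N w w)) + - s * (s * (kappa * fischer N w w)) =
   (1 - s ^+ 2) * (kappa * fischer N w w) by ring.
by rewrite s2 subrr mul0r.
Qed.
End Kernel.
End Witness.

(** * Rigidity of the kernel vectors *)

Section PolyFun.
Variable C : numFieldType.
Implicit Types (f g : C -> C).

Definition polyfun f := exists P : {poly C}, forall t, f t = P.[t].

Lemma polyfun_cst c : polyfun (fun=> c).
Proof. by exists c%:P => t; rewrite hornerC. Qed.
Lemma polyfun_id : polyfun id.
Proof. by exists 'X => t; rewrite hornerX. Qed.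
Lemma polyfunD f g : polyfun f -> polyfun g -> polyfun (fun t => f t + g t).
Proof. by move=> [P HP] [Q HQ]; exists (P + Q) => t; rewrite hornerD HP HQ. Qed.
Lemma polyfunM f g : polyfun f -> polyfun g -> polyfun (fun t => f t * g t).
Proof. by move=> [P HP] [Q HQ]; exists (P * Q) => t; rewrite hornerM HP HQ. Qed.
Lemma polyfun_sum (I : Type) (s : seq I) (F : I -> C -> C) :
  (forall i, polyfun (F i)) -> polyfun (fun t => \sum_(i <- s) F i t).
Proof.
move=> HF; elim: s => [|i s [P HP]].
  by exists 0 => t; rewrite big_nil horner0.
have [Q HQ] := HF i; exists (Q + P) => t.
by rewrite big_cons hornerD HP HQ.
Qed.

(** The sample points n + 1 are fixed by conjugation and nonzero; both properties matter where
    identities are extended from them. *)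
Lemma poly_eq0_nat (P : {poly C}) : (forall n : nat, P.[n.+1%:R] = 0) -> P = 0.
Proof.
move=> f0; apply: contraTeq isT => P0 /=.
pose s : seq C := [seq n.+1%:R | n <- iota 0 (size P)].
have : (size s < size P)%N.
  apply: max_poly_roots => //.
    by apply/allP => _ /mapP[n _ ->]; rewrite rootE f0.
  rewrite map_inj_uniq ?iota_uniq // => n m /eqP.
  by rewrite eqr_nat => /eqP [].
by rewrite size_map size_iota ltnn.
Qed.

Lemma polyfun_eq0 f : polyfun f -> (forall n : nat, f n.+1%:R = 0) -> forall t, f t = 0.
Proof.
move=> [P HP] f0 t; rewrite HP; suff -> : P = 0 by rewrite horner0.
by apply: poly_eq0_nat => n; rewrite -HP.
Qed.

Definition coef_polyfun (A : C -> {poly C}) := forall a, polyfun (fun t => (A t)`_a).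

Lemma coef_polyfun_affine (u v : {poly C}) : coef_polyfun (fun t => u + t *: v).
Proof.
move=> a; have [P HP] : polyfun (fun t => u`_a + t * v`_a).
  apply: polyfunD; first exact: polyfun_cst.
  by apply: polyfunM; [exact: polyfun_id|exact: polyfun_cst].
by exists P => t; rewrite coefD coefZ HP.
Qed.

Lemma coef_polyfunM A B : coef_polyfun A -> coef_polyfun B ->
  coef_polyfun (fun t => A t * B t).
Proof.
move=> HA HB a; have [P HP] := @polyfun_sum _ (index_enum 'I_a.+1)
  (fun i t => (A t)`_(i : nat) * (B t)`_(a - i)) (fun i => polyfunM (HA _) (HB _)).
by exists P => t; rewrite coefM HP.
Qed.

Lemma coef_polyfunX A n : coef_polyfun A -> coef_polyfun (fun t => A t ^+ n).
Proof.
move=> HA; elim: n => [|n IH] a.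
  by exists ((1 : {poly C})`_a)%:P => t; rewrite expr0 hornerC.
have [P HP] := coef_polyfunM HA IH a.
by exists P => t; rewrite exprS HP.
Qed.
End PolyFun.

(** * Spanning by tensors of quadratic forms and Dicke states *)

Section Span.
Variable C : numClosedFieldType.
Variables (b : nat) (beta : nat -> nat -> C).
Let N := b.*2.+1.

(** A linear functional, with coefficients [beta], on tensors of a quadratic form and a form of
    degree [N]. At [spinor z] and [antispinor z] its arguments are q_p, up to a scalar, and
    [dicke z b]. *)
Definition pairing (l m : {poly C}) : C :=
  \sum_(i < 3) \sum_(a < N.+1) beta i a * ((l * m)`_i * (l ^+ b.+1 * m ^+ b)`_a).

Lemma pairing_polyfun A B : coef_polyfun A -> coef_polyfun B ->
  polyfun (fun t => pairing (A t) (B t)).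
Proof.
move=> HA HB; apply: polyfun_sum => i; apply: polyfun_sum => a.
apply: polyfunM; first exact: polyfun_cst.
apply: polyfunM; first exact: coef_polyfunM.
by apply: coef_polyfunM; exact: coef_polyfunX.
Qed.

Lemma pairingZ c d l m : pairing (c *: l) (d *: m) = c ^+ b.+2 * d ^+ b.+1 * pairing l m.
Proof.
rewrite /pairing mulr_sumr; apply: eq_bigr => i _; rewrite mulr_sumr.
apply: eq_bigr => a _; rewrite !exprZn -!scalerAl -!scalerAr !coefZ !exprS; ring.
Qed.

Hypothesis pairing0 : forall z : C, pairing (spinor z) (antispinor z) = 0.

(* [z] and [z^*] are independent variables for polynomial identities. *)
Lemma pairing_affine_eq0 (z t : C) : pairing (1 + z *: 'X) ('X - t%:P) = 0.
Proof.
pose im := 'i : C.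
(* For real u and v this is the hypothesis at z = u + i v. The pairing is polynomial in each
   variable, so it vanishes for complex u and v as well, and z and t can then be prescribed
   freely. *)
have H u v : pairing (1 + (u + im * v) *: 'X) ('X - (u - im * v)%:P) = 0.
  have pu v' : polyfun (fun u => pairing (1 + (u + im * v') *: 'X) ('X - (u - im * v')%:P)).
    have [P HP] := @pairing_polyfun (fun t => (1 + (im * v') *: 'X) + t *: 'X)
      (fun t => ('X + (im * v')%:P) + t *: (-1)) (coef_polyfun_affine _ _)
      (coef_polyfun_affine _ _).
    exists P => u'; rewrite -HP; congr pairing.
      by rewrite scalerDl addrCA addrC.
    by rewrite scalerN -[u' *: 1]/(u'%:A) alg_polyC rmorphB /= opprB addrA.
  have pv u' : polyfun (fun v => pairing (1 + (u' + im * v) *: 'X) ('X - (u' - im * v)%:P)).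
    have [P HP] := @pairing_polyfun (fun t => (1 + u' *: 'X) + t *: (im *: 'X))
      (fun t => ('X - u'%:P) + t *: im%:P) (coef_polyfun_affine _ _)
      (coef_polyfun_affine _ _).
    exists P => v'; rewrite -HP; congr pairing.
      by rewrite scalerDl addrA scalerA mulrC.
    by rewrite rmorphB rmorphM /= opprB -mul_polyC mulrC addrA addrAC.
  have H1 : forall n : nat, forall u, pairing (1 + (u + im * n.+1%:R) *: 'X)
      ('X - (u - im * n.+1%:R)%:P) = 0.
    move=> n; apply: polyfun_eq0 (pu _) _ => k.
    have := pairing0 (k.+1%:R + im * n.+1%:R); rewrite /spinor /antispinor.
    by rewrite rmorphD rmorphM /= !rmorph_nat conjCi mulNr.
  exact: (polyfun_eq0 (pv u) (fun n => H1 n u)).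
have := H ((z + t) / 2) ((z - t) / (2 * im)).
have imN0 : im != 0 := neq0Ci C.
have -> : (z + t) / 2 + im * ((z - t) / (2 * im)) = z by field.
by have -> : (z + t) / 2 - im * ((z - t) / (2 * im)) = t by field.
Qed.

(** Homogeneity reduces nonzero l0 and m1 to [pairing_affine_eq0]; polynomial continuation in m1 and
    then in l0 removes both restrictions. *)
Lemma pairing_eq0 (l0 l1 m0 m1 : C) :
  pairing (l0%:P + l1 *: 'X) (m0%:P + m1 *: 'X) = 0.
Proof.
have H x0 y1 : x0 != 0 -> y1 != 0 ->
    pairing (x0%:P + l1 *: 'X) (m0%:P + y1 *: 'X) = 0.
  move=> x00 y10.
  have -> : x0%:P + l1 *: 'X = x0 *: (1 + (l1 / x0) *: 'X).
    by rewrite scalerDr scalerA alg_polyC mulrC mulfVK.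
  have -> : m0%:P + y1 *: 'X = y1 *: ('X - (- (m0 / y1))%:P).
    rewrite rmorphN opprK scalerDr addrC; congr (_ + _).
    by rewrite -mul_polyC -rmorphM /= mulrC mulfVK.
  by rewrite pairingZ pairing_affine_eq0 mulr0.
have H1 x0 : x0 != 0 -> pairing (x0%:P + l1 *: 'X) (m0%:P + m1 *: 'X) = 0.
  move=> x00.
  have pf := @pairing_polyfun (fun t => (x0%:P + l1 *: 'X) + t *: 0)
      (fun t => m0%:P + t *: 'X) (coef_polyfun_affine _ _) (coef_polyfun_affine _ _).
  have {}pf := polyfun_eq0 pf _ m1; rewrite scaler0 addr0 in pf; apply: pf => n.
  by rewrite scaler0 addr0 H ?pnatr_eq0.
have pf := @pairing_polyfun (fun t => (l1 *: 'X) + t *: 1)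
  (fun t => (m0%:P + m1 *: 'X) + t *: 0) (coef_polyfun_affine _ _) (coef_polyfun_affine _
    _).
have Hn (n : nat) :
    pairing (l1 *: 'X + n.+1%:R *: 1) (m0%:P + m1 *: 'X + n.+1%:R *: 0) = 0.
  by rewrite scaler0 addr0 alg_polyC addrC H1 ?pnatr_eq0.
by have := polyfun_eq0 pf Hn l0; rewrite scaler0 addr0 alg_polyC addrC.
Qed.

Lemma scale_comp (p : {poly C}) z a : (p \Po (z *: 'X))`_a = z ^+ a * p`_a.
Proof.
elim/poly_ind: p a => [|p c IH] a; first by rewrite comp_poly0 coef0 mulr0.
rewrite comp_polyD comp_polyM comp_polyX comp_polyC !coefD !coefC.
rewrite -scalerAr coefZ !coefMX.
case: a => [|a] /=; first by rewrite mulr0 expr0 mul1r.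
by rewrite IH !addr0 exprS mulrA.
Qed.

(* Torus invariance: the substitution [X -> zX] separates the weights [i + a]. *)
Definition weight_coef w i : C :=
  if (i <= w)%N && (w - i < N.+1)%N then beta i (w - i)%N else 0.

Lemma pairing_weight (l0 l1 m0 m1 : C) w :
  let l := l0%:P + l1 *: 'X in let m := m0%:P + m1 *: 'X in
  \sum_(i < 3) weight_coef w i * ((l * m)`_i * (l ^+ b.+1 * m ^+ b)`_(w - i)) = 0.
Proof.
move=> l m.
pose cf (i a : nat) := beta i a * ((l * m)`_i * (l ^+ b.+1 * m ^+ b)`_a).
(* The value of P at z is the pairing of the two linear forms after X -> zX, and its coefficient of
   index [w] is the sum in question. *)
pose P : {poly C} := \sum_(i < 3) \sum_(a < N.+1) cf i a *: 'X^(i + a).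
have P0 : P = 0.
  apply: poly_eq0_nat => n; move: (n.+1%:R) => z.
  rewrite -[RHS](pairing_eq0 l0 (z * l1) m0 (z * m1)) /P horner_sum.
  apply: eq_bigr => i _; rewrite horner_sum; apply: eq_bigr => a _.
  rewrite hornerZ hornerXn /cf.
  have lin c0 c1 : c0%:P + (z * c1) *: 'X = (c0%:P + c1 *: 'X) \Po (z *: 'X) :> {poly C}.
    by rewrite comp_polyD comp_polyC comp_polyZ comp_polyX scalerA mulrC.
  rewrite !lin -!rmorphXn -!rmorphM /= !scale_comp exprD -/l -/m; ring.
move/(congr1 (fun p : {poly C} => p`_w)): P0; rewrite coef0 /P coef_sum => E0;
  rewrite -[RHS]E0 {E0}.
apply: eq_bigr => i _; rewrite coef_sum /weight_coef; case: ifP => [/andP[iw wN]|iwN].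
  rewrite (bigD1 (Ordinal wN)) //= coefZ coefXn subnKC // eqxx mulr1 big1 ?addr0 // => a.
  rewrite coefZ coefXn => /eqP aN; case: eqP => [E|]; last by rewrite mulr0.
  by case: aN; apply/val_inj; rewrite /= E addKn.
rewrite mul0r big1 // => a _; rewrite coefZ coefXn; case: eqP => [E|];
  last by rewrite mulr0.
by move: iwN; rewrite E leq_addr addKn ltn_ord.
Qed.

(** Up to nonzero factors the equations are (b - v + 2) x + v y = 0 and (b - v + 1) x + v y = 0,
    whose difference is x = 0. *)
Lemma bin_two_term (v : nat) (x y : C) : (0 < v <= b.+1)%N ->
  'C(b.+1, v)%:R * x + 'C(b.+1, v.-1)%:R * y = 0 ->
  'C(b, v)%:R * x + 'C(b, v.-1)%:R * y = 0 -> x = 0 /\ y = 0.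
Proof.
case: v => // v; rewrite ltnS /= => vb; set c := 'C(b, v) => E1 E2.
have cN0 : (c%:R : C) != 0 by rewrite pnatr_eq0 -lt0n bin_gt0.
have H1 : v.+1%:R * 'C(b, v.+1)%:R = (b - v)%:R * c%:R :> C.
  by rewrite -!natrM mul_bin_left.
have H2 : v.+1%:R * 'C(b.+1, v.+1)%:R = b.+1%:R * c%:R :> C.
  by rewrite -!natrM -mul_bin_diag.
have H3 : (b - v).+1%:R * 'C(b.+1, v)%:R = b.+1%:R * c%:R :> C.
  by rewrite -!natrM -subSn // -mul_bin_down.
have F1 : (b - v)%:R * x + v.+1%:R * y = 0.
  apply: (mulfI cN0); rewrite mulr0.
  have -> : c%:R * ((b - v)%:R * x + v.+1%:R * y) =
    ((b - v)%:R * c%:R) * x + v.+1%:R * (c%:R * y) by ring.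
  by rewrite -H1 -mulrA -mulrDr E2 mulr0.
have F2 : (b - v).+1%:R * x + v.+1%:R * y = 0.
  have bcN0 : (b.+1%:R * c%:R : C) != 0 by rewrite mulf_neq0 // pnatr_eq0.
  apply: (mulfI bcN0); rewrite mulr0.
  have -> : b.+1%:R * c%:R * ((b - v).+1%:R * x + v.+1%:R * y) =
    (b - v).+1%:R * (b.+1%:R * c%:R) * x + v.+1%:R * (b.+1%:R * c%:R) * y by ring.
  rewrite -[in X in X + _]H2 -H3.
  rewrite (_ : _ + _ = v.+1%:R * (b - v).+1%:R *
    ('C(b.+1, v.+1)%:R * x + 'C(b.+1, v)%:R * y)); first by rewrite E1 mulr0.
  ring.
have x0 : x = 0.
  have -> : x = ((b - v).+1%:R * x + v.+1%:R * y) - ((b - v)%:R * x + v.+1%:R * y).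
    by rewrite -natr1; ring.
  by rewrite F1 F2 subrr.
split=> //; move: F1; rewrite x0 mulr0 add0r => /eqP.
by rewrite mulf_eq0 pnatr_eq0 => /eqP.
Qed.

Lemma coef_one_addX n a : ((1 + 'X : {poly C}) ^+ n)`_a = 'C(n, a)%:R.
Proof.
rewrite exprDn coef_sum.
have [an|na] := leqP a n; last first.
  rewrite bin_small // big1 // => i _; rewrite expr1n mul1r coefMn coefXn.
  by rewrite gtn_eqF ?mul0rn // (leq_ltn_trans _ na) // -ltnS ltn_ord.
rewrite (bigD1 (Ordinal (an : (a < n.+1)%N))) //= big1 ?addr0.
  by rewrite expr1n mul1r coefMn coefXn eqxx.
move=> i ia; rewrite expr1n mul1r coefMn coefXn.
by case: eqP => [E|]; rewrite ?mul0rn //; case/eqP: ia; apply/val_inj.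
Qed.

(** The product is (1 + X)(1 - X^2)^b, whose coefficients of index 2u and 2u + 1 are both (-1)^u
    binomial(b, u). *)
Lemma coef_equator a : (a < N.+1)%N ->
  ((1 + 'X : {poly C}) ^+ b.+1 * (1 - 'X) ^+ b)`_a != 0.
Proof.
move=> aN; have -> : (1 + 'X : {poly C}) ^+ b.+1 * (1 - 'X) ^+ b =
    ((1 - 'X) ^+ b) \Po 'X^2 + 'X * (((1 - 'X) ^+ b) \Po 'X^2).
  rewrite exprS -mulrA -exprMn rmorphXn rmorphB rmorph1 /= comp_polyX.
  have -> : (1 + 'X) * (1 - 'X) = 1 - 'X^2 :> {poly C} by ring.
  by rewrite mulrDl mul1r.
have cf u : ((1 - 'X : {poly C}) ^+ b)`_u = (-1) ^+ u * 'C(b, u)%:R.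
  have -> : (1 - 'X : {poly C}) = (1 + 'X) \Po (-1 *: 'X).
    by rewrite comp_polyD comp_polyX -polyC1 comp_polyC scaleN1r.
  by rewrite -rmorphXn /= scale_comp coef_one_addX.
rewrite coefD coefXM !coef_comp_poly_Xn // !cf.
have nz u : (u <= b)%N -> (-1) ^+ u * 'C(b, u)%:R != 0 :> C.
  by move=> ub; rewrite mulf_neq0 ?signr_eq0 // pnatr_eq0 -lt0n bin_gt0.
case: a aN => [|a] aN /=; first by rewrite addr0 nz.
rewrite !dvdn2 /= !divn2; case: (boolP (odd a)) => oa /=.
  by rewrite addr0 nz //; move: aN oa; rewrite /N; lia.
by rewrite add0r nz //; move: aN oa; rewrite /N; lia.
Qed.

(* In each weight there are at most three unknowns. The equations [E2], [E3] (low
   weights) or [E4], [E5] (high weights) kill two of them and [E1] the third. *)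
Lemma weight_coef_eq0 w i : (i < 3)%N -> weight_coef w i = 0.
Proof.
move=> i3; pose x k := weight_coef w k; rewrite -/(x i).
have x_out k : (w - k < N.+1)%N = false -> x k = 0.
  by rewrite /x /weight_coef => ->; rewrite andbF.
have x_small k : (k <= w)%N = false -> x k = 0 by rewrite /x /weight_coef => ->.
pose lin (c d : C) : {poly C} := c%:P + d *: 'X.
have l11 : lin 1 1 = 1 + 'X by rewrite /lin scale1r.
have l10 : lin 1 0 = 1 by rewrite /lin scale0r addr0.
have l01 : lin 0 1 = 'X by rewrite /lin scale1r add0r.
have l1N : lin 1 (-1) = 1 - 'X by rewrite /lin scaleN1r.
have E l0 l1 m0 m1 (p q : {poly C}) : lin l0 l1 = p -> lin m0 m1 = q ->
    x 0 * ((p * q)`_0 * (p ^+ b.+1 * q ^+ b)`_w)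
    + x 1 * ((p * q)`_1 * (p ^+ b.+1 * q ^+ b)`_(w - 1))
    + x 2 * ((p * q)`_2 * (p ^+ b.+1 * q ^+ b)`_(w - 2)) = 0.
  move=> <- <-; have /= := pairing_weight l0 l1 m0 m1 w.
  by rewrite !big_ord_recl big_ord0 /= addr0 subn0 addrA.
have c1X : (((1 + 'X : {poly C})`_0 = 1) * ((1 + 'X : {poly C})`_1 = 1) *
    ((1 + 'X : {poly C})`_2 = 0))%type.
  by rewrite !coefD !coef1 !coefX !add0r !addr0.
have E2 : 'C(b.+1, w)%:R * x 0 + 'C(b.+1, w.-1)%:R * x 1 = 0.
  have := E _ _ _ _ _ _ l11 l10; rewrite expr1n !mulr1 !c1X !coef_one_addX.
  by rewrite !mul1r mul0r mulr0 addr0 subn1 ![_ * x _]mulrC.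
have E3 : 'C(b, w)%:R * x 0 + 'C(b, w.-1)%:R * x 1 = 0.
  have := E _ _ _ _ _ _ l10 l11; rewrite expr1n !mul1r !c1X !coef_one_addX.
  by rewrite !mul1r mul0r mulr0 addr0 subn1 ![_ * x _]mulrC.
have E4 : x 1 * (if (w - 1 < b)%N then 0 else 'C(b.+1, w - 1 - b)%:R)
    + x 2 * (if (w - 2 < b)%N then 0 else 'C(b.+1, w - 2 - b)%:R) = 0.
  have := E _ _ _ _ _ _ l11 l01; rewrite !coefMX /= !c1X !coefMXn !coef_one_addX.
  by rewrite !mul1r mul0r mulr0 add0r.
have E5 : x 1 * (if (w - 1 < b.+1)%N then 0 else 'C(b, w - 1 - b.+1)%:R)
    + x 2 * (if (w - 2 < b.+1)%N then 0 else 'C(b, w - 2 - b.+1)%:R) = 0.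
  have := E _ _ _ _ _ _ l01 l11; rewrite !coefXM /= !c1X !coefXnM !coef_one_addX.
  by rewrite !mul1r mul0r mulr0 add0r.
have E1 : x 0 * ((1 + 'X : {poly C}) ^+ b.+1 * (1 - 'X) ^+ b)`_w =
    x 2 * ((1 + 'X : {poly C}) ^+ b.+1 * (1 - 'X) ^+ b)`_(w - 2).
  have := E _ _ _ _ _ _ l11 l1N.
  have -> : (1 + 'X) * (1 - 'X) = 1 - 'X * 'X :> {poly C} by ring.
  rewrite !coefB !coef1 !coefXM !coefX /= subr0 subrr sub0r mul1r mul0r mulr0 addr0.
  by rewrite mulN1r mulrN => /eqP; rewrite subr_eq0 => /eqP.
suff [x0 [x1 x2]] : x 0 = 0 /\ x 1 = 0 /\ x 2 = 0 by case: i i3 => [|[|[|]]].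
have [wb|wb] := leqP w b.+1.
  have [w0|w_gt0] := posnP w.
    split; last by split; apply: x_small; rewrite w0.
    by move: E2; rewrite w0 (x_small 1) ?w0 // !bin0 mul1r mulr0 addr0.
  have [x0 x1] : x 0 = 0 /\ x 1 = 0 by apply: bin_two_term E2 E3; rewrite w_gt0.
  split=> //; split=> //.
  have [w1|w2] := leqP w 1; first by apply: x_small; rewrite leqNgt ltnS w1.
  move: E1; rewrite x0 mul0r => /esym/eqP; rewrite mulf_eq0 => /orP[/eqP //|].
  by rewrite (negPf (coef_equator _)) //; rewrite /N; lia.
have [w2|] := ltnP (b.*2 + 3) w.
  by split; [|split]; apply: x_out; rewrite /N; lia.
(* The top weight N + 2 has the single unknown [x 2]. *)
rewrite leq_eqVlt => /orP[/eqP w2|w2].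
  split; [|split]; try by apply: x_out; rewrite /N; lia.
  move: E4; rewrite (x_out 1%N); last by rewrite /N; lia.
  rewrite mul0r add0r ifF; last by lia.
  by rewrite (_ : (w - 2 - b = b.+1)%N) ?binn ?mulr1 //; lia.
(* Reversing the coefficients exchanges i with 2 - i and a with N - a, hence w with N + 2 - w = v:
   the high weights mirror the low ones. *)
pose v := (b.*2 + 3 - w)%N.
have [x2 x1] : x 2 = 0 /\ x 1 = 0.
  apply: (@bin_two_term v); first by rewrite /v; lia.
    move: E4; rewrite !ifF; [|by lia|by lia].
    rewrite -(@bin_sub b.+1 (w - 1 - b)); last by lia.
    rewrite -(@bin_sub b.+1 (w - 2 - b)); last by lia.
    rewrite (_ : (b.+1 - (w - 1 - b) = v.-1)%N); last by rewrite /v; lia.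
    rewrite (_ : (b.+1 - (w - 2 - b) = v)%N); last by rewrite /v; lia.
    by rewrite addrC ![_ * x _]mulrC.
  move: E5; rewrite ifF; last by lia.
  rewrite -(@bin_sub b (w - 1 - b.+1)); last by lia.
  rewrite (_ : (b - (w - 1 - b.+1) = v.-1)%N); last by rewrite /v; lia.
  have -> : (if (w - 2 < b.+1)%N then 0 else 'C(b, w - 2 - b.+1)%:R) = 'C(b, v)%:R :> C.
    case: ltnP => [wb'|wb']; first by rewrite bin_small //; rewrite /v; lia.
    rewrite -(@bin_sub b (w - 2 - b.+1)); last by lia.
    by congr 'C(_, _)%:R; rewrite /v; lia.
  by rewrite addrC ![_ * x _]mulrC.
split=> //.
have [w3|w3] := ltnP w N.+1; last by apply: x_out; rewrite subn0 ltnNge w3.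
move: E1; rewrite x2 mul0r => /eqP; rewrite mulf_eq0 => /orP[/eqP //|].
by rewrite (negPf (coef_equator _)).
Qed.

(** The spanning statement in dual form. It is applied at [b] to q_p and w, and at [b.+1] to q_p and
    q_p w, which is again a Dicke state up to a scalar. *)
Lemma kernel_spanning i a : (i < 3)%N -> (a < N.+1)%N -> beta i a = 0.
Proof.
move=> i3 aN; have := weight_coef_eq0 (i + a) i3.
by rewrite /weight_coef leq_addr addKn aN.
Qed.

End Span.

(** * Intertwining relations and their rigidity *)

Section Rigidity.
Variable C : numClosedFieldType.
Variables (b d : nat).
Let N := b.*2.+1.
Variables (E1 : 'M[C]_(N.+1, d)) (E2 : 'M[C]_(N.+3, d)) (cc : nat -> 'M[C]_d).
Hypothesis dN : (d <= N)%N.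

Lemma poly_sum (p : {poly C}) n : (size p <= n)%N -> p = \sum_(i < n) p`_i *: 'X^i.
Proof. by move=> sp; rewrite -{1}(take_poly_id sp) /take_poly poly_def. Qed.

(** The traceless part of psi as a complex linear function of q_p: at the point (1, s p) with p on
    the sphere, psi takes the value 1 + s [acomb q_p]. *)
Definition acomb (q : {poly C}) : 'M[C]_d := \sum_(i < 3) q`_i *: cc i.

Hypothesis annihilates : forall z s : C, s ^+ 2 = 1 -> s^* = s ->
  let q := bloch_quad (bloch_beta z) (bloch_gamma z) in let w := dicke z b in
  (poly_rV w *m E1 + poly_rV (- s *: (q * w)) *m E2) *m (1%:M + s *: acomb q) = 0.

Let V1 f : 'rV[C]_d := poly_rV f *m E1.
Let V2 f : 'rV[C]_d := poly_rV f *m E2.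
Let R1 a := V1 'X^a.
Let R2 a := V2 'X^a.

Let V1D f g : V1 (f + g) = V1 f + V1 g. Proof. by rewrite /V1 linearD mulmxDl. Qed.
Let V2D f g : V2 (f + g) = V2 f + V2 g. Proof. by rewrite /V2 linearD mulmxDl. Qed.
Let V1Z c f : V1 (c *: f) = c *: V1 f. Proof. by rewrite /V1 linearZ -scalemxAl. Qed.
Let V2Z c f : V2 (c *: f) = c *: V2 f. Proof. by rewrite /V2 linearZ -scalemxAl. Qed.
Let V10 : V1 0 = 0. Proof. by rewrite /V1 linear0 mul0mx. Qed.
Let V20 : V2 0 = 0. Proof. by rewrite /V2 linear0 mul0mx. Qed.
Let V1s n (F : 'I_n -> {poly C}) : V1 (\sum_i F i) = \sum_i V1 (F i).
Proof. exact: (big_morph V1 V1D V10). Qed.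
Let V2s n (F : 'I_n -> {poly C}) : V2 (\sum_i F i) = \sum_i V2 (F i).
Proof. exact: (big_morph V2 V2D V20). Qed.

(** The sum and the difference of the hypotheses for s = 1 and s = -1. *)
Let intertwine z : let q := bloch_quad (bloch_beta z) (bloch_gamma z) in let w := dicke z
  b in
  V2 (q * w) = V1 w *m acomb q /\ V1 w = V2 (q * w) *m acomb q.
Proof.
move=> q w.
have h1 := @annihilates z 1 (expr1n _ _) (rmorph1 _).
have h2 : (V1 w + V2 (q * w)) *m (1%:M - acomb q) = 0.
  have := @annihilates z (-1); rewrite sqrrN expr1n rmorphN1 => /(_ erefl erefl) /=.
  by rewrite -/q -/w opprK scale1r scaleN1r.
have {}h1 : (V1 w - V2 (q * w)) *m (1%:M + acomb q) = 0.
  by move: h1; rewrite /= -/q -/w scaleN1r linearN mulNmx scale1r.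
move: h1 h2; rewrite mulmxDr mulmxBr !mulmx1 mulmxBl mulmxDl.
move: (V1 w) (V2 _) (_ *m _) (_ *m _) => x y xa ya h1 h2.
have two (u : 'rV[C]_d) : u + u = 0 -> u = 0.
  by rewrite -mulr2n -scaler_nat => /eqP; rewrite scaler_eq0 pnatr_eq0 => /eqP.
split; apply/eqP; rewrite -subr_eq0; apply/eqP/two.
  rewrite -[RHS]subr0 -{1}h2 -{1}h1; apply/rowP => k; rewrite !mxE; ring.
rewrite -[RHS]addr0 -{1}h2 -{1}h1; apply/rowP => k; rewrite !mxE; ring.
Qed.

Let mxZ (c : C) (v : 'rV[C]_d) k : (c *: v) 0 k = c * v 0 k.
Proof. by rewrite mxE. Qed.

Let mxB (u v : 'rV[C]_d) k : (u - v) 0 k = u 0 k - v 0 k.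
Proof. by rewrite !mxE. Qed.

Let n2 z : C := 1 + z * z^*.
Let n2_neq0 z : n2 z != 0.
Proof. by rewrite /n2 gt_eqF // ltr_pwDl // -normCK exprn_ge0. Qed.

(** The first relation of [intertwine] is bilinear in (q, w) and the tensors that occur span, so it
    holds for all pairs of monomials. *)
Let R2_cc i a : (i < 3)%N -> (a < N.+1)%N -> R2 (i + a) = R1 a *m cc i.
Proof.
move=> i3 aN; apply/rowP => k; apply/eqP; rewrite -subr_eq0; apply/eqP.
pose beta i a := (R2 (i + a) 0 k - (R1 a *m cc i) 0 k).
apply: (@kernel_spanning _ b beta) i3 aN => {i a} z.
have [+ _] := intertwine z; set q := bloch_quad _ _; set w := dicke z b => E.
have lm : spinor z * antispinor z = n2 z *: q by rewrite /q bloch_quad_kernel scalerA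
  mulfV // scale1r.
have sw : (size w <= N.+1)%N by exact: size_dicke.
have Eq : V2 (q * w) = \sum_(i < 3) \sum_(a < N.+1) (q`_i * w`_a) *: R2 (i + a).
  rewrite {1}(poly_sum (size_bloch_quad _ _ : (size q <= 3)%N)) {1}(poly_sum sw)
    mulr_suml V2s.
  apply: eq_bigr => i _; rewrite mulr_sumr V2s; apply: eq_bigr => a _.
  by rewrite -scalerAl -scalerAr scalerA V2Z -exprD.
have Ew : V1 w *m acomb q = \sum_(i < 3) \sum_(a < N.+1) (q`_i * w`_a) *: (R1 a *m cc i).
  rewrite {1}(poly_sum sw) V1s /acomb mulmx_sumr; apply: eq_bigr => i _.
  rewrite mulmx_suml; apply: eq_bigr => a _.
  by rewrite V1Z -scalemxAl -scalemxAr scalerA mulrC.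
rewrite /pairing lm -/w; transitivity (n2 z * (V2 (q * w) - V1 w *m acomb q) 0 k).
  rewrite mxB Eq Ew !summxE -sumrB mulr_sumr; apply: eq_bigr => i _.
  rewrite !summxE -sumrB mulr_sumr; apply: eq_bigr => a _.
  rewrite /beta coefZ -/(dicke z b) -/w !mxZ; ring.
by rewrite E subrr mxE mulr0.
Qed.

(** The adjoint of multiplication by q is conjugate linear in q, but a [bloch_quad] satisfies
    conj(q_0) = - q_2 and conj(q_1) = q_1, so its adjoint is also the sum of the q_i D_i, linear in
    q. *)
Let D i (f : {poly C}) : {poly C} :=
  match i with
  | 0 => - f^`()^`() | 1 => dx N.+1 f^`() | _ => - dx N.+1 (dx N.+2 f)
  end.

(** As kappa w = q^* q w, the second relation of [intertwine] reads V1 (q^* G) = kappa V2 G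
    [acomb q] with G = q w. It is bilinear in (q, G), so the spanning in degree N + 2 applies. *)
Let R1_cc i c : (i < 3)%N -> (c < N.+3)%N -> V1 (D i 'X^c) = kappa C b *: (R2 c *m cc i).
Proof.
move=> i3 cN; apply/rowP => k; apply/eqP; rewrite -subr_eq0; apply/eqP.
pose beta i c := V1 (D i 'X^c) 0 k - (kappa C b *: (R2 c *m cc i)) 0 k.
have cN' : (c < b.+1.*2.+2)%N by rewrite doubleS.
apply: (@kernel_spanning _ b.+1 beta) i3 cN' => {i c cN} z.
have [_] := intertwine z; set q := bloch_quad _ _; set w := dicke z b => E.
have lm : spinor z * antispinor z = n2 z *: q by rewrite /q bloch_quad_kernel scalerA
  mulfV // scale1r.
pose G := q * w.
have sG : (size G <= N.+3)%N.
  apply: leq_trans (size_polyMleq _ _) _.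
  have sw : (size w <= N.+1)%N by exact: size_dicke.
  by have := size_bloch_quad (bloch_beta z) (bloch_gamma z); rewrite -/q; lia.
have lmG : spinor z ^+ b.+2 * antispinor z ^+ b.+1 = n2 z *: G.
  by rewrite /G scalerAl -lm /w /dicke !exprS; ring.
have EG : kappa C b *: V1 w = V1 (\sum_(i < 3) q`_i *: D i G).
  rewrite -V1Z -qadj_dicke -/q -/w -/G; congr V1.
  have half : (2^-1 : C)^* = 2^-1 by rewrite fmorphV rmorph_nat.
  have e0 (g : C) : (- (g / 2))^* = - (g^* / 2) by rewrite rmorphN rmorphM /= half.
  have e2 (g : C) : (g^* / 2)^* = g / 2 by rewrite rmorphM /= half conjCK.
  rewrite /qadj !big_ord_recl big_ord0 /= /q !coef_bloch_quad bloch_beta_real e0 e2.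
  by rewrite addr0 !scalerN !scaleNr !opprK addrC.
have E' : V1 (\sum_(i < 3) q`_i *: D i G) =
  \sum_(i < 3) \sum_(a < N.+3) (q`_i * G`_a) *: V1 (D i 'X^a).
  rewrite V1s; apply: eq_bigr => i _; rewrite V1Z {1}(poly_sum sG).
  have DD f g : D i (f + g) = D i f + D i g.
    by case: i => [[|[|[|]]]] //= _; rewrite /dx -?mul_polyC !derivE; ring.
  have DZ c f : D i (c *: f) = c *: D i f.
    by case: i {DD} => [[|[|[|]]]] //= _; rewrite /dx -?mul_polyC !derivE; ring.
  have D0 : D i 0 = 0 by have := DZ 0 0; rewrite !scale0r.
  rewrite (big_morph (D i) DD D0) V1s scaler_sumr; apply: eq_bigr => a _.
  by rewrite DZ V1Z scalerA.
have E'' : kappa C b *: (V2 G *m acomb q) =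
  \sum_(i < 3) \sum_(a < N.+3) (q`_i * G`_a) *: (kappa C b *: (R2 a *m cc i)).
  rewrite {1}(poly_sum sG) V2s /acomb mulmx_sumr scaler_sumr; apply: eq_bigr => i _.
  rewrite mulmx_suml scaler_sumr; apply: eq_bigr => a _.
  by rewrite V2Z -scalemxAl -scalemxAr !scalerA; congr (_ *: _); ring.
rewrite /pairing lm lmG -/N.
transitivity (n2 z ^+ 2 * (kappa C b *: V1 w - kappa C b *: (V2 G *m acomb q)) 0 k).
  rewrite mxB EG E' E'' !summxE -sumrB mulr_sumr; apply: eq_bigr => i _.
  rewrite !summxE -sumrB mulr_sumr; apply: eq_bigr => a _.
  rewrite /beta !coefZ !mxZ; ring.
by rewrite E subrr mxE mulr0.
Qed.

Lemma dxXn n c : dx n 'X^c = (n%:R - c%:R) *: 'X^c :> {poly C}.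
Proof.
apply/polyP => a; rewrite coef_dx coefZ coefXn.
by case: eqP => [->|]; rewrite ?mulr0.
Qed.

Lemma dxZ n c (f : {poly C}) : dx n (c *: f) = c *: dx n f.
Proof. by rewrite /dx -!mul_polyC !derivE; ring. Qed.

(* [E1] and [E2] intertwine multiplication by quadratic forms and its adjoint with
   [d x d] matrices. Since [cc 0 *m cc 2] has the images of the [N + 1 > d] monomials as
   eigenvectors with distinct eigenvalues, one of these images vanishes, and the
   relations [R1_cc], [R2_cc] spread this to all of them. *)
Lemma rigidity : E1 = 0 /\ E2 = 0.
Proof.
have kN0 : kappa C b != 0 by rewrite gt_eqF ?kappa_gt0.
(* [cc 0] sends R1 a to R2 a, and [cc 2] sends that to a multiple of the image of the second
   x-derivative of x^(N+2-a) y^a. *)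
pose lam a : C := - ((N.+1%:R - a%:R) * (N.+2%:R - a%:R)) / kappa C b.
have eig a : (a < N.+1)%N -> R1 a *m (cc 0 *m cc 2) = lam a *: R1 a.
  move=> aN; rewrite mulmxA -R2_cc // add0n.
  have := @R1_cc 2 a isT; rewrite /= => /(_ (leqW (leqW aN))).
  rewrite dxXn dxZ dxXn scalerA -scaleNr V1Z => /(congr1 (fun v => (kappa C b)^-1 *: v)).
  by rewrite !scalerA mulVf // scale1r /lam => <-; congr (_ *: _); ring.
have lam_inj a a' : (a < N.+1)%N -> (a' < N.+1)%N -> lam a = lam a' -> a = a'.
  move=> aN aN' /(mulIf (invr_neq0 kN0)) /oppr_inj.
  rewrite -!natrB ?(leqW (ltnW aN)) ?(leqW (ltnW aN')) ?(ltnW aN) ?(ltnW aN') // -!natrM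
    => /eqP.
  rewrite eqr_nat => /eqP; nia.
(* Otherwise the characteristic polynomial, of degree d <= N, would have N + 1 distinct roots. *)
have [a aN R1a] : exists2 a, (a < N.+1)%N & R1 a = 0.
  apply: contrapT => noR1.
  pose s := [seq lam a | a <- iota 0 N.+1].
  have : (size s < size (char_poly (cc 0 *m cc 2)))%N.
    apply: max_poly_roots; first exact/monic_neq0/char_poly_monic.
      apply/allP => _ /mapP[a + ->]; rewrite mem_iota /= add0n => aN.
      rewrite -eigenvalue_root_char; apply/eigenvalueP; exists (R1 a); first exact: eig.
      by apply/eqP => R1a; apply: noR1; exists a.
    rewrite map_inj_in_uniq ?iota_uniq // => a a'.
    by rewrite !mem_iota /= !add0n; exact: lam_inj.
  by rewrite size_char_poly size_map size_iota ltnS ltnNge dN.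
have down a' : (a' < N.+1)%N -> R1 a' = 0 -> forall i, (i < 3)%N -> R2 (i + a') = 0.
  by move=> aN' R10 i i3; rewrite R2_cc // R10 mul0mx.
(* The mixed derivative maps X^(c+1) to a nonzero multiple of X^c. Together with [down], this
   carries R1 a = 0 to a - 1 and a + 1. *)
have step c : (c < N.+1)%N -> R2 c.+1 = 0 -> R1 c = 0.
  move=> cN R2c; have := @R1_cc 1 c.+1 isT; rewrite /= => /(_ (leqW cN)).
  rewrite R2c mul0mx scaler0 derivXn -scaler_nat dxZ dxXn scalerA V1Z => /eqP.
  rewrite scaler_eq0 mulf_eq0 pnatr_eq0 /= subr_eq0 eqr_nat => /orP[/eqP cN'|/eqP //].
  by move: cN; rewrite cN' ltnn.
have R1down c : (c <= a)%N -> R1 (a - c) = 0.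
  elim: c => [|c IH] ca; first by rewrite subn0.
  apply: step; first by rewrite (leq_ltn_trans _ aN) ?leq_subr.
  have -> : (a - c.+1).+1 = (0 + (a - c))%N by rewrite subnSK.
  by apply: down => //; [rewrite (leq_ltn_trans _ aN) ?leq_subr|exact/IH/ltnW].
have R1up c : (a + c < N.+1)%N -> R1 (a + c) = 0.
  elim: c => [|c IH] ca; first by rewrite addn0.
  rewrite addnS in ca *; apply: step => //.
  rewrite -[(a + c).+2]/(2 + (a + c))%N; apply: down => //; first exact: ltnW.
  exact/IH/ltnW.
have all1 a' : (a' < N.+1)%N -> R1 a' = 0.
  move=> aN'; have [aa|/ltnW aa] := leqP a' a.
    by rewrite -(subKn aa); apply: R1down; exact: leq_subr.
  by rewrite -(subnKC aa); apply: R1up; rewrite subnKC.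
have all2 c : (c < N.+3)%N -> R2 c = 0.
  rewrite ltnS => cN; have [cN1|cN1] := ltnP c N.+1.
    by rewrite -[c]add0n; apply: down => //; exact: all1.
  have -> : c = ((c - N) + N)%N by rewrite subnK // ltnW.
  by apply: down; [|exact: all1|rewrite ltn_subLR ?addn3 // ltnW].
have rowX n (k : 'I_n) : poly_rV 'X^k = delta_mx 0 k :> 'rV[C]_n.
  by apply/rowP => j; rewrite !mxE coefXn eqxx.
split; apply/row_matrixP => i; rewrite row0 rowE -rowX; [exact: all1|exact: all2].
Qed.
End Rigidity.

(** * Non-subhomogeneity *)

(** A finite list whose span has maximal rank. It replaces the infinite family of kernel vectors by
    a list independent of psi. *)
Lemma finite_span (F : fieldType) (T : eqType) n (f : T -> 'rV[F]_n) (Q : T -> Prop) :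
  exists s : seq T, (forall x, x \in s -> Q x) /\
    forall x, Q x -> (f x <= \sum_(y <- s) <<f y>>)%MS.
Proof.
pose sp (s : seq T) := (\sum_(y <- s) <<f y>>)%MS.
pose P k := `[< exists s : seq T, (forall x, x \in s -> Q x) /\ \rank (sp s) = k >].
have P0 : exists k, P k by exists (\rank (sp [::])); apply/asboolP; exists [::].
have Pb k : P k -> (k <= n)%N by move=> /asboolP [s [_ <-]]; exact: rank_leq_row.
case: (ex_maxnP P0 Pb) => k /asboolP [s [sQ sk]] kmax; exists s; split=> // x Qx.
have : P (\rank (sp (x :: s))).
  apply/asboolP; exists (x :: s); split=> // y; rewrite inE => /predU1P [->//|]; exact: sQ.
move/kmax; rewrite -sk => rle.
have sub : (sp s <= sp (x :: s))%MS by rewrite /sp big_cons addsmxSr.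
have := mxrank_leqif_sup sub; rewrite /Order.leif => -[_].
rewrite eqn_leq mxrankS // rle => /esym; apply: submx_trans.
by rewrite /sp big_cons (submx_trans _ (addsmxSl _ _)) // genmxE.
Qed.

Section Forms.
Variable C : numClosedFieldType.

Lemma row_form n (v w : 'rV[C]_n) (H : 'M[C]_n) :
  (v *m H *m w^t*) 0 0 = \sum_i \sum_j v 0 i * H i j * (w 0 j)^*.
Proof.
rewrite mxE exchange_big; apply: eq_bigr => j _.
by rewrite !mxE mulr_suml; apply: eq_bigr => i _.
Qed.

Lemma psd_null n (H : 'M[C]_n) (v : 'rV[C]_n) : H^t* = H ->
  (forall u : 'rV[C]_n, 0 <= (u *m H *m u^t*) 0 0) ->
  (v *m H *m v^t*) 0 0 = 0 -> v *m H = 0.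
Proof.
move=> herH posH v0; set w := v *m H.
pose q := (w *m w^t*) 0 0; pose K := (w *m H *m w^t*) 0 0.
have qE : q = \sum_j `|w 0 j| ^+ 2.
  by rewrite /q mxE; apply: eq_bigr => j _; rewrite !mxE normCK.
have q0 : 0 <= q by rewrite qE sumr_ge0 // => j _; rewrite exprn_ge0.
suff : q = 0.
  rewrite qE => /eqP; rewrite psumr_eq0; last by move=> j _; rewrite exprn_ge0.
  move=> /allP H0; apply/rowP => j; rewrite [RHS]mxE; apply/eqP.
  by have := H0 j (mem_index_enum _); rewrite /= expf_eq0 /= normr_eq0.
apply/eqP; rewrite eq_le q0 andbT.
have K0 : 0 <= K by exact: posH.
have K1 : 0 < K + 1 by rewrite ltr_wpDl.
(* Step length for the test vector v - e w, where positivity gives e q + e^2 <= 0. The 1 in K + 1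
   covers K = 0. *)
have [e e0 eK] : exists2 e, 0 <= e & e * (K + 1) = q.
  exists (q / (K + 1)); first by rewrite divr_ge0 // ltW.
  by rewrite mulfVK // gt_eqF.
have er : e^* = e by apply/CrealP/ger0_real.
have wv : w *m H *m v^t* = w *m w^t*.
  by rewrite /w trmx_mul map_mxM herH !mulmxA.
have := posH (v - e *: w).
have -> : (v - e *: w)^t* = v^t* - e *: w^t*.
  by apply/matrixP => i j; rewrite !mxE rmorphB rmorphM /= er.
have -> : (v - e *: w) *m H *m (v^t* - e *: w^t*) =
    v *m H *m v^t* - e *: (w *m w^t*) - e *: (w *m w^t*) + (e * e) *: (w *m H *m w^t*).
  rewrite mulmxBl mulmxBr !mulmxBl -!scalemxAl -!scalemxAr.
  by rewrite wv -/w scalerA opprD opprK !addrA.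
have -> : forall a c k : 'M[C]_1, (a - e *: c - e *: c + (e * e) *: k) 0 0 =
    a 0 0 - e * c 0 0 - e * c 0 0 + e * (e * k 0 0).
  by move=> a c k; rewrite !mxE mulrA.
rewrite v0 -/q -/K => h.
have : e * q + e ^+ 2 <= 0.
  rewrite -oppr_ge0; apply: le_trans h _; rewrite le_eqVlt; apply/orP; left; apply/eqP.
  have -> : e * K = q - e by rewrite -eK; ring.
  ring.
have h1 : 0 <= e * q by rewrite mulr_ge0.
have h2 : 0 <= e ^+ 2 by rewrite exprn_ge0.
move=> h3; have : e * q + e ^+ 2 == 0 by rewrite eq_le h3 addr_ge0.
rewrite paddr_eq0 // => /andP[_]; rewrite expf_eq0 /= => /eqP e00.
by rewrite -eK e00 mul0r.
Qed.

Lemma sum_mxtens d s (F : 'I_(d * s) -> C) :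
  \sum_k F k = \sum_i \sum_j F (mxtens_index (i, j)).
Proof.
rewrite pair_big /= (reindex (@mxtens_index d s)) /=; last first.
  by exists (@mxtens_unindex d s) => k _; [exact: mxtens_indexK|exact: mxtens_unindexK].
by apply: eq_bigr => -[i j].
Qed.

Definition untens d s (xi : 'rV[C]_(d * s)) : 'M[C]_(s, d) :=
  \matrix_(j, i) xi 0 (mxtens_index (i, j)).

(** Turns the vanishing of a sum of such forms into the equations v E psi(p) = 0 with E =
    [untens xi]. *)
Lemma tens_rank1_form d s (xi : 'rV[C]_(d * s)) (Psi : 'M[C]_d) (B : 'M[C]_s)
    (v : 'rV[C]_s) : (forall i j, B i j = v 0 i * (v 0 j)^*) ->
  (xi *m (Psi *t B) *m xi^t*) 0 0 =
  ((v *m untens xi) *m Psi *m (v *m untens xi)^t*) 0 0.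
Proof.
move=> HB; rewrite !row_form sum_mxtens.
have L i : \sum_(j < s) \sum_(k < d * s)
    xi 0 (mxtens_index (i, j)) * (Psi *t B) (mxtens_index (i, j)) k * (xi 0 k)^* =
  \sum_(i' < d) (\sum_(j < s) xi 0 (mxtens_index (i, j)) * v 0 j) * Psi i i' *
    (\sum_(j' < s) xi 0 (mxtens_index (i', j')) * v 0 j')^*.
  rewrite (eq_bigr (fun j => \sum_(i' < d) \sum_(j' < s)
    (xi 0 (mxtens_index (i, j)) * v 0 j) * Psi i i' *
    (xi 0 (mxtens_index (i', j')) * v 0 j')^*)).
    rewrite exchange_big; apply: eq_bigr => i' _.
    rewrite rmorph_sum !mulr_suml; apply: eq_bigr => j _.
    by rewrite mulr_sumr.
  move=> j _; rewrite sum_mxtens; apply: eq_bigr => i' _; apply: eq_bigr => j' _.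
  by rewrite tensmxE HB rmorphM /=; ring.
rewrite (eq_bigr _ (fun i _ => L i)); apply: eq_bigr => i _; apply: eq_bigr => i' _.
congr (_ * _ * _^*); rewrite mxE; apply: eq_bigr => j _; rewrite mxE mulrC //.
Qed.

End Forms.

Section Herm.
Variable R : realType.
Variable n : nat.
Local Notation C := R[i].

Fact rank1_subproof (v : 'rV[C]_n) : (v^T *m v^t*^T) \is hermsymmx.
Proof.
apply/hermP => i j; rewrite !mxE !big_ord1 !mxE rmorphM /= conjCK; exact: mulrC.
Qed.
Definition rank1 (v : 'rV[C]_n) : herm R n := Herm (rank1_subproof v).

Lemma rank1E v i j : rank1 v i j = v 0 i * (v 0 j)^*.
Proof. by rewrite /= mxE big_ord1 !mxE. Qed.

Lemma psd_rank1 v : psd (rank1 v).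
Proof.
move=> u; rewrite row_form.
have -> : \sum_i \sum_j u 0 i * rank1 v i j * (u 0 j)^* =
    (\sum_i u 0 i * v 0 i) * (\sum_j u 0 j * v 0 j)^*.
  rewrite rmorph_sum mulr_suml; apply: eq_bigr => i _; rewrite mulr_sumr.
  by apply: eq_bigr => j _; rewrite rank1E rmorphM /=; ring.
by rewrite -normCK exprn_ge0.
Qed.

Lemma psd_decomp (b : herm R n) : psd b -> exists v : 'I_n -> 'rV[C]_n,
  forall i j, b i j = \sum_k (v k) 0 i * ((v k) 0 j)^*.
Proof.
move=> posb; set U := spectralmx (herm_mx b).
have bn : herm_mx b \is normalmx by apply: hermitian_normalmx; case: (b).
have bE := orthomx_spectralP bn; have Uu := spectral_unitarymx (herm_mx b).
set D := spectral_diag (herm_mx b) in bE.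
have UU : U *m U^t* = 1%:M by apply/unitarymxP.
rewrite -/U invmx_unitary // in bE.
have UbU : U *m herm_mx b *m U^t* = diag_mx D.
  by rewrite bE !mulmxA UU mul1mx -mulmxA UU mulmx1.
have D0 k : 0 <= D 0 k.
  have := posb (row k U); rewrite -row_mul.
  have -> : row k (U *m herm_mx b) *m (row k U)^t* = row k (U *m herm_mx b) *m (U^t* *m
    delta_mx k 0).
    by congr (_ *m _); rewrite -colE; apply/matrixP => i j; rewrite !mxE.
  by rewrite mulmxA -row_mul UbU -colE !mxE eqxx mulr1n.
exists (fun k => \row_i (sqrtC (D 0 k) * (U k i)^*)) => i j.
rewrite bE !mxE; apply: eq_bigr => k _; rewrite mul_mx_diag !mxE rmorphM /= conjCK.
have -> : (sqrtC (D 0 k))^* = sqrtC (D 0 k).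
  by apply/CrealP/ger0_real; rewrite sqrtC_ge0.
rewrite mulrACA -expr2 sqrtCK; ring.
Qed.
End Herm.

(** * The separating functional *)

Section Witness.
Variables (R : realType) (b : nat).
Local Notation C := R[i].
Let N := b.*2.+1.
Local Notation n := (N.+1 + N.+3)%N.
Implicit Types (y : 'rV[R]_4) (v : 'rV[C]_n).

Definition lorentz4 : set 'rV[R]_4 :=
  [set y | 0 <= y 0 0 /\
    y 0 (inord 1) ^+ 2 + y 0 (inord 2) ^+ 2 + y 0 (inord 3) ^+ 2 <= y 0 0 ^+ 2].

Definition ybe y : C := (y 0 (inord 3))%:C.
Definition yga y : C := y 0 (inord 1) +i* y 0 (inord 2).
Definition left_poly v : {poly C} := rVpoly (lsubmx v).
Definition right_poly v : {poly C} := rVpoly (rsubmx v).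

Definition witness y v v' : C :=
  Wform b (y 0 0)%:C (ybe y) (yga y) (left_poly v) (right_poly v) (left_poly v')
    (right_poly v').

Lemma ybe_real y : (ybe y)^* = ybe y.
Proof. by rewrite /ybe conjcE conjc_real. Qed.

Lemma ynorm y : ybe y ^+ 2 + yga y * (yga y)^* =
  (y 0 (inord 1) ^+ 2 + y 0 (inord 2) ^+ 2 + y 0 (inord 3) ^+ 2)%:C.
Proof.
rewrite /ybe /yga conjcE /=; apply/eqP; rewrite eq_complex /=.
by apply/andP; split; apply/eqP; ring.
Qed.

Lemma witness_ge0 y v : lorentz4 y -> 0 <= witness y v v.
Proof.
move=> [y0 yle]; apply: Wform_ge0; [exact: ybe_real|by rewrite lecR| |exact: size_poly].
by rewrite ynorm -rmorphXn lecR.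
Qed.

Lemma witness_linear_y (c : R) y y' v v' :
  witness (c *: y + y') v v' = c%:C * witness y v v' + witness y' v v'.
Proof.
rewrite -Wform_linear_p; last by rewrite conjcE conjc_real.
rewrite /witness; congr (Wform _ _ _ _ _ _ _ _).
- by rewrite !mxE rmorphD rmorphM.
- by rewrite /ybe !mxE rmorphD rmorphM.
rewrite /yga !mxE; apply/eqP; rewrite eq_complex /=.
by apply/andP; split; apply/eqP; ring.
Qed.

Lemma witness_linear_l y (c : C) v u v' : witness y (c *: v + u) v' = c * witness y v v'
  + witness y u v'.
Proof. by rewrite -Wform_linear_l /witness /left_poly /right_poly !linearP. Qed.

Lemma witness_linear_r y (c : C) v u v' :
  witness y v' (c *: v + u) = c^* * witness y v' v + witness y v' u.
Proof. by rewrite -Wform_linear_r /witness /left_poly /right_poly !linearP. Qed.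

Lemma witness_sum_l y m (c : 'I_m -> C) (F : 'I_m -> 'rV[C]_n) v' :
  witness y (\sum_i c i *: F i) v' = \sum_i c i * witness y (F i) v'.
Proof.
elim/big_rec2: _ => [|i x u _ <-]; last exact: witness_linear_l.
by have := witness_linear_l y (-1) 0 0 v'; rewrite scaler0 addr0 => ->; ring.
Qed.

Lemma witness_sum_r y m (c : 'I_m -> C) (F : 'I_m -> 'rV[C]_n) v' :
  witness y v' (\sum_i c i *: F i) = \sum_i (c i)^* * witness y v' (F i).
Proof.
elim/big_rec2: _ => [|i x u _ <-]; last exact: witness_linear_r.
have := witness_linear_r y (-1) 0 0 v'; rewrite scaler0 addr0 rmorphN1 => ->; ring.
Qed.

Definition witness_mx y (i j : 'I_n) : C := witness y (delta_mx 0 i) (delta_mx 0 j).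

Lemma witness_expand y v v' :
  witness y v v' = \sum_i \sum_j (v 0 i * (v' 0 j)^*) * witness_mx y i j.
Proof.
rewrite {1}(row_sum_delta v) witness_sum_l; apply: eq_bigr => i _.
rewrite {1}(row_sum_delta v') witness_sum_r mulr_sumr; apply: eq_bigr => j _.
by rewrite mulrA.
Qed.

Definition witness_sum y (h : 'M[C]_n) : C := \sum_i \sum_j h i j * witness_mx y i j.
Definition witness_pair y (h : herm R n) : R := complex.Re (witness_sum y h).

Lemma witness_pair_rank1 y v : witness_pair y (rank1 v) = complex.Re (witness y v v).
Proof.
rewrite /witness_pair /witness_sum witness_expand; congr complex.Re.
by apply: eq_bigr => i _; apply: eq_bigr => j _; rewrite rank1E.
Qed.

Lemma Re_ge0 (c : C) : 0 <= c -> 0 <= complex.Re c.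
Proof. by case: c => x x'; rewrite lecE /= => /andP[]. Qed.

Lemma witness_pair_ge0 y h : lorentz4 y -> psd h -> 0 <= witness_pair y h.
Proof.
move=> ly /psd_decomp [v hE]; apply: Re_ge0.
have -> : witness_sum y h = \sum_k witness y (v k) (v k).
  rewrite [RHS](eq_bigr _ (fun k _ => witness_expand y (v k) (v k))) [RHS]exchange_big.
  apply: eq_bigr => i _; rewrite [RHS]exchange_big; apply: eq_bigr => j _.
  by rewrite hE mulr_suml.
by apply: sumr_ge0 => k _; exact: witness_ge0.
Qed.

Lemma witness_sum_linear_y (h : 'M[C]_n) (c : R) y y' :
  witness_sum (c *: y + y') h = c%:C * witness_sum y h + witness_sum y' h.
Proof.
rewrite /witness_sum mulr_sumr -big_split; apply: eq_bigr => i _ /=.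
rewrite mulr_sumr -big_split; apply: eq_bigr => j _ /=.
by rewrite {1}/witness_mx witness_linear_y mulrDr mulrCA.
Qed.

Lemma witness_sum_linear_h y (c : C) (h h' : 'M[C]_n) :
  witness_sum y (c *: h + h') = c * witness_sum y h + witness_sum y h'.
Proof.
rewrite /witness_sum mulr_sumr -big_split; apply: eq_bigr => i _ /=.
rewrite mulr_sumr -big_split; apply: eq_bigr => j _ /=.
by rewrite !mxE mulrDl mulrA.
Qed.

Lemma Re_linear (c : R) (x x' : C) :
  complex.Re (c%:C * x + x') = c * complex.Re x + complex.Re x'.
Proof. by case: x x' => [u u'] [w w'] /=; rewrite mul0r subr0. Qed.

Lemma witness_pair_linear_y h (c : R) y y' :
  witness_pair (c *: y + y') h = c * witness_pair y h + witness_pair y' h.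
Proof. by rewrite /witness_pair witness_sum_linear_y Re_linear. Qed.

Lemma witness_pair_linear_h y (c : R) (h h' : herm R n) :
  witness_pair y (c *: h + h') = c * witness_pair y h + witness_pair y h'.
Proof.
rewrite /witness_pair -[herm_mx (c *: h + h')]/(c%:C *: herm_mx h + herm_mx h').
by rewrite witness_sum_linear_h Re_linear.
Qed.

Definition apex : 'rV[R]_4 := delta_mx 0 0.

Lemma lorentz4_apex : lorentz4 apex.
Proof.
split; rewrite !mxE eqxx // !andTb.
have i0 k : (0 < k < 4)%N -> ((inord k : 'I_4) == 0) = false.
  by move=> /andP[k0 k4]; apply/negP => /eqP /(congr1 val); rewrite /= inordK //;
    case: k k0 {k4}.
by rewrite !i0 // expr0n !addr0 expr1n.
Qed.

(** At the apex the off-diagonal part of W vanishes and the form is kappa |f|^2 + |g|^2. One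
    positive diagonal entry suffices, the others being nonnegative. *)
Lemma witness_pair_apex_gt0 : 0 < witness_pair apex herm1.
Proof.
have -> : witness_pair apex herm1 = \sum_i complex.Re (witness_mx apex i i).
  rewrite /witness_pair /witness_sum (raddf_sum (@complex.Re R)); apply: eq_bigr => i _.
  congr complex.Re; rewrite (bigD1 i) //= mxE eqxx mul1r big1 ?addr0 // => j ji.
  by rewrite mxE eq_sym (negPf ji) mul0r.
rewrite (bigD1 (lshift N.+3 ord0)) //=; apply: ltr_wpDr.
  by apply: sumr_ge0 => i _; apply/Re_ge0/witness_ge0/lorentz4_apex.
suff : 0 < witness_mx apex (lshift N.+3 ord0) (lshift N.+3 ord0).
  by rewrite ltcE /= => /andP[].
rewrite /witness_mx /witness.
have j0 k : (0 < k < 4)%N -> apex 0 (inord k) = 0.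
  move=> /andP[k0 k4]; rewrite mxE eqxx /=; case: eqP => // /(congr1 val).
  by rewrite /= inordK // => k0'; rewrite k0' in k0.
have -> : ybe apex = 0 by rewrite /ybe j0.
have -> : yga apex = 0 by rewrite /yga !j0.
rewrite /Wform bloch_quad0 !mul0r fischer0l fischer0r !addr0.
have -> : apex 0 0 = 1 by rewrite mxE !eqxx.
rewrite mulr1 mul1r ltr_pwDl ?fischer_ge0 // mulr_gt0 ?kappa_gt0 // fischer_gt0 //.
rewrite /left_poly coef_rVpoly /= insubT /= !mxE /=.
exact: oner_neq0.
Qed.

Definition kernel_y (z : C) (s : R) : 'rV[R]_4 :=
  \row_k nth 0 [:: 1; s * complex.Re (bloch_gamma z); s * complex.Im (bloch_gamma z);
    s * complex.Re (bloch_beta z)] k.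
Definition kernel_v (z : C) (s : R) : 'rV[C]_n :=
  row_mx (poly_rV (dicke z b)) (poly_rV (- s%:C *: (bloch_quad (bloch_beta z)
    (bloch_gamma z) * dicke z b))).

Lemma kernel_coords z s :
  [/\ kernel_y z s 0 0 = 1, ybe (kernel_y z s) = s%:C * bloch_beta z &
      yga (kernel_y z s) = s%:C * bloch_gamma z].
Proof.
split; first by rewrite mxE.
  rewrite /ybe mxE inordK //= rmorphM /=; congr (_ * _).
  by have := bloch_beta_real z; rewrite conjcE; case: (bloch_beta z) => x x' /= [/eqP];
    rewrite eqNr => /eqP ->.
rewrite /yga !mxE !inordK //=; case: (bloch_gamma z) => x x' /=.
by apply/eqP; rewrite eq_complex /= !mul0r subr0 addr0 !eqxx.
Qed.

Lemma kernel_witness z s : s ^+ 2 = 1 ->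
  lorentz4 (kernel_y z s) /\ witness (kernel_y z s) (kernel_v z s) (kernel_v z s) = 0.
Proof.
move=> s2; have [y0 ybeE ygaE] := kernel_coords z s.
have sr : (s%:C : C)^* = s%:C by rewrite conjcE conjc_real.
have s2C : (s%:C : C) ^+ 2 = 1 by rewrite -rmorphXn s2.
split.
  split; first by rewrite y0.
  rewrite y0 expr1n -lecR -ynorm ybeE ygaE rmorphM /= sr.
  have -> : (s%:C * bloch_beta z) ^+ 2 + s%:C * bloch_gamma z * (s%:C * (bloch_gamma z)^*) =
    s%:C ^+ 2 * (bloch_beta z ^+ 2 + bloch_gamma z * (bloch_gamma z)^*) by ring.
  by rewrite s2C bloch_unit mulr1.
rewrite /witness y0 ybeE ygaE /left_poly /right_poly /kernel_v row_mxKl row_mxKr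
  !poly_rV_K ?size_dicke //.
  exact: Wform_kernel.
rewrite (leq_trans (size_scale_leq _ _)) // (leq_trans (size_polyMleq _ _)) //.
by rewrite -subn1 leq_subLR (leq_trans (leq_add (size_bloch_quad _ _) (size_dicke _ _))).
Qed.

End Witness.

Section KernelRigidity.
Variables (R : realType) (b d : nat).
Local Notation C := R[i].
Let N := b.*2.+1.
Local Notation n := (N.+1 + N.+3)%N.

Lemma kernel_rigid (E : 'M[C]_(n, d)) (psi : 'rV[R]_4 -> 'M[C]_d) : (d <= N)%N ->
  (forall (c : R) y y', psi (c *: y + y') = c%:C *: psi y + psi y') ->
  psi (apex R) = 1%:M ->
  (forall (z : C) (s : R), s ^+ 2 = 1 ->
    kernel_v b z s *m E *m psi (kernel_y z s) = 0) ->
  E = 0.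
Proof.
move=> dN psiL psi1 ann.
pose a k := psi (delta_mx 0 (inord k)).
(* From x1 = q_2 - q_0, x2 = i (q_0 + q_2) and x3 = q_1, the coordinates of p in terms of its
   quadratic form. *)
pose cc k := match k with
  | 0 => - (a 1%N - 'i%C *: a 2) | 1 => a 3 | _ => a 1%N + 'i%C *: a 2 end.
suff [E1 E2] : usubmx E = 0 /\ dsubmx E = 0.
  by rewrite -[E]vsubmxK E1 E2 col_mx0.
apply: (@rigidity _ b d _ _ cc dN) => z s s2 sr q w.
have [t sE] : exists t : R, s = t%:C.
  exists (complex.Re s); move: sr; rewrite conjcE; case: (s) => x x' /= [/eqP].
  by rewrite eqNr => /eqP ->.
have t2 : t ^+ 2 = 1 by apply: complexI; rewrite rmorphXn /= -sE.
have := ann z t t2; rewrite -{1}[E]vsubmxK /kernel_v mul_row_col -sE -/q -/w.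
suff -> : psi (kernel_y z t) = 1%:M + s *: acomb cc q by [].
have psi0 : psi 0 = 0.
  have := psiL (-1) 0 0; rewrite scaler0 addr0 rmorphN1 scaleN1r => /eqP.
  by rewrite addNr => /eqP.
have psiZ c y : psi (c *: y) = c%:C *: psi y by rewrite -[c *: y]addr0 psiL psi0 addr0.
have -> : kernel_y z t = t *: (complex.Re (bloch_gamma z) *: delta_mx 0 (inord 1)
    + (complex.Im (bloch_gamma z) *: delta_mx 0 (inord 2) + complex.Re (bloch_beta z) *:
      delta_mx 0 (inord 3)))
    + apex R.
  apply/rowP => -[k k4]; rewrite !mxE /= -!val_eqE /= !inordK //.
  case: k k4 => [|[|[|[|]]]] //= _; rewrite !(mulr0, mulr1, addr0, add0r) //.
rewrite psiL psi1 addrC psiL psiL psiZ sE; congr (_ + _ *: _).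
rewrite /acomb !big_ord_recl big_ord0 /= /q !coef_bloch_quad -/(a 1%N) -/(a 2) -/(a 3).
have -> : (complex.Re (bloch_beta z))%:C = bloch_beta z.
  by have := bloch_beta_real z; rewrite conjcE; case: (bloch_beta z) => x x' /= [/eqP];
    rewrite eqNr => /eqP ->.
have two0 : (2 : C) != 0 by rewrite pnatr_eq0.
have -> : (complex.Re (bloch_gamma z))%:C = bloch_gamma z / 2 + (bloch_gamma z)^* / 2.
  apply: (mulfI two0); rewrite mulrDr ![2 * (_ / 2)]mulrC !mulfVK // mulr_natl mulr2n.
  rewrite conjcE; case: (bloch_gamma z) => x x'; apply/eqP; rewrite eq_complex /=.
  by rewrite subrr addr0 !eqxx.
have -> : (complex.Im (bloch_gamma z))%:C = 'i%C * ((bloch_gamma z)^* / 2 - bloch_gamma z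
  / 2).
  apply: (mulfI two0); rewrite [RHS]mulrCA mulrBr ![2 * (_ / 2)]mulrC !mulfVK //.
  rewrite mulr_natl mulr2n conjcE; case: (bloch_gamma z) => x x'; apply/eqP;
    rewrite eq_complex /=.
  by apply/andP; split; apply/eqP; ring.
move: (a 1%N) (a 2) (a 3) (_ / 2) (_ / 2) => a1 a2 a3 g g'.
apply/matrixP => i j; rewrite !mxE; ring.
Qed.
End KernelRigidity.

Section Ampliation.
Variables (R : realType) (V : vectType R) (A : comCStarAlgebra R) (d s : nat).
Variable phi : V -> 'M[A]_d.

Lemma ampliation_linear (c : R) (x y : tens V (herm R s)) :
  ampliation phi (c *: x + y) = sca A c *: ampliation phi x + ampliation phi y.
Proof.
rewrite /ampliation scaler_sumr -big_split; apply: eq_bigr => i _ /=.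
apply/matrixP => k l; rewrite !mxE !ffunE -[herm_mx _]/(c%:C *: herm_mx (x i) + herm_mx
  (y i)).
rewrite !mxE /= scalerDl mulrDr -scalerA /sca mulr_algl; congr (_ + _).
by rewrite -!scalerAr.
Qed.

Lemma ampliation_sum (T : Type) (r : seq T) (F : T -> tens V (herm R s)) :
  ampliation phi (\sum_(t <- r) F t) = \sum_(t <- r) ampliation phi (F t).
Proof.
elim/big_rec2: _ => [|t x y _ <-].
  have := ampliation_linear (-1) 0 0; rewrite scaler0 addr0 /sca rmorphN1 !scaleN1r addNr.
  by [].
by have := ampliation_linear 1 (F t) y; rewrite scale1r sca1 scale1r.
Qed.
End Ampliation.

(** * Separation for cones with a Lorentz retract *)

Section Retract.
Variables (R : realType) (d : nat).
Local Notation C := R[i].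
Let b := d.
Let N := b.*2.+1.
Local Notation n := (N.+1 + N.+3)%N.

(** The tensor of point and kernel vector. Through [contraction_mx] the equations v E psi(y) = 0
    become linear in it, whatever E and psi are. *)
Definition kernel_tensor (zs : C * R) : 'rV[C]_(4 * n) :=
  \row_k ((kernel_y zs.1 zs.2 0 (mxtens_unindex k).1)%:C
          * kernel_v b zs.1 zs.2 0 (mxtens_unindex k).2).

Definition contraction_mx (E : 'M[C]_(n, d)) (psi : 'rV[R]_4 -> 'M[C]_d) : 'M[C]_(4 * n,
  d) :=
  \matrix_(k, l) (E *m psi (delta_mx 0 (mxtens_unindex k).1)) (mxtens_unindex k).2 l.

Lemma kernel_tensor_contraction E psi zs :
  (forall (c : R) y y', psi (c *: y + y') = c%:C *: psi y + psi y') ->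
  kernel_tensor zs *m contraction_mx E psi =
  kernel_v b zs.1 zs.2 *m E *m psi (kernel_y zs.1 zs.2).
Proof.
move=> psiL; set y := kernel_y _ _; set v := kernel_v _ _ _.
have psi0 : psi 0 = 0.
  have := psiL (-1) 0 0; rewrite scaler0 addr0 rmorphN1 scaleN1r => /eqP.
  by rewrite addNr => /eqP.
have -> : psi y = \sum_i (y 0 i)%:C *: psi (delta_mx 0 i).
  rewrite {1}[y]row_sum_delta; elim/big_rec2: _ => [|i x z _ <-] //.
apply/rowP => l; rewrite mxE sum_mxtens -mulmxA mulmx_sumr mulmx_sumr summxE.
apply: eq_bigr => i _; rewrite -!scalemxAr [RHS]mxE [X in _ = _ * X]mxE mulr_sumr.
by apply: eq_bigr => j _; rewrite [X in X * _]mxE [X in _ * X]mxE mxtens_indexK /= mulrA.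
Qed.

Theorem retract_not_subhomogeneous (V : vectType R) (P : set V) (u : V)
    (io : 'rV[R]_4 -> V) (re : V -> 'rV[R]_4) :
  (forall c y y', io (c *: y + y') = c *: io y + io y') ->
  (forall c p q, re (c *: p + q) = c *: re p + re q) ->
  (forall y, lorentz4 y -> P (io y)) -> (forall p, P p -> lorentz4 (re p)) ->
  cancel io re -> io (apex R) = u -> ~ Pmin_subhomogeneous d P u.
Proof.
move=> ioL reL ioP reP ioK ioapex [A [phi [phiL phis phi1 phiP]]].
have [s [sQ sspan]] := finite_span kernel_tensor (fun zs : C * R => zs.2 ^+ 2 = 1).
pose Y (t : C * R) := kernel_y t.1 t.2; pose v (t : C * R) := kernel_v b t.1 t.2.
pose x0 : tens V (herm R n) := \sum_(t <- s) tpure (io (Y t)) (rank1 (v t)).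
pose M0 := ampliation phi x0.
have M0E : M0 = \sum_(t <- s) phi (io (Y t)) *t map_mx (in_alg A) (rank1 (v t)).
  by rewrite /M0 ampliation_sum; apply: eq_bigr => t _; exact: ampliation_tpure.
have adj_tens m1 m2 (B1 : 'M[A]_m1) (B2 : 'M[A]_m2) : adjmx (B1 *t B2) = adjmx B1 *t
  adjmx B2.
  by apply/matrixP => k l; rewrite adjmxE !mxE starM mulrC.
have adj_herm m (h : herm R m) : adjmx (map_mx (in_alg A) h) = map_mx (in_alg A) h.
  apply/matrixP => k l; rewrite adjmxE !mxE /= star_alg; congr (_ *: _).
  by rewrite [RHS]hermE.
have adjM0 : adjmx M0 = M0.
  rewrite M0E; elim/big_rec: _ => [|t x _ IH]; first exact: adjmx0.
  rewrite -[in RHS]IH -[x in LHS]opprK adjmxB adj_tens adj_herm -[adjmx (phi _)]/(starmx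
    _) phis.
  by congr (_ + _); rewrite -[- x]add0r adjmxB adjmx0 add0r opprK.
pose psi (chi : {rmorphism A -> C}) y := map_mx chi (phi (io y)).
have psiL chi : starchar chi -> forall (c : R) y y',
    psi chi (c *: y + y') = c%:C *: psi chi y + psi chi y'.
  move=> [chiZ _] c y y'; rewrite /psi ioL phiL.
  by apply/matrixP => k l; rewrite !mxE rmorphD rmorphM /= chiZ.
have psi_herm chi : starchar chi -> forall y, (psi chi y)^t* = psi chi y.
  by move=> schi y; rewrite /psi -map_adjmx // -[adjmx _]/(starmx _) phis.
have map_herm chi m (h : herm R m) : starchar chi ->
    map_mx chi (map_mx (in_alg A) h) = h.
  by move=> [chiZ _]; apply/matrixP => k l; rewrite !mxE chiZ.
(* Subhomogeneity at s = 1, from left to right, makes psi positive; the converse direction enters at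
   s = n, for the element [x] below. *)
have psi_psd chi : starchar chi -> forall y, lorentz4 y ->
    forall w : 'rV[C]_d, 0 <= (w *m psi chi y *m w^t*) 0 0.
  move=> schi y ly w; pose xi : 'rV[C]_(d * 1) := \row_k w 0 (mxtens_unindex k).1.
  have Px : Pmin P (tpure (io y) (rank1 (const_mx 1 : 'rV[C]_1))).
    exists 1%N, (fun=> io y), (fun=> rank1 (const_mx 1)); split; last by rewrite big_ord1.
    by move=> _; split; [exact: ioP|exact: psd_rank1].
  move/(phiP 1%N _ isT): Px; rewrite ampliation_tpure // => /(mx_ge0_char xi schi).
  rewrite map_mxT map_herm // (tens_rank1_form _ _ (rank1E _)).
  suff -> : const_mx 1 *m untens xi = w by [].
  by apply/rowP => k; rewrite mxE big_ord1 !mxE mxtens_indexK mul1r.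
have posM0 chi : starchar chi -> posdef (map_mx chi M0).
  move=> schi xi xi0; pose E := untens xi.
  have form : (xi *m map_mx chi M0 *m xi^t*) 0 0 =
      \sum_(t <- s) ((v t *m E) *m psi chi (Y t) *m (v t *m E)^t*) 0 0.
    rewrite M0E map_mx_sum mulmx_sumr mulmx_suml summxE; apply: eq_bigr => t _.
    by rewrite map_mxT map_herm // (tens_rank1_form _ _ (rank1E _)).
  have ge0 t : t \in s -> 0 <= ((v t *m E) *m psi chi (Y t) *m (v t *m E)^t*) 0 0.
    by move=> ts; apply: psi_psd => //; have [] := kernel_witness b t.1 (sQ _ ts).
  rewrite form lt_def big_seq sumr_ge0 // andbT.
  apply: contra_neq xi0 => sum0.
  have ann t : t \in s -> v t *m E *m psi chi (Y t) = 0.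
    move=> ts; apply: psd_null (psi_herm _ schi _) _ _.
      by apply: psi_psd => //; have [] := kernel_witness b t.1 (sQ _ ts).
    move/eqP: sum0; rewrite psumr_eq0 // => /allP /(_ t ts).
    by rewrite ts => /eqP.
  suff E0 : E = 0.
    apply/rowP => k; have := congr1 (fun X : 'M[C]_(n, d) =>
      X (mxtens_unindex k).2 (mxtens_unindex k).1) E0.
    by rewrite !mxE -surjective_pairing mxtens_unindexK.
  apply: (@kernel_rigid _ b _ _ (psi chi)) => [||| z t t2].
  - by rewrite /b; lia.
  - exact: psiL.
  - by rewrite /psi ioapex phi1 map_mx1.
  (* Every kernel tensor lies in the span of those from [s], which [contraction_mx] annihilates. *)
  rewrite -(kernel_tensor_contraction _ (z, t) (psiL _ schi)).
  apply/sub_kermxP; apply: submx_trans (sspan (z, t) t2) _.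
  rewrite big_seq; elim/big_ind: _ => [|B1 B2 sB1 sB2|r rs]; first exact: sub0mx.
    by rewrite addsmx_sub sB1.
  rewrite genmxE; apply/sub_kermxP; rewrite kernel_tensor_contraction; last exact: psiL.
  exact: ann.
have [e e0 ge0] := posdef_shift adjM0 posM0.
pose x := (- e) *: tpure u (herm1 : herm R n) + x0.
have Px : Pmin P x.
  apply/phiP => //; rewrite ampliation_linear ampliation_tpure // phi1.
  suff -> : (sca A (- e) *: (1%:M *t map_mx (in_alg A) (@herm1 R n)) + ampliation phi x0
    : 'M[A]_(d * n))
    = M0 - (sca A e)%:M by [].
  have -> : map_mx (in_alg A) (@herm1 R n) = 1%:M by exact: map_mx1.
  have -> : 1%:M *t 1%:M = 1%:M :> 'M[A]_(d * n).
    apply/matrixP => k l; case: (mxtens_indexP k) => k1 k2;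
      case: (mxtens_indexP l) => l1 l2.
    by rewrite tensmxE !mxE (can_eq (@mxtens_indexK d n)) xpair_eqE -natrM mulnb.
  by rewrite addrC scaN scaleNr scalemx1.
pose f (p : V) (h : herm R n) : R^o := witness_pair (re p) h.
have [|p c h h'|g gE] := @tens_universal _ V (herm R n) R^o f.
- by move=> h c p q; rewrite /f reL witness_pair_linear_y.
- by rewrite /f witness_pair_linear_h.
(* [g] is nonnegative on [Pmin] and vanishes on [x0], so g x is - e times the positive value at the
   unit. *)
have : 0 <= (g x : R).
  have [m [p [h [ph ->]]]] := Px; rewrite linear_sum; apply: sumr_ge0 => k _.
  have [Pp ph'] := ph k; rewrite gE; apply: witness_pair_ge0 => //; exact: reP.
rewrite /x linearD linearZ /= gE linear_sum big_seq big1 => [|t ts]; last first.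
  rewrite gE /f ioK witness_pair_rank1.
  by have [_ ->] := kernel_witness b t.1 (sQ _ ts).
rewrite addr0 /f -ioapex ioK -[_ *: _]/(- e * _) mulNr oppr_ge0 leNgt.
by rewrite mulr_gt0 // witness_pair_apex_gt0.
Qed.
End Retract.

(** * The two cones *)

Section Instances.
Variable R : realType.
Local Notation C := R[i].

Definition row4 (t x1 x2 x3 : R) : 'rV[R]_4 := \row_k nth 0 [:: t; x1; x2; x3] k.

Lemma row4E t x1 x2 x3 : [/\ row4 t x1 x2 x3 0 0 = t, row4 t x1 x2 x3 0 (inord 1) = x1,
  row4 t x1 x2 x3 0 (inord 2) = x2 & row4 t x1 x2 x3 0 (inord 3) = x3].
Proof. by split; rewrite mxE ?inordK. Qed.

Lemma row4_eta (y : 'rV[R]_4) :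
  y = row4 (y 0 0) (y 0 (inord 1)) (y 0 (inord 2)) (y 0 (inord 3)).
Proof.
by apply/rowP => -[[|[|[|[|//]]]] k4]; rewrite mxE /=; congr (y _ _); apply/val_inj;
  rewrite /= ?inordK.
Qed.

Lemma apexE : [/\ apex R 0 0 = 1, apex R 0 (inord 1) = 0,
  apex R 0 (inord 2) = 0 & apex R 0 (inord 3) = 0].
Proof. by split; rewrite mxE -?val_eqE /= ?inordK. Qed.

(** [io] pads with zeros and [re] keeps three space coordinates; dropping coordinates does not
    increase the Euclidean norm. *)
Lemma lorentz_not_subhomogeneous (m d : nat) :
  ~ Pmin_subhomogeneous d (@lorentz R m.+4) (1, 0).
Proof.
pose io (y : 'rV[R]_4) : R^o * 'rV[R]_m.+3 :=
  (y 0 0, \row_j (if (j < 3)%N then y 0 (inord j.+1) else 0)).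
pose re (p : R^o * 'rV[R]_m.+3) : 'rV[R]_4 :=
  row4 p.1 (p.2 0 (inord 0)) (p.2 0 (inord 1)) (p.2 0 (inord 2)).
have sumE (x : 'rV[R]_m.+3) : \sum_j x 0 j ^+ 2 =
    x 0 (inord 0) ^+ 2 + x 0 (inord 1) ^+ 2 + x 0 (inord 2) ^+ 2
    + \sum_(j < m) x 0 (lift ord0 (lift ord0 (lift ord0 j))) ^+ 2.
  rewrite !big_ord_recl !addrA; congr (x _ _ ^+ 2 + x _ _ ^+ 2 + x _ _ ^+ 2 + _);
    by apply/val_inj; rewrite /= inordK.
apply: (@retract_not_subhomogeneous _ d _ _ _ io re).
- move=> c y y'; congr (_, _); first by rewrite !mxE.
  by apply/rowP => j; rewrite !mxE; case: ifP => _; rewrite ?mxE ?mulr0 ?addr0.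
- by move=> c [p x] [q x']; apply/rowP => -[[|[|[|[|//]]]] k4]; rewrite !mxE.
- move=> y [y0 yle]; rewrite /lorentz /= sumE.
  rewrite big1 => [|j _]; last by rewrite mxE /= expr0n.
  rewrite addr0 !mxE !inordK //= -(ger0_norm y0) -sqrtr_sqr ler_wsqrtr //.
- move=> [t x] /= tx; have [e0 e1 e2 e3] := row4E t (x 0 (inord 0)) (x 0 (inord 1)) (x 0
  (inord 2)).
  have t0 : 0 <= t by apply: le_trans tx; exact: sqrtr_ge0.
  split; rewrite /= ?e0 ?e1 ?e2 ?e3 //.
  have s0 : 0 <= \sum_j x 0 j ^+ 2 by apply: sumr_ge0 => j _; exact: sqr_ge0.
  have : \sum_j x 0 j ^+ 2 <= t ^+ 2.
    by rewrite -(sqr_sqrtr s0) lerXn2r ?nnegrE ?sqrtr_ge0.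
  apply: le_trans; rewrite sumE lerDl; apply: sumr_ge0 => j _; exact: sqr_ge0.
- by move=> y; rewrite [RHS]row4_eta /re /io /=; congr row4; rewrite mxE inordK.
have [e0 e1 e2 e3] := apexE; congr (_, _) => //.
apply/rowP => -[[|[|[|j]]] jm]; rewrite [LHS]mxE [RHS]mxE /=;
  [exact: e1|exact: e2|exact: e3|by []].
Qed.

Lemma normsqE (x : C) : `|x| ^+ 2 = (complex.Re x ^+ 2 + complex.Im x ^+ 2)%:C.
Proof.
rewrite normCK conjcE; case: x => p q; apply/eqP; rewrite eq_complex /=.
by apply/andP; split; apply/eqP; ring.
Qed.

Definition qform n (u : 'rV[C]_n) (M : 'M[C]_n) : C := (u *m M *m u^t*) 0 0.

Lemma qformZ n (u : 'rV[C]_n) c M : qform u (c *: M) = c * qform u M.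
Proof. by rewrite /qform -scalemxAr -scalemxAl mxE. Qed.
Lemma qformD n (u : 'rV[C]_n) M M' : qform u (M + M') = qform u M + qform u M'.
Proof. by rewrite /qform mulmxDr mulmxDl mxE. Qed.
Lemma qformB n (u : 'rV[C]_n) M M' : qform u (M - M') = qform u M - qform u M'.
Proof. by rewrite qformD -scaleN1r qformZ mulN1r. Qed.

Lemma qform_pair n (x y : C) (i j : 'I_n) M :
  qform (x *: delta_mx 0 i + y *: delta_mx 0 j) M =
  x * x^* * M i i + x * y^* * M i j + y * x^* * M j i + y * y^* * M j j.
Proof.
pose B (u w : 'rV[C]_n) : C := (u *m M *m w^t*) 0 0.
have Bl c u u' w : B (c *: u + u') w = c * B u w + B u' w.
  by rewrite /B mulmxDl mulmxDl -!scalemxAl !mxE.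
have Br c u u' w : B w (c *: u + u') = c^* * B w u + B w u'.
  have -> : B w (c *: u + u') = (w *m M *m (c^* *: u^t* + u'^t*)) 0 0.
    by congr ((_ *m _) _ _); apply/matrixP => k l; rewrite !mxE rmorphD rmorphM.
  by rewrite /B mulmxDr -scalemxAr !mxE.
have BZl c u w : B (c *: u) w = c * B u w by rewrite /B -!scalemxAl mxE.
have BZr c u w : B w (c *: u) = c^* * B w u.
  have -> : B w (c *: u) = (w *m M *m (c^* *: u^t*)) 0 0.
    by congr ((_ *m _) _ _); apply/matrixP => k l; rewrite !mxE rmorphM.
  by rewrite /B -scalemxAr mxE.
have E k l : B (delta_mx 0 k) (delta_mx 0 l) = M k l.
  have -> : B (delta_mx 0 k) (delta_mx 0 l) = ((delta_mx 0 k : 'rV[C]_n) *m M *m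
    (delta_mx l 0 : 'cV[C]_n)) 0 0.
    by congr ((_ *m _) _ _); apply/matrixP => k' l'; rewrite !mxE rmorph_nat andbC.
  by rewrite -rowE -colE !mxE.
by rewrite /qform -/(B _ _) Bl !Br !BZl !BZr !E; ring.
Qed.

Lemma qform_rank1 n (u v : 'rV[C]_n) :
  qform u (rank1 v) = `|\sum_i u 0 i * v 0 i| ^+ 2.
Proof.
rewrite /qform row_form normCK rmorph_sum mulr_suml; apply: eq_bigr => i _.
by rewrite mulr_sumr; apply: eq_bigr => j _; rewrite rank1E rmorphM /=; ring.
Qed.

(** The value of a hermitian 2 x 2 matrix at (p0 + i q0, p1 + i q1). The factors n1, n2, n3 are the
    Hopf coordinates of that vector, so n1^2 + n2^2 + n3^2 = n0^2 and Cauchy-Schwarz applies. *)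
Lemma bloch_ge0 (t x1 x2 x3 p0 q0 p1 q1 : R) : 0 <= t ->
  x1 ^+ 2 + x2 ^+ 2 + x3 ^+ 2 <= t ^+ 2 ->
  0 <= t * ((p0 ^+ 2 + q0 ^+ 2) + (p1 ^+ 2 + q1 ^+ 2))
    + x1 * (2 * (p0 * p1 + q0 * q1)) + x2 * (2 * (q0 * p1 - p0 * q1))
    + x3 * ((p0 ^+ 2 + q0 ^+ 2) - (p1 ^+ 2 + q1 ^+ 2)).
Proof.
move=> t0 xt; set n0 := _ + (p1 ^+ 2 + q1 ^+ 2).
set n1 := 2 * (p0 * p1 + _); set n2 := 2 * (q0 * p1 - _); set n3 := _ - (p1 ^+ 2 + _).
have n00 : 0 <= n0 by rewrite /n0 !addr_ge0 ?sqr_ge0.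
have nE : n1 ^+ 2 + n2 ^+ 2 + n3 ^+ 2 = n0 ^+ 2 by rewrite /n0 /n1 /n2 /n3; ring.
have CS : (x1 * n1 + x2 * n2 + x3 * n3) ^+ 2 <= (t * n0) ^+ 2.
  have h1 : (x1 * n1 + x2 * n2 + x3 * n3) ^+ 2 <=
      (x1 ^+ 2 + x2 ^+ 2 + x3 ^+ 2) * (n1 ^+ 2 + n2 ^+ 2 + n3 ^+ 2).
    rewrite -subr_ge0.
    have -> : (x1 ^+ 2 + x2 ^+ 2 + x3 ^+ 2) * (n1 ^+ 2 + n2 ^+ 2 + n3 ^+ 2)
      - (x1 * n1 + x2 * n2 + x3 * n3) ^+ 2 = (x1 * n2 - x2 * n1) ^+ 2
      + (x1 * n3 - x3 * n1) ^+ 2 + (x2 * n3 - x3 * n2) ^+ 2 by ring.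
    by rewrite !addr_ge0 ?sqr_ge0.
  apply: le_trans h1 _; rewrite nE exprMn ler_wpM2r ?sqr_ge0 //.
have : `|x1 * n1 + x2 * n2 + x3 * n3| <= t * n0.
  by rewrite -(ger0_norm (mulr_ge0 t0 n00)) -!sqrtr_sqr ler_wsqrtr.
by rewrite ler_norml => /andP[h _]; rewrite -!addrA -lerBlDl sub0r addrA.
Qed.

(** [io] puts the Pauli matrices into the upper left 2 x 2 block but takes t times the full
    identity, which makes it unital; [re] compresses to the block, where t^2 - |x|^2 is the
    determinant. *)
Lemma psd_not_subhomogeneous (k d : nat) :
  ~ Pmin_subhomogeneous d (@psd R k.+2) herm1.
Proof.
pose i0 : 'I_k.+2 := ord0; pose i1 : 'I_k.+2 := lift ord0 ord0.
pose e0 : 'rV[C]_k.+2 := delta_mx 0 i0; pose e1 : 'rV[C]_k.+2 := delta_mx 0 i1.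
(* The Pauli matrices as combinations of rank one matrices, so that their forms are combinations of
   squared moduli. *)
pose hX : herm R k.+2 := rank1 (e0 + e1) - (rank1 e0 + rank1 e1).
pose hY : herm R k.+2 := rank1 (e0 + 'i%C *: e1) - (rank1 e0 + rank1 e1).
pose hZ : herm R k.+2 := rank1 e0 - rank1 e1.
pose io (y : 'rV[R]_4) : herm R k.+2 := y 0 0 *: (herm1 : herm R k.+2) + (y 0 (inord 1)
  *: hX
   + (y 0 (inord 2) *: hY + y 0 (inord 3) *: hZ)).
pose re (h : herm R k.+2) : 'rV[R]_4 := row4
  ((complex.Re (h i0 i0) + complex.Re (h i1 i1)) / 2) (complex.Re (h i0 i1))
  (- complex.Im (h i0 i1)) ((complex.Re (h i0 i0) - complex.Re (h i1 i1)) / 2).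
have mxE2 (c : R) (h h' : herm R k.+2) :
  herm_mx (c *: h + h') = c%:C *: herm_mx h + herm_mx h' by [].
have hXE : herm_mx hX =
    herm_mx (rank1 (e0 + e1)) - (herm_mx (rank1 e0) + herm_mx (rank1 e1)) by [].
have hYE : herm_mx hY =
    herm_mx (rank1 (e0 + 'i%C *: e1)) - (herm_mx (rank1 e0) + herm_mx (rank1 e1)) by [].
have hZE : herm_mx hZ = herm_mx (rank1 e0) - herm_mx (rank1 e1) by [].
have ioE y : herm_mx (io y) = (y 0 0)%:C *: 1%:M + ((y 0 (inord 1))%:C *: herm_mx hX
   + ((y 0 (inord 2))%:C *: herm_mx hY + (y 0 (inord 3))%:C *: herm_mx hZ)) by [].
have ImL (c : R) (x x' : C) :
    complex.Im (c%:C * x + x') = c * complex.Im x + complex.Im x'.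
  by case: x x' => [? ?] [? ?] /=; rewrite mul0r addr0.
apply: (@retract_not_subhomogeneous _ d _ _ _ io re).
- move=> c y y'; rewrite /io !mxE; move: (herm1) (hX) (hY) (hZ) => h1 h2 h3 h4.
  rewrite !scalerDr !scalerDl -!scalerA.
  by rewrite [RHS]addrACA; congr (_ + _); rewrite [RHS]addrACA; congr (_ + _);
    rewrite [RHS]addrACA.
- move=> c p q; rewrite /re mxE2; apply/rowP => -[[|[|[|[|//]]]] k4];
  rewrite !mxE /= ?Re_linear ?ImL; ring.
- move=> y [y0 yle] u; rewrite -/(qform u _) ioE 3!qformD 4!qformZ hXE hYE hZE.
  rewrite 3!qformB qformD !qform_rank1.
  have s0 : \sum_i u 0 i * e0 0 i = u 0 i0.
    by rewrite (bigD1 i0) //= mxE !eqxx mulr1 big1 ?addr0 // => i /negPf ii;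
      rewrite mxE ii andbF mulr0.
  have s1 : \sum_i u 0 i * e1 0 i = u 0 i1.
    by rewrite (bigD1 i1) //= mxE !eqxx mulr1 big1 ?addr0 // => i /negPf ii;
      rewrite mxE ii andbF mulr0.
  have sX : \sum_i u 0 i * (e0 + e1) 0 i = u 0 i0 + u 0 i1.
    by rewrite -s0 -s1 -big_split; apply: eq_bigr => i _; rewrite [X in _ * X]mxE mulrDr.
  have sY : \sum_i u 0 i * (e0 + 'i%C *: e1) 0 i = u 0 i0 + 'i%C * u 0 i1.
    rewrite -s0 -s1 mulr_sumr -big_split; apply: eq_bigr => i _.
    by rewrite [X in _ * X]mxE mulrDr [X in _ + _ * X]mxE mulrCA.
  have s1M : qform u 1%:M = `|u 0 i0| ^+ 2 + `|u 0 i1| ^+ 2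
      + \sum_(j < k) `|u 0 (lift ord0 (lift ord0 j))| ^+ 2.
    rewrite /qform mulmx1 mxE !big_ord_recl !addrA.
    by congr (_ + _ + _); [..|apply: eq_bigr => j _]; rewrite !mxE normCK.
  rewrite s1M s0 s1 sX sY mulrDr -addrA addrCA.
  have rest : 0 <= (y 0 0)%:C * \sum_(j < k) `|u 0 (lift ord0 (lift ord0 j))| ^+ 2.
    by rewrite mulr_ge0 ?lecR // sumr_ge0 // => j _; rewrite exprn_ge0.
  apply: addr_ge0 rest _.
  move: (u 0 i0) (u 0 i1) => [p0 q0] [p1 q1]; rewrite !normsqE /=.
  have B0 := bloch_ge0 p0 q0 p1 q1 y0 yle.
  move: B0; set e := (X in 0 <= X -> _) => B0.
  rewrite [X in 0 <= X](_ : _ = e%:C) ?lecR // /e; apply/eqP; rewrite eq_complex /=.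
  by apply/andP; split; apply/eqP; ring.
- move=> h ph; have [r0 r1 r2 r3] := row4E ((complex.Re (h i0 i0) + complex.Re (h i1 i1))
  / 2)
    (complex.Re (h i0 i1)) (- complex.Im (h i0 i1))
    ((complex.Re (h i0 i0) - complex.Re (h i1 i1)) / 2).
  rewrite /lorentz4 /= /re r0 r1 r2 r3.
  have form x y := qform_pair x y i0 i1 h.
  have h10 : h i1 i0 = (h i0 i1)^* by rewrite [LHS]hermE.
  have real i : h i i = (complex.Re (h i i))%:C.
    have := hermE h i i; rewrite conjcE; case: (h i i) => p q /= [/eqP].
    by rewrite -addr_eq0 -mulr2n mulrn_eq0 /= => /eqP ->.
  set a := complex.Re (h i0 i0) in form *; set e := complex.Re (h i1 i1) in form *.
  have a0 : 0 <= a.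
    have := ph e0; rewrite -/(qform _ _) -[e0]addr0 -(scale0r e1) -[e0]scale1r form.
    by rewrite conjC0 rmorph1 !mul0r !mulr0 !mul0r !addr0 !mul1r real lecR.
  have e0' : 0 <= e.
    have := ph e1; rewrite -/(qform _ _) -[e1]add0r -(scale0r e0) -[e1]scale1r form.
    by rewrite conjC0 rmorph1 !mul0r !mulr0 !mul0r !add0r !mul1r real lecR.
  have hle : complex.Re (h i0 i1) ^+ 2 + complex.Im (h i0 i1) ^+ 2 <= a * e.
    move: a0; rewrite le_eqVlt => /orP[/eqP a0|a0].
      have hh : (herm_mx h)^t* = h by apply/matrixP => i j; rewrite !mxE -hermE.
      have /(congr1 (fun X : 'rV[C]_k.+2 => X 0 i1)) : e0 *m h = 0.
        apply: psd_null hh ph _; rewrite -/(qform _ _) -[e0]addr0 -(scale0r e1)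
          -[e0]scale1r.
        by rewrite form conjC0 rmorph1 !mul0r !mulr0 !mul0r !addr0 !mul1r real -/a -a0.
      by rewrite -rowE !mxE => ->; rewrite /= expr0n addr0 -a0 mul0r.
    (* The form at this vector is a (a e - |h01|^2), the pivot times the determinant. *)
    have := ph (- (h i0 i1)^* *: e0 + a%:C *: e1); rewrite -/(qform _ _) form h10.
    rewrite real (real i1) -/a -/e; case: (h i0 i1) => c1 c2.
    rewrite [X in 0 <= X](_ : _ = (a * (a * e - (c1 ^+ 2 + c2 ^+ 2)))%:C); last first.
      by rewrite !conjcE; apply/eqP; rewrite eq_complex /=; apply/andP; split; apply/eqP;
        ring.
    by rewrite lecR pmulr_rge0 // subr_ge0.
  split; first by rewrite divr_ge0 // addr_ge0.
  rewrite sqrrN -subr_ge0.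
  have -> : ((a + e) / 2) ^+ 2 - (complex.Re (h i0 i1) ^+ 2 + complex.Im (h i0 i1) ^+ 2
    + ((a - e) / 2) ^+ 2) = a * e - (complex.Re (h i0 i1) ^+ 2 + complex.Im (h i0 i1) ^+
      2) by field.
  by rewrite subr_ge0.
- move=> y; rewrite [RHS]row4_eta /re ioE hXE hYE hZE.
  have E (c0 c1 c2 c3 : C) (B B' D D' : 'M[C]_k.+2) i j :
      (c0 *: 1%:M + (c1 *: (B - (D + D')) + (c2 *: (B' - (D + D')) + c3 *: (D - D')))) i j =
      c0 * (i == j)%:R + (c1 * (B i j - (D i j + D' i j)) +
      (c2 * (B' i j - (D i j + D' i j)) + c3 * (D i j - D' i j))) by rewrite !mxE.
  rewrite !E !rank1E !mxE !conjcE /= !(mulr0, mul0r, mulr1, mul1r, oppr0, addr0, add0r,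
    subr0, sub0r).
  by congr row4; field.
have [a0 a1 a2 a3] := apexE.
by rewrite /io a0 a1 a2 a3 scale1r !scale0r !addr0.
Qed.
End Instances.

Theorem theorem2p3 (R : realType) (k m d : nat) :
  (2 <= k)%N -> (4 <= m)%N -> (0 < d)%N ->
  ~ Pmin_subhomogeneous d (@psd R k) herm1 /\
  ~ Pmin_subhomogeneous d (@lorentz R m) (1, 0).
Proof.
move=> k2 m4 _; split.
  by case: k k2 => [|[|k]] // _; exact: psd_not_subhomogeneous.
by case: m m4 => [|[|[|[|m]]]] // _; exact: lorentz_not_subhomogeneous.
Qed.
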